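(* Let $z\in\mathbb{C}$. For $N\ge 2$ let $\mathscr{O}_{1,1}^{\mathrm{Sph}(N)}$ denote the diagonal overlap associated with the eigenvalue $\lambda_1$ of a matrix distributed according to the spherical ensemble $\mathrm{Sph}(N)$. Then, conditionally on the event $\{\lambda_1=z\}$, $$\mathbb{E}\left(\mathscr{O}_{1,1}^{\mathrm{Sph}(N)}\right)=N \qquad\text{for every } N,$$ and $$\frac1N\,\mathscr{O}_{1,1}^{\mathrm{Sph}(N)}\ \xrightarrow[N\to\infty]{d}\ \frac{1}{\gamma_2},$$ where $\gamma_2$ is a random variable with density $t e^{-t}\mathbf{1}_{t>0}$.
   Context: $\mathrm{Sph}(N)$ is the law of $G=G_1G_2^{-1}$, where $G_1,G_2$ are independent $N\times N$ complex Ginibre matrices (i.i.d. centered complex Gaussian entries). The spectrum is almost surely simple; the eigenvalues $\lambda_1,\dots,\lambda_N$ are labelled exchangeably (uniformly random labelling). Overlaps: for a matrix $G$ with simple spectrum, let $R_j$ be right eigenvectors (columns) and $L_j$ left eigenvectors (rows) with $GR_j=\lambda_jR_j$, $L_jG=\lambda_jL_j$, $L_iR_j=\delta_{ij}$. Then $\mathscr{O}_{i,j}=(L_iL_j^* )(R_j^*R_i)$; this does not depend on the choice of such eigenvectors and is invariant under unitary change of basis. Schur form and conditioning: $G$ can be written $G=UTU^*$ with $U$ unitary (suitably chosen at random) and $T$ upper triangular with diagonal $(\lambda_1,\dots,\lambda_N)$, such that $T$ has density proportional to $\prod_{i<j}|\lambda_i-\lambda_j|^2\det(I_N+TT^* )^{-2N}$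 with respect to Lebesgue measure on all diagonal and strictly upper-triangular complex entries. The overlaps of $G$ equal those of $T$. Conditioning on $\{\lambda_1=z\}$ means taking the law of $T$ obtained by setting $T_{1,1}=z$ in this density and renormalizing. *)

(* Defs.v *)
From HB Require Import structures.
From mathcomp Require Import all_boot all_order all_algebra.
From mathcomp Require Import complex.
From mathcomp Require Import all_classical all_reals all_analysis.

Set Implicit Arguments.
Unset Strict Implicit.
Unset Printing Implicit Defensive.

Import Order.TTheory GRing.Theory Num.Theory.
Import numFieldNormedType.Exports.

Local Open Scope classical_set_scope.
Local Open Scope ring_scope.
Local Open Scope complex_scope.
Local Open Scope sesquilinear_scope.

Section Overlaps.
Variables (R : realType) (N : nat).
Implicit Types (G : 'M[R[i]]_N) (lam : 'I_N -> R[i]).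

(* The columns of [Rs] are the right eigenvectors R_j, the rows of [Ls] the
   left eigenvectors L_i; the first clause says that the spectrum is simple. *)
Definition biorthogonal_eigenvectors G lam (Rs Ls : 'M[R[i]]_N) : Prop :=
  [/\ injective lam,
      forall j, G *m col j Rs = lam j *: col j Rs,
      forall j, row j Ls *m G = lam j *: row j Ls
    & forall i j, (row i Ls *m col j Rs) 0 0 = (i == j)%:R].

(* O_{i,j} is the product of L_i L_j^* and R_j^* R_i; it does not depend on the
   choice of eigenvectors. The value is 0 if [lam] is not a labelling of a
   simple spectrum. *)
Definition overlap G lam (i j : 'I_N) : R[i] :=
  let RL := xget (0, 0)
    [set RL | biorthogonal_eigenvectors G lam RL.1 RL.2] in
  (row i RL.2 *m (row j RL.2)^t*) 0 0 * ((col j RL.1)^t* *m col i RL.1) 0 0.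

(* Diagonal overlaps are nonnegative real numbers. *)
Definition diag_overlap G lam (i : 'I_N) : R := complex.Re (overlap G lam i i).

End Overlaps.

(* Coordinates on upper triangular matrices with a prescribed (0, 0) entry: the
   other entries (i, j), i <= j, are listed column by column, so that (i, j) has
   index 'C(j.+1, 2) + i once (0, 0) is put in front. A complex number is given
   by its real and imaginary parts. *)
Notation schur_coords R N :=
  ('C(N.+1, 2).-1.-tuple (measurableTypeR R * measurableTypeR R)%type).

Definition schur_mx (R : realType) (N : nat) (z : R[i])
    (t : schur_coords R N) : 'M[R[i]]_N :=
  \matrix_(i, j)
    if (i <= j)%N then (z :: [seq x.1 +i* x.2 | x <- t])`_('C(j.+1, 2) + i)
    else 0.

(* The unnormalized Schur density of Sph(N), which is real. *)
Definition sph_weight (R : realType) (N : nat) (T : 'M[R[i]]_N) : R :=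
  complex.Re ((\prod_(i < N) \prod_(j < N | (i < j)%N) `|T i i - T j j| ^+ 2)
              / \det (1%:M + T *m T^t*) ^+ (2 * N)).

Section LebesgueMeasure.
Variable R : realType.
Local Notation C := (measurableTypeR R * measurableTypeR R)%type.

Definition lebesgue_complex : set C -> \bar R :=
  (@lebesgue_measure R \x @lebesgue_measure R)%E.

HB.instance Definition _ := Measure.on lebesgue_complex.

Let sigma_finite_lebesgue_complex : sigma_finite setT lebesgue_complex.
Proof.
have /sigma_finiteP[F [TF ndF Foo]] := sigma_finiteT (@lebesgue_measure R).
exists (fun n => F n `*` F n).
  rewrite -setXTT TF predeqE => -[x y]; split => [[]|].
    move=> [n _ Fnx] [k _ Fky]; exists (maxn n k) => //; split.
    - by have /subsetPset := ndF n _ (leq_maxl n k); exact.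
    - by have /subsetPset := ndF k _ (leq_maxr n k); exact.
  by move=> [n _ [/= Fnx Fny]]; split; exists n.
move=> k; have [mFk Fkoo] := Foo k; split; first exact: measurableX.
rewrite /lebesgue_complex product_measure1E//.
by rewrite lte_mul_pinfty// ge0_fin_numE.
Qed.

HB.instance Definition _ := Measure_isSigmaFinite.Build _ _ _
  lebesgue_complex sigma_finite_lebesgue_complex.

Definition tuple_rcons n (p : n.-tuple C * C) : n.+1.-tuple C :=
  [tuple of rcons p.1 p.2].

Lemma measurable_tuple_rcons n : measurable_fun setT (@tuple_rcons n).
Proof.
apply/measurable_fun_tnthP => i.
have [lein|ltni] := ltnP i n.
  apply: (eq_measurable_fun (fun p => tnth p.1 (Ordinal lein))) => [p _|].
    by rewrite /= !(tnth_nth point) /= nth_rcons size_tuple lein.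
  exact: (measurableT_comp (measurable_tnth _) measurable_fst).
apply: (eq_measurable_fun snd) => [p _|]; last exact: measurable_snd.
have ein : i = n :> nat by apply/eqP; rewrite eqn_leq ltni -ltnS ltn_ord.
by rewrite /= (tnth_nth point) /= ein nth_rcons size_tuple ltnn eqxx.
Qed.

(* [n]-fold power of [lebesgue_complex]. The long constant is the measure
   structure on [pushforward], which cannot be inferred as it takes a proof of
   measurability. *)
Fixpoint lebesgue_tuple n : {measure set (n.-tuple C) -> \bar R} :=
  if n is m.+1 then
    measure_function_pushforward__canonical__measure_function_Measure
      (lebesgue_tuple m \x lebesgue_complex)%E (@measurable_tuple_rcons m)
  else \d_([tuple] : 0.-tuple C).

End LebesgueMeasure.

Section Laws.
Context d d' (W : measurableType d) (T : measurableType d') (R : realType).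

Definition has_density (mu : {measure set T -> \bar R}) (f : T -> R)
    (P : probability W R) (X : {RV P >-> T}) : Prop :=
  forall A, measurable A -> P (X @^-1` A) = (\int[mu]_(x in A) (f x)%:E)%E.

End Laws.

(* The law of [X] is that of the Schur form T of Sph(N) conditioned on
   T_{1,1} = z: the density is restricted to {T_{1,1} = z} and renormalized. *)
Definition sph_schur_law_given (R : realType) (N : nat) (z : R[i])
    (d : measure_display) (W : measurableType d) (P : probability W R)
    (X : {RV P >-> schur_coords R N}) : Prop :=
  exists c : R,
    has_density (lebesgue_tuple R _) (fun t => c * sph_weight (schur_mx z t)) X.

Definition gamma2_pdf (R : realType) (t : R) : R :=
  if 0 < t then t * expR (- t) else 0.

Definition cvg_in_law (R : realType) (d : nat -> measure_display)
    (W : forall n, measurableType (d n)) (P : forall n, probability (W n) R)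
    (X : forall n, W n -> R) (d' : measure_display) (W' : measurableType d')
    (P' : probability W' R) (Y : W' -> R) : Prop :=
  forall f : R -> R, continuous f -> (exists M, forall x, `|f x| <= M) ->
    'E_(P n)[f \o X n]%E @[n --> \oo] --> 'E_P'[f \o Y]%E.

(* Main.v *)
(** Let T_k be the leading k x k block of T, L its left eigenvector for z with
first entry 1, and S = |L|^2, so that the overlap is the final value of S.
Adding a column u and an eigenvalue l multiplies det(1 + T T^* ) by
1 + |l|^2 + u^* M^-1 u, where M = 1 + T_k T_k^*, and adds |L u|^2 / |z - l|^2
to S; moreover L M L^* = (1 + |z|^2) S.  Integrating over u therefore leaves S
multiplied by 1 + kappa(l) |v|^2 with v distributed like a Cauchy variable and
kappa(l) = (1 + |z|^2)(1 + |l|^2) / |z - l|^2.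

Up to a constant, the Vandermonde determinant of the other eigenvalues is the
determinant of the functions (l - z)^a (1 + z^* l)^(N-2-a), a <= N - 2, which are
orthogonal for every weight on the Riemann sphere invariant under rotation
around z, such as a function of kappa(l) against (1 + |l|^2)^-N dl.  Hence only
the diagonal terms survive and each eigenvalue acts on the law of S by an
operator depending on a only: S is multiplied by the inverse of an independent
Beta(a + 2, 1) variable.  These operators commute, so in the end 1 / S has
density proportional to u (1 - u)^(N-2) on (0, 1).  The mean of S is then a Beta
integral, and the density of N / S converges to t exp(- t) by dominated
convergence. *)
Require Import Defs.
From HB Require Import structures.
From mathcomp Require Import all_boot all_order all_algebra.
From mathcomp Require Import complex.
From mathcomp Require Import all_classical all_reals all_analysis.
From mathcomp Require Import measurable_realfun.
From mathcomp Require Import ring lra zify.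

Set Implicit Arguments.
Unset Strict Implicit.
Unset Printing Implicit Defensive.

Import Order.TTheory GRing.Theory Num.Theory.
Import numFieldNormedType.Exports.

Local Open Scope classical_set_scope.
Local Open Scope ring_scope.
Local Open Scope complex_scope.

(** * Integration over the complex plane *)

(** Up to the final limit every integrand is nonnegative with values in [0, +oo], so Tonelli applies
    throughout. The constants produced by the integrations are kept as an unevaluated [K], chosen
    before the test function F; their product is fixed only at the end, by F = 1. Polar coordinates
    are avoided: radial integration and the inversion c |-> 1 / c follow from the uniqueness of Haar
    measure, and orthogonality from averaging over finitely many rotations by roots of unity. The
    obstacle to removing eigenvalues one at a time is that the squared modulus of a Vandermonde
    determinant does not factor. Expanded along its last column it leaves, once the cross terms are
    gone, a sum of weights of the same shape with one exponent removed. The induction therefore runs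
    over arbitrary injective families of exponents bounded by a fixed M. The terms of the sum apply
    the same operators in different orders, and commutation merges them. The factors |z - l|^2 stay
    outside the determinant, where they compensate the singularity of kappa at l = z. *)

Section Prelim.
Context d (T : measurableType d) (R : realType).

(** Inversion is continuous away from 0, and {0}, where it takes the default value 0, is
    measurable. *)
Lemma measurable_fun_inv (f : T -> R) :
  measurable_fun setT f -> measurable_fun setT (fun x => (f x)^-1).
Proof.
move=> mf; apply: (measurable_comp (F := setT)) mf => //.
have -> : [set: R] = [set x | x != 0] `|` [set 0 : R].
  by apply/seteqP; split => x //= _; case: (eqVneq x 0); [right|left].
have m0 : measurable [set 0 : R] by [].
have mn0 : measurable [set x : R | x != 0].
  have -> : [set x : R | x != 0] = ~` [set 0].
    by apply/seteqP; split => x /=; [move/eqP|move/eqP].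
  exact: measurableC.
apply/measurable_funU => //; split; last first.
  exact: measurable_fun_set1.
apply: open_continuous_measurable_fun.
  have -> : [set x : R | x != 0] = ~` [set 0].
    by apply/seteqP; split => x /=; [move/eqP|move/eqP].
  by apply: closed_openC; exact: closed_eq.
by move=> x /[!inE] /= x0; exact: inv_continuous.
Qed.

Lemma ge0_integralTZl (m : {measure set T -> \bar R}) (f : T -> \bar R) (k : \bar R) :
  measurable_fun setT f -> (forall x, 0 <= f x)%E -> (0 <= k)%E ->
  (\int[m]_x (k * f x) = k * \int[m]_x f x)%E.
Proof. by move=> mf f0 k0; apply: ge0_integralZl. Qed.

End Prelim.

Section FstSnd.
Context d1 d2 d3 (X : measurableType d1) (Y : measurableType d2) (Z : measurableType d3).

Lemma measurable_comp_fst (h : X -> Z) : measurable_fun setT h ->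
  measurable_fun setT (fun p : X * Y => h p.1).
Proof. by move=> mh; exact: (measurableT_comp mh measurable_fst). Qed.

Lemma measurable_comp_snd (h : Y -> Z) : measurable_fun setT h ->
  measurable_fun setT (fun p : X * Y => h p.2).
Proof. by move=> mh; exact: (measurableT_comp mh measurable_snd). Qed.

End FstSnd.

Section Tonelli.
Context d1 d2 (X : measurableType d1) (Y : measurableType d2) (R : realType).
Variables (m1 : {sigma_finite_measure set X -> \bar R})
  (m2 : {sigma_finite_measure set Y -> \bar R}).
Local Open Scope ereal_scope.

Lemma measurable_integral2 (f : X -> Y -> \bar R) :
  measurable_fun setT (fun p : X * Y => f p.1 p.2) ->
  (forall x y, 0 <= f x y) ->
  measurable_fun setT (fun x => \int[m2]_y f x y).
Proof.
move=> mf f0.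
exact: (@measurable_fun_fubini_tonelli_F _ _ X Y R m2
  (fun p => f p.1 p.2) mf (fun p => f0 p.1 p.2)).
Qed.

Lemma integral_swap (f : X -> Y -> \bar R) :
  measurable_fun setT (fun p : X * Y => f p.1 p.2) ->
  (forall x y, 0 <= f x y) ->
  \int[m1]_x \int[m2]_y f x y = \int[m2]_y \int[m1]_x f x y.
Proof.
move=> mf f0.
exact: (@fubini_tonelli _ _ X Y R m1 m2
  (fun p => f p.1 p.2) mf (fun p => f0 p.1 p.2)).
Qed.

End Tonelli.

Section Affine.
Context {R : realType}.
Local Notation mu := (@lebesgue_measure R).
Local Open Scope ereal_scope.

Lemma measurable_affine (a b : R) :
  measurable_fun setT ((fun x => a * x + b)%R : measurableTypeR R -> measurableTypeR R).
Proof. by apply: measurable_funD => //; apply: measurable_funM. Qed.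

(** Lebesgue measure is characterised by its values on half-open intervals, so the rescaled image
    measure is compared with it there only. *)
Lemma lebesgue_measure_affine (a b : R) (A : set (measurableTypeR R)) : a != 0%R ->
  measurable A -> mu A = `|a|%:E * pushforward mu (fun x => a * x + b)%R A.
Proof.
move=> a0 mA.
pose nu := mscale (NngNum (normr_ge0 a))
  (measure_function_pushforward__canonical__measure_function_Measure
     mu (measurable_affine a b)).
apply: (@lebesgue_measure_unique R nu) mA => _ [[x y] _ <-].
rewrite /nu /= /mscale/= /pushforward /=.
have na : (0 < `|a|)%R by rewrite normr_gt0.
have [a_lt0|a_gt0|/eqP] := ltgtP a 0%R; last by rewrite (negbTE a0).
  (* For a < 0 the preimage is closed on the left instead of the right, which does not change its
     length. *)
  have -> : (fun x0 => a * x0 + b)%R @^-1` `]x, y] =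
      [set` `[((y - b) / a)%R, ((x - b) / a)%R[ ].
    apply/seteqP; split => t /=; rewrite !in_itv/= ler_ndivrMr// ltr_ndivlMr//.
      by move=> /andP[]; lra.
    by move=> /andP[]; lra.
  rewrite !lebesgue_measure_itv/= !lte_fin ltr_ndivrMr// divfK// ltrD2r.
  case: ifP; rewrite ?mule0// => xy; rewrite -EFinD -EFinM; congr EFin.
  by rewrite ltr0_norm//; field.
have -> : (fun x0 => a * x0 + b)%R @^-1` `]x, y] =
      [set` `]((x - b) / a)%R, ((y - b) / a)%R] ].
  apply/seteqP; split => t /=; rewrite !in_itv/= ltr_pdivrMr// ler_pdivlMr//.
    by move=> /andP[]; lra.
  by move=> /andP[]; lra.
rewrite !lebesgue_measure_itv/= !lte_fin ltr_pdivrMr// divfK// ltrD2r.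
case: ifP; rewrite ?mule0// => xy; rewrite -EFinD -EFinM; congr EFin.
by rewrite gtr0_norm//; field.
Qed.

Lemma ge0_integral_affine (a b : R) (f : R -> \bar R) : a != 0%R ->
  measurable_fun setT f -> (forall x, 0 <= f x) ->
  \int[mu]_x f (a * x + b)%R = (`|a|^-1)%:E * \int[mu]_x f x.
Proof.
move=> a0 mf f0; have na : (0 < `|a|)%R by rewrite normr_gt0.
pose nu := mscale (NngNum (normr_ge0 a))
  (measure_function_pushforward__canonical__measure_function_Measure
     mu (measurable_affine a b)).
have -> : \int[mu]_x f x = \int[nu]_x f x.
  by apply: eq_measure_integral => A mA _; exact: lebesgue_measure_affine.
rewrite ge0_integral_mscale//= muleA -EFinM mulVf ?gt_eqF// mul1e.
by rewrite ge0_integral_pushforward//; exact: measurable_affine.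
Qed.

End Affine.

Section ComplexMeasurable.
Context {R : realType}.
Local Notation CR := (measurableTypeR R * measurableTypeR R)%type.

Definition toC (c : CR) : R[i] := c.1 +i* c.2.
Definition ofC (x : R[i]) : CR := (complex.Re x, complex.Im x).
Definition absq (x : R[i]) : R := complex.Re x ^+ 2 + complex.Im x ^+ 2.

Lemma toCK : cancel toC ofC. Proof. by case. Qed.
Lemma ofCK : cancel ofC toC. Proof. by case. Qed.

Lemma absq_ge0 x : 0 <= absq x.
Proof. by rewrite addr_ge0// sqr_ge0. Qed.

Lemma mul_conj_absq (x : R[i]) : x * x^* = (absq x)%:C.
Proof. by case: x => a b; rewrite /absq; simpc; congr (_ +i* _)%C; ring. Qed.

Lemma absqM x y : absq (x * y) = absq x * absq y.
Proof. by case: x y => [a b] [c e]; rewrite /absq /=; ring. Qed.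

Lemma absqN x : absq (- x) = absq x.
Proof. by case: x => a b; rewrite /absq /=; ring. Qed.

Lemma absq1 : absq 1 = 1. Proof. by rewrite /absq /=; ring. Qed.
Lemma absq0 : absq 0 = 0. Proof. by rewrite /absq /=; ring. Qed.

Lemma absqX x n : absq (x ^+ n) = absq x ^+ n.
Proof. by elim: n => [|n ih]; rewrite ?expr0 ?absq1// !exprS absqM ih. Qed.

Lemma absq_eq0 x : (absq x == 0) = (x == 0).
Proof.
case: x => a b; rewrite /absq /= paddr_eq0 ?sqr_ge0// !sqrf_eq0.
by rewrite eq_complex.
Qed.

Lemma absq_gt0 x : (0 < absq x) = (x != 0).
Proof. by rewrite lt_neqAle absq_ge0 eq_sym absq_eq0 andbT. Qed.

Lemma absqV x : absq x^-1 = (absq x)^-1.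
Proof.
have [->|x0] := eqVneq x 0; first by rewrite invr0 absq0 invr0.
have a0 : absq x != 0 by rewrite absq_eq0.
by apply: (mulIf a0); rewrite mulVf// -absqM mulVf// absq1.
Qed.

Lemma absqJ x : absq (x^*) = absq x.
Proof. by case: x => a b; rewrite /absq /= sqrrN. Qed.

Lemma absq_real (r : R) : absq r%:C = r ^+ 2.
Proof. by rewrite /absq /= expr0n addr0. Qed.

Lemma absqB x y : absq (x - y) = absq (y - x).
Proof. by rewrite -opprB absqN. Qed.

Lemma normc_absq (x : R[i]) : `|x| ^+ 2 = (absq x)%:C.
Proof. by rewrite normCK mul_conj_absq. Qed.

Definition cmeas d (T : measurableType d) (f : T -> R[i]) :=
  measurable_fun setT (fun x => ofC (f x)).

Section Closure.
Context d (T : measurableType d).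
Implicit Types f g : T -> R[i].

Lemma cmeasP f : cmeas f <-> measurable_fun setT (fun x => complex.Re (f x) : R) /\
  measurable_fun setT (fun x => complex.Im (f x) : R).
Proof.
split => [mf|[m1 m2]]; last exact: measurable_fun_pair.
by split; [exact: (measurableT_comp measurable_fst mf)
          |exact: (measurableT_comp measurable_snd mf)].
Qed.

Lemma cmeas_eq f g : f =1 g -> cmeas g -> cmeas f.
Proof. by move=> /funext ->. Qed.

Lemma cmeas_cst (c : R[i]) : cmeas (fun _ : T => c).
Proof. exact: measurable_cst. Qed.

Lemma cmeasD f g : cmeas f -> cmeas g -> cmeas (fun x => f x + g x).
Proof.
move=> /cmeasP[f1 f2] /cmeasP[g1 g2]; apply/cmeasP; split.
  rewrite (_ : (fun _ => _) = (fun x => complex.Re (f x) + complex.Re (g x))).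
    exact: measurable_funD.
  by apply/funext => x; case: (f x) (g x) => [? ?] [].
rewrite (_ : (fun _ => _) = (fun x => complex.Im (f x) + complex.Im (g x))).
  exact: measurable_funD.
by apply/funext => x; case: (f x) (g x) => [? ?] [].
Qed.

Lemma cmeasM f g : cmeas f -> cmeas g -> cmeas (fun x => f x * g x).
Proof.
move=> /cmeasP[f1 f2] /cmeasP[g1 g2]; apply/cmeasP; split.
  rewrite (_ : (fun _ => _) = (fun x => complex.Re (f x) * complex.Re (g x) -
     complex.Im (f x) * complex.Im (g x))).
    by apply: measurable_funB; exact: measurable_funM.
  by apply/funext => x; case: (f x) (g x) => [? ?] [].
rewrite (_ : (fun _ => _) = (fun x => complex.Re (f x) * complex.Im (g x) +
     complex.Im (f x) * complex.Re (g x))).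
  by apply: measurable_funD; exact: measurable_funM.
by apply/funext => x; case: (f x) (g x) => [? ?] [].
Qed.

Lemma cmeasJ f : cmeas f -> cmeas (fun x => (f x)^*).
Proof.
move=> /cmeasP[f1 f2]; apply/cmeasP; split.
  by rewrite (_ : (fun _ => _) = (fun x => complex.Re (f x)))//; apply/funext => x; case: (f x).
rewrite (_ : (fun _ => _) = (fun x => - complex.Im (f x))).
  exact: measurableT_comp.
by apply/funext => x; case: (f x).
Qed.

Lemma cmeas_real (f : T -> R) : measurable_fun setT f -> cmeas (fun x => (f x)%:C).
Proof. by move=> mf; apply/cmeasP; split => //=; exact: measurable_cst. Qed.

Lemma cmeasN f : cmeas f -> cmeas (fun x => - f x).
Proof.
move=> mf; apply: (cmeas_eq (g := fun x => (- 1) * f x)) => [x|].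
  by rewrite mulN1r.
by apply: cmeasM => //; exact: cmeas_cst.
Qed.

Lemma cmeasB f g : cmeas f -> cmeas g -> cmeas (fun x => f x - g x).
Proof. by move=> mf mg; apply: cmeasD => //; exact: cmeasN. Qed.

Lemma measurable_Re f : cmeas f -> measurable_fun setT (fun x => complex.Re (f x) : R).
Proof. by move=> /cmeasP[]. Qed.

Lemma measurable_absq f : cmeas f -> measurable_fun setT (fun x => absq (f x)).
Proof.
by move=> /cmeasP[f1 f2]; apply: measurable_funD; exact: measurable_funX.
Qed.

Lemma cmeasV f : cmeas f -> cmeas (fun x => (f x)^-1).
Proof.
move=> mf; apply: (cmeas_eq (g := fun x => (f x)^* * ((absq (f x))^-1)%:C)) => [x|].
  have [->|x0] := eqVneq (f x) 0; first by rewrite invr0 rmorph0 mul0r.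
  apply: (mulfI x0); rewrite mulrA mul_conj_absq mulfV// -rmorphM/= mulfV//.
  by rewrite absq_eq0.
apply: cmeasM; first exact: cmeasJ.
by apply: cmeas_real; apply: measurable_fun_inv; exact: measurable_absq.
Qed.

Lemma cmeas_sum (I : Type) (r : seq I) (P : pred I) (F : I -> T -> R[i]) :
  (forall i, cmeas (F i)) -> cmeas (fun x => \sum_(i <- r | P i) F i x).
Proof.
move=> mF; elim: r => [|i r ih].
  by apply: cmeas_eq (cmeas_cst 0) => x; rewrite big_nil.
case Pi : (P i).
  by apply: cmeas_eq (cmeasD (mF i) ih) => x; rewrite big_cons Pi.
by apply: cmeas_eq ih => x; rewrite big_cons Pi.
Qed.

Lemma cmeas_prod (I : Type) (r : seq I) (P : pred I) (F : I -> T -> R[i]) :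
  (forall i, cmeas (F i)) -> cmeas (fun x => \prod_(i <- r | P i) F i x).
Proof.
move=> mF; elim: r => [|i r ih].
  by apply: cmeas_eq (cmeas_cst 1) => x; rewrite big_nil.
case Pi : (P i).
  by apply: cmeas_eq (cmeasM (mF i) ih) => x; rewrite big_cons Pi.
by apply: cmeas_eq ih => x; rewrite big_cons Pi.
Qed.

Lemma cmeasX f n : cmeas f -> cmeas (fun x => f x ^+ n).
Proof.
move=> mf; elim: n => [|n ih]; first exact: cmeas_cst.
by apply: cmeas_eq (cmeasM mf ih) => x; rewrite exprS.
Qed.

Lemma cmeas_det n (F : T -> 'M[R[i]]_n) :
  (forall i j, cmeas (fun x => F x i j)) -> cmeas (fun x => \det (F x)).
Proof.
move=> mF; apply: cmeas_sum => s; apply: cmeasM; first exact: cmeas_cst.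
by apply: cmeas_prod => i.
Qed.

End Closure.

Lemma cmeas_toC : cmeas toC.
Proof.
rewrite /cmeas (_ : (fun x => _) = id); last by apply/funext => x; rewrite toCK.
exact: measurable_id.
Qed.

Lemma cmeas_comp d d' (T : measurableType d) (T' : measurableType d')
  (f : T -> R[i]) (g : T' -> T) : cmeas f -> measurable_fun setT g ->
  cmeas (fun x => f (g x)).
Proof. by move=> mf mg; exact: (measurableT_comp mf mg). Qed.

Lemma measurable_comp_cmeas d d' (T : measurableType d) (U : measurableType d')
  (h : R[i] -> U) (f : T -> R[i]) :
  measurable_fun setT (fun c => h (toC c)) -> cmeas f ->
  measurable_fun setT (fun x => h (f x)).
Proof.
move=> mh mf; rewrite (_ : (fun x => _) = (fun c => h (toC c)) \o (fun x => ofC (f x))).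
  exact: measurableT_comp.
by apply/funext => x; rewrite /= ofCK.
Qed.

End ComplexMeasurable.

Section ComplexIntegral.
Context {R : realType}.
Local Notation CR := (measurableTypeR R * measurableTypeR R)%type.
Local Notation mu := (@lebesgue_measure R).
Local Open Scope ereal_scope.
Implicit Types f : R[i] -> \bar R.

Definition Cint f : \bar R := \int[@lebesgue_complex R]_c f (toC c).
Definition Cmeas f := measurable_fun setT (fun c : CR => f (toC c)).

Lemma eq_Cint f g : f =1 g -> Cint f = Cint g.
Proof. by move=> /funext ->. Qed.

Lemma Cint_ge0 f : (forall x, 0 <= f x) -> 0 <= Cint f.
Proof. by move=> f0; apply: integral_ge0 => x _. Qed.

Lemma CintZl f k : Cmeas f -> (forall x, 0 <= f x) -> 0 <= k ->
  Cint (fun c => k * f c) = k * Cint f.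
Proof. by move=> mf f0 k0; rewrite /Cint ge0_integralZl. Qed.

Lemma CintE f : Cmeas f -> (forall x, 0 <= f x) ->
  Cint f = \int[mu]_x \int[mu]_y f (x +i* y)%C.
Proof.
by move=> mf f0; rewrite /Cint -(fubini_tonelli1 (fun c : CR => f (toC c))).
Qed.

Lemma Cmeas_comp f (g : R[i] -> R[i]) : Cmeas f -> cmeas (fun c : CR => g (toC c)) ->
  Cmeas (fun c => f (g c)).
Proof. by move=> mf mg; exact: (measurable_comp_cmeas (h := f)). Qed.

Lemma Cint_translate f (b : R[i]) : Cmeas f -> (forall x, 0 <= f x) ->
  Cint (fun c => f (c + b)%R) = Cint f.
Proof.
move=> mf f0.
have mfb : Cmeas (fun c => f (c + b)%R).
  by apply: Cmeas_comp => //; apply: cmeasD; [exact: cmeas_toC|exact: cmeas_cst].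
rewrite (CintE mfb (fun x => f0 _)) (CintE mf f0); case: b mfb => b1 b2 mfb.
have E (x : R) : \int[mu]_y f ((x +i* y) + (b1 +i* b2))%R =
    (fun t : R => \int[mu]_y f (t +i* y)) (1 * x + b1)%R.
  rewrite /= -[RHS]mul1e -[X in X%:E * _]invr1 -(normr1 R) -(@ge0_integral_affine R 1 b2)
    ?oner_neq0//.
    by apply: eq_integral => y _; congr f; rewrite normr1; apply/eqP; rewrite eq_complex/=;
      apply/andP; split; apply/eqP; ring.
  exact: (measurableT_comp mf (measurable_pair1 _)).
under eq_integral do rewrite E.
rewrite (@ge0_integral_affine R 1 b1 (fun t : R => \int[mu]_y f (t +i* y))) ?oner_neq0 ?normr1
  ?invr1 ?mul1e//.
- exact: (measurable_fun_fubini_tonelli_F (fun c : CR => f (toC c))).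
- by move=> x; exact: integral_ge0.
Qed.

(** Multiplication by a + ib is realised by two one-dimensional affine substitutions, with Jacobians
    |b| and (a^2 + b^2) / |b|. They divide by b; when b = 0 the two coordinates decouple. *)
Lemma Cint_scale f (a : R[i]) : a != 0%R -> Cmeas f -> (forall x, 0 <= f x) ->
  Cint (fun c => f (a * c)%R) = ((absq a)^-1)%:E * Cint f.
Proof.
move=> a0 mf f0.
have mfa : Cmeas (fun c => f (a * c)%R).
  by apply: Cmeas_comp => //; apply: cmeasM; [exact: cmeas_cst|exact: cmeas_toC].
have mF : measurable_fun setT (fun x => \int[mu]_y f (x +i* y)%C).
  exact: (measurable_fun_fubini_tonelli_F (fun c : CR => f (toC c))).
rewrite (CintE mfa (fun x => f0 _)) (CintE mf f0).
case: a a0 mfa => a b a0 mfa; rewrite /absq/=.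
have [b0|b0] := eqVneq b 0%R.
  have {}a0 : a != 0%R by move: a0; rewrite eq_complex/= b0 eqxx andbT.
  have E (x : R) : \int[mu]_y f ((a +i* b) * (x +i* y))%R =
    `|a|^-1%:E * (fun t : R => \int[mu]_y f (t +i* y)) (a * x + 0)%R.
    rewrite /= -(@ge0_integral_affine R a 0)//.
      by apply: eq_integral => y _; congr f; rewrite b0; apply/eqP; rewrite eq_complex/=;
        apply/andP; split; apply/eqP; ring.
    exact: (measurableT_comp mf (measurable_pair1 _)).
  under eq_integral do rewrite E.
  rewrite ge0_integralTZl; last 3 first.
  - by apply: (measurableT_comp mF); exact: measurable_affine.
  - by move=> x; exact: integral_ge0.
  - by rewrite lee_fin invr_ge0.
  rewrite (@ge0_integral_affine R a 0 (fun t : R => \int[mu]_y f (t +i* y)))//; last first.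
    by move=> x; exact: integral_ge0.
  rewrite muleA -EFinM; congr (_%:E * _).
  by rewrite -invfM -normrM -expr2 normrX real_normK ?num_real// b0 expr0n addr0.
have s0 : (a ^+ 2 + b ^+ 2 != 0)%R.
  by rewrite paddr_eq0 ?sqr_ge0// !sqrf_eq0 (negbTE b0) andbF.
(* The new variable is a x - b y, the real part of the product; for it fixed, the imaginary part is
   affine in x with slope (a^2 + b^2) / b. *)
have E (x : R) : \int[mu]_y f ((a +i* b) * (x +i* y))%R = `|b|^-1%:E *
    \int[mu]_y f (y +i* (((a ^+ 2 + b ^+ 2) / b) * x + (- a * y / b)))%R.
  rewrite -(normrN b) -(@ge0_integral_affine R (- b) (a * x)) ?oppr_eq0//.
    apply: eq_integral => y _; congr f; apply/eqP; rewrite eq_complex/=; apply/andP; split;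
      apply/eqP; first ring.
    by field.
  apply: (measurable_comp_cmeas (h := f)) => //; apply/cmeasP; split => //=.
  apply: measurable_funD => //.
  rewrite (_ : (fun _ => _) = (fun y => (- a / b) * y)%R); last first.
    by apply/funext => y; rewrite mulrAC.
  exact: measurable_funM.
under eq_integral do rewrite E.
pose g (x y : measurableTypeR R) := f (y +i* (((a ^+ 2 + b ^+ 2) / b) * x + (- a * y / b)))%R.
have mg : measurable_fun setT (fun p : CR => g p.1 p.2).
  apply: (measurable_comp_cmeas (h := f)) => //; apply/cmeasP; split => /=.
    exact: measurable_snd.
  apply: measurable_funD; first by apply: measurable_funM => //; exact: measurable_fst.
  apply: measurable_funM => //; apply: measurable_funM => //; exact: measurable_snd.
rewrite ge0_integralTZl; last 3 first.
- exact: (measurable_integral2 mu mg (fun x y => f0 _)).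
- by move=> x; exact: integral_ge0.
- by rewrite lee_fin invr_ge0.
rewrite (integral_swap mu mu mg (fun x y => f0 _)) /g.
have E' (y : R) : \int[mu]_x f (y +i* ((a ^+ 2 + b ^+ 2) / b * x + - a * y / b))%R =
  `|((a ^+ 2 + b ^+ 2) / b)%R|^-1%:E * \int[mu]_x f (y +i* x).
  rewrite -(@ge0_integral_affine R _ (- a * y / b)) ?mulf_neq0 ?invr_eq0//.
  exact: (measurableT_comp mf (measurable_pair1 _)).
under eq_integral do rewrite E'.
rewrite ge0_integralTZl; last 3 first.
- exact: mF.
- by move=> x; exact: integral_ge0.
- by rewrite lee_fin invr_ge0.
rewrite muleA -EFinM -invfM -normrM mulrC divfK// ger0_norm//.
by rewrite addr_ge0 ?sqr_ge0.
Qed.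

End ComplexIntegral.

(** * Inversion and radial integration *)

Section HaarTransfer.
Context d1 d2 (X : measurableType d1) (Y : measurableType d2) (R : realType).
Variables (m1 : {sigma_finite_measure set X -> \bar R})
  (m2 : {sigma_finite_measure set Y -> \bar R}).
Variables (JX : X -> R) (JY : Y -> R) (mulX : X -> X -> X) (invX : X -> X) (u : Y -> X).
Local Open Scope ereal_scope.
Hypotheses (mJX : measurable_fun setT JX) (mJY : measurable_fun setT JY).
Hypotheses (JX0 : forall x, (0 <= JX x)%R) (JY0 : forall y, (0 <= JY y)%R).
Hypotheses (mmul : measurable_fun setT (fun p : X * X => mulX p.1 p.2))
  (minv : measurable_fun setT invX) (mu : measurable_fun setT u).
Hypothesis JY_invariant : forall x (g : X -> \bar R), JX x != 0%R ->
  measurable_fun setT g -> (forall x, 0 <= g x) ->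
  \int[m2]_y ((JY y)%:E * g (mulX x (u y))) = \int[m2]_y ((JY y)%:E * g (u y)).
Hypothesis JX_invariant : forall y (g : X -> \bar R), JY y != 0%R ->
  measurable_fun setT g -> (forall x, 0 <= g x) ->
  \int[m1]_x ((JX x)%:E * g (mulX x (u y))) = \int[m1]_x ((JX x)%:E * g x).
(** The group laws are required only where the weights do not vanish: X will be all of R or C, whose
    element 0 is not invertible. *)
Hypothesis mulXK : forall x y, JX x != 0%R -> JY y != 0%R ->
  mulX (mulX x (u y)) (invX (u y)) = x.
Hypothesis mulXVK : forall x y, JX x != 0%R -> JY y != 0%R ->
  mulX x (invX (mulX x (u y))) = invX (u y).

(* Uniqueness of Haar measure: the weight [JX] on X and the image under [u] of
   the weight [JY] on Y are both invariant, hence proportional; [psi] computes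
   the constant. *)
Lemma haar_transfer (psi g : X -> \bar R) :
  measurable_fun setT psi -> (forall x, 0 <= psi x) ->
  measurable_fun setT g -> (forall x, 0 <= g x) ->
  \int[m1]_x ((JX x)%:E * psi x) = 1 ->
  \int[m2]_y ((JY y)%:E * g (u y)) =
  (\int[m2]_y ((JY y)%:E * psi (invX (u y)))) * \int[m1]_x ((JX x)%:E * g x).
Proof.
move=> mpsi psi0 mg g0 psi1; set K := (X in X * _).
have mEX : measurable_fun setT (fun x => (JX x)%:E) by exact/measurable_EFinP.
have mEY : measurable_fun setT (fun y => (JY y)%:E) by exact/measurable_EFinP.
have J0 x : 0 <= (JX x)%:E by rewrite lee_fin.
have J0' x : 0 <= (JY x)%:E by rewrite lee_fin.
have mxu : measurable_fun setT (fun p : X * Y => mulX p.1 (u p.2)).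
  exact: (measurableT_comp mmul (measurable_fun_pair measurable_fst (measurableT_comp mu
    measurable_snd))).
have mxv : measurable_fun setT (fun p : X * Y => mulX p.1 (invX (u p.2))).
  exact: (measurableT_comp mmul (measurable_fun_pair measurable_fst
    (measurableT_comp minv (measurableT_comp mu measurable_snd)))).
have mgu : measurable_fun setT (fun y => (JY y)%:E * g (u y)).
  by apply: emeasurable_funM => //; exact: measurableT_comp.
have m1x x : measurable_fun setT (mulX x).
  exact: (measurableT_comp mmul (measurable_pair1 x)).
have m2x y : measurable_fun setT (fun x => mulX x y).
  exact: (measurableT_comp mmul (measurable_pair2 y)).
(* The double integral of psi(x) g(x u(y)) is computed in two ways: the invariance of [JY] removes
   x, while after exchanging the integrals that of [JX] moves u(y) from g to psi. *)
transitivity (\int[m1]_x \int[m2]_y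
    ((JX x)%:E * psi x * ((JY y)%:E * g (mulX x (u y))))).
  rewrite -[LHS]mul1e -psi1 muleC -ge0_integralTZl; last 3 first.
  - exact: emeasurable_funM.
  - by move=> x; rewrite mule_ge0.
  - by apply: integral_ge0 => y _; rewrite mule_ge0.
  apply: eq_integral => x _; rewrite muleC.
  have [->|Jx] := eqVneq (JX x) 0%R.
    rewrite !mul0e; rewrite integral0_eq// => y _; rewrite mul0e//.
  rewrite -(JY_invariant Jx)// ge0_integralTZl//; last 3 first.
  - apply: emeasurable_funM => //; apply: measurableT_comp => //.
    exact: measurableT_comp.
  - by move=> y; rewrite mule_ge0.
  - by rewrite mule_ge0.
rewrite integral_swap; last 2 first.
- apply: emeasurable_funM.
    exact: (measurable_comp_fst (emeasurable_funM mEX mpsi)).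
  apply: emeasurable_funM; first exact: (measurable_comp_snd mEY).
  exact: (measurableT_comp mg mxu).
- by move=> x y; rewrite !mule_ge0.
transitivity (\int[m2]_y \int[m1]_x
    ((JX x)%:E * g x * ((JY y)%:E * psi (mulX x (invX (u y)))))).
  apply: eq_integral => y _.
  have [->|Jy] := eqVneq (JY y) 0%R.
    by apply: eq_integral => x _; rewrite !mul0e !mule0.
  pose h x := psi (mulX x (invX (u y))) * g x.
  transitivity ((JY y)%:E * \int[m1]_x ((JX x)%:E * h (mulX x (u y)))).
    rewrite -ge0_integralTZl; last 3 first.
    - apply: emeasurable_funM => //; apply: emeasurable_funM; apply: measurableT_comp => //.
      exact: (measurableT_comp (m2x (invX (u y))) (m2x (u y))).
    - by move=> x; rewrite !mule_ge0.
    - by [].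
    apply: eq_integral => x _.
    have [->|Jx] := eqVneq (JX x) 0%R; first by rewrite !mul0e mule0.
    rewrite /h mulXK//; rewrite muleCA -!muleA; congr (_ * _).
  rewrite (JX_invariant (g := h) Jy); last 2 first.
  - by apply: emeasurable_funM => //; exact: measurableT_comp.
  - by move=> x; rewrite mule_ge0.
  rewrite -ge0_integralTZl//; last 2 first.
  - by apply: emeasurable_funM => //; apply: emeasurable_funM => //; exact: measurableT_comp.
  - by move=> x; rewrite !mule_ge0.
  apply: eq_integral => x _; rewrite muleCA -!muleA; congr (_ * _).
  by rewrite /h muleA muleC.
rewrite -integral_swap; last 2 first.
- apply: emeasurable_funM.
    exact: (measurable_comp_fst (emeasurable_funM mEX mg)).
  apply: emeasurable_funM; first exact: (measurable_comp_snd mEY).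
  exact: (measurableT_comp mpsi mxv).
- by move=> x y; rewrite !mule_ge0.
rewrite muleC -ge0_integralZr//; last 3 first.
- exact: emeasurable_funM.
- by move=> x _; rewrite mule_ge0.
- by apply: integral_ge0 => y _; rewrite mule_ge0.
apply: eq_integral => x _; have [->|Jx] := eqVneq (JX x) 0%R.
  by rewrite !mul0e integral0_eq// => y _; rewrite mul0e.
have mh : measurable_fun setT (fun w => psi (mulX x (invX w))).
  by apply: measurableT_comp => //; exact: (measurableT_comp (m1x x)).
rewrite ge0_integralTZl//; last 3 first.
- apply: emeasurable_funM => //; exact: (measurableT_comp mh).
- by move=> y; rewrite mule_ge0.
- by rewrite mule_ge0.
(* Invariance is used backwards to insert x next to u(y); [mulXVK] then cancels x and leaves psi (1
   / u(y)), whose integral is the constant. *)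
congr (_ * _); rewrite -(JY_invariant (g := fun w => psi (mulX x (invX w))) Jx)//.
apply: eq_integral => y _; have [->|Jy] := eqVneq (JY y) 0%R; first by rewrite !mul0e.
by rewrite mulXVK.
Qed.

End HaarTransfer.

Lemma measurable_lt_ind d (T : measurableType d) (R : realType) (f g : T -> R) :
  measurable_fun setT f -> measurable_fun setT g ->
  measurable_fun setT (fun x => (f x < g x)%R%:R : R).
Proof.
move=> mf mg.
rewrite (_ : (fun x => _) = (fun x => if f x < g x then 1 else 0)); last first.
  by apply/funext => x; case: ifP.
by apply: measurable_fun_ifT => //; exact: measurable_fun_ltr.
Qed.

Section Inversion.
Context {R : realType}.
Local Notation CR := (measurableTypeR R * measurableTypeR R)%type.
Local Notation mu := (@lebesgue_measure R).
Local Open Scope ereal_scope.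

Let set1_prod (c : CR) : [set c] = [set c.1] `*` [set c.2].
Proof.
apply/seteqP; split; first by move=> x ->.
by move=> [x y] /= [-> ->]; case: c.
Qed.

Lemma lebesgue_complex_set1 (c : CR) : @lebesgue_complex R [set c] = 0.
Proof.
by rewrite set1_prod /lebesgue_complex product_measure1E//= lebesgue_measure_set1 mul0e.
Qed.

(** A point is a null set, so an identity may fail at a pole, where inverses take the default value
    0. *)
Lemma Cint_eq_neq (p : R[i]) (f g : R[i] -> \bar R) : Cmeas f -> Cmeas g ->
  (forall x, 0 <= f x) -> (forall x, 0 <= g x) ->
  (forall x, x != p -> f x = g x) -> Cint f = Cint g.
Proof.
move=> mf mg f0 g0 fg; apply: ge0_ae_eq_integral => //.
exists [set ofC p]; split => //.
  by rewrite set1_prod; exact: measurableX.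
  exact: lebesgue_complex_set1.
move=> c /= /not_implyP[_ fgn]; apply: contrapT => cp; apply: fgn.
by apply: fg; apply: contra_notN cp => /eqP <-; rewrite toCK.
Qed.

Lemma Cint_eq_ne0 (f g : R[i] -> \bar R) : Cmeas f -> Cmeas g ->
  (forall x, 0 <= f x) -> (forall x, 0 <= g x) ->
  (forall x, x != 0%R -> f x = g x) -> Cint f = Cint g.
Proof. exact: (@Cint_eq_neq 0%R). Qed.

Let Jc (c : CR) : R := (absq (toC c))^-1%R.

Let mJc : measurable_fun setT Jc.
Proof. by apply: measurable_fun_inv; apply: measurable_absq; exact: cmeas_toC. Qed.

Let Jc0 c : (0 <= Jc c)%R. Proof. by rewrite invr_ge0 absq_ge0. Qed.

Let Jc_neq0 c : (Jc c != 0)%R = (toC c != 0%R).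
Proof. by rewrite invr_eq0 absq_eq0. Qed.

Let Cint_absqV_scale (a : R[i]) (f : R[i] -> \bar R) : (a != 0)%R ->
  Cmeas f -> (forall x, 0 <= f x) ->
  Cint (fun c => (absq c)^-1%:E * f (a * c)%R) = Cint (fun c => (absq c)^-1%:E * f c).
Proof.
move=> a0 mf f0; have sa0 : absq a != 0%R by rewrite absq_eq0.
have mI : Cmeas (fun c : R[i] => (absq c)^-1%:E).
  by apply/measurable_EFinP; exact: mJc.
transitivity (Cint (fun c => (absq a)%:E * (fun c => (absq c)^-1%:E * f c) (a * c)%R)).
  by apply: eq_Cint => c; rewrite absqM invfM EFinM !muleA -EFinM mulfV// mul1r.
rewrite CintZl ?lee_fin ?absq_ge0//; last 2 first.
- apply: (Cmeas_comp (f := fun c => (absq c)^-1%:E * f c)).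
    exact: emeasurable_funM.
  by apply: cmeasM; [exact: cmeas_cst|exact: cmeas_toC].
- by move=> x; rewrite mule_ge0// lee_fin invr_ge0 absq_ge0.
rewrite (Cint_scale (f := fun c => (absq c)^-1%:E * f c))//; last 2 first.
- exact: emeasurable_funM.
- by move=> x; rewrite mule_ge0// lee_fin invr_ge0 absq_ge0.
by rewrite muleA -EFinM mulfV// mul1e.
Qed.

Let itv12 : set R := [set` `[1%R, 2%R]].
Let mitv12 : measurable_fun setT (\1_itv12 : R -> R).
Proof. by apply: measurable_indic; exact: measurable_itv. Qed.

Let mu_itv12 : mu itv12 = 1.
Proof.
rewrite /itv12 lebesgue_measure_itv/= lte_fin ltr1n -EFinB; congr EFin; lra.
Qed.

(* |c|^-2 dc is a Haar measure on the multiplicative group, hence invariant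
   under c |-> 1 / c. *)
Lemma Cint_inv (f : R[i] -> \bar R) : Cmeas f -> (forall x, 0 <= f x) ->
  Cint (fun c => ((absq c)^-1 ^+ 2)%:E * f (c^-1)%R) = Cint f.
Proof.
move=> mf f0.
have mI : Cmeas (fun c : R[i] => (absq c)^-1%:E).
  by apply/measurable_EFinP; exact: mJc.
have mA : Cmeas (fun c : R[i] => (absq c)%:E).
  by apply/measurable_EFinP; apply: measurable_absq; exact: cmeas_toC.
have a0 (c : R[i]) : 0 <= (absq c)%:E by rewrite lee_fin absq_ge0.
pose mulC (p q : CR) := ofC (toC p * toC q)%R.
pose invC (p : CR) := ofC (toC p)^-1%R.
(* The box has area 1 and avoids 0; multiplied by |c|^2, its indicator has Haar integral 1. *)
pose B := itv12 `*` itv12.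
have mB : measurable B by apply: measurableX; exact: measurable_itv.
pose psi (c : CR) := (absq (toC c) * \1_B c)%:E.
pose g (c : CR) := (absq (toC c))%:E * f (toC c).
have mmul : measurable_fun setT (fun p : CR * CR => mulC p.1 p.2).
  by apply: cmeasM; apply: cmeas_comp;
    [exact: cmeas_toC|exact: measurable_fst|exact: cmeas_toC|exact: measurable_snd].
have minv : measurable_fun setT invC by apply: cmeasV; exact: cmeas_toC.
have mg : measurable_fun setT g by exact: emeasurable_funM.
have g0 c : 0 <= g c by rewrite mule_ge0.
have mpsi : measurable_fun setT psi.
  apply/measurable_EFinP; apply: measurable_funM.
    by apply: measurable_absq; exact: cmeas_toC.
  exact: measurable_indic.
have psi0 c : 0 <= psi c by rewrite lee_fin !mulr_ge0// absq_ge0.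
have inv1 c : Jc c != 0%R -> forall h : CR -> \bar R, measurable_fun setT h ->
    (forall x, 0 <= h x) ->
    \int[@lebesgue_complex R]_x ((Jc x)%:E * h (mulC c x)) =
    \int[@lebesgue_complex R]_x ((Jc x)%:E * h x).
  rewrite Jc_neq0 => c0 h mh h0.
  have := @Cint_absqV_scale (toC c) (h \o ofC) c0; rewrite /Cint /Cmeas /=.
  have -> : (fun c0 => h (ofC (toC c0))) = h by apply/funext => x; rewrite toCK.
  move=> /(_ mh (fun x => h0 _)); rewrite /Jc /mulC => ->.
  by apply: eq_integral => x _; rewrite toCK.
have inv2 c : Jc c != 0%R -> forall h : CR -> \bar R, measurable_fun setT h ->
    (forall x, 0 <= h x) ->
    \int[@lebesgue_complex R]_x ((Jc x)%:E * h (invC (mulC c x))) =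
    \int[@lebesgue_complex R]_x ((Jc x)%:E * h (invC x)).
  move=> c0 h mh h0.
  exact: (inv1 _ c0 (h \o invC) (measurableT_comp mh minv) (fun x => h0 _)).
have := @haar_transfer _ _ _ _ R (@lebesgue_complex R) (@lebesgue_complex R)
  Jc Jc mulC invC invC mJc mJc Jc0 Jc0 mmul minv minv.
move=> /(_ _ _ _ _ psi g mpsi psi0 mg g0) E.
transitivity (\int[@lebesgue_complex R]_y ((Jc y)%:E * g (invC y))).
  apply: eq_integral => c _; rewrite /Jc /g /invC !ofCK absqV muleA -EFinM.
  by rewrite expr2.
have mulCK (x y : CR) : Jc y != 0%R -> mulC (mulC x (invC y)) (invC (invC y)) = x.
  rewrite Jc_neq0 => y0; rewrite /mulC /invC !ofCK invrK -mulrA mulVf// mulr1.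
  by rewrite toCK.
have mulCVK (x y : CR) : Jc x != 0%R -> Jc y != 0%R ->
    mulC x (invC (mulC x (invC y))) = invC (invC y).
  rewrite !Jc_neq0 => x0 y0; rewrite /mulC /invC !ofCK invfM !invrK.
  by rewrite mulrA mulfV// mul1r.
have Jpsi1 : \int[@lebesgue_complex R]_c ((Jc c)%:E * psi c) = 1.
  transitivity (\int[@lebesgue_complex R]_c (\1_B c)%:E).
    apply: eq_integral => c _; rewrite /psi -EFinM mulrA /Jc.
    have [cB|cB] := boolP (c \in B); last by rewrite indicE (negbTE cB) mulr0.
    rewrite mulVf ?mul1r// absq_eq0 eq_complex/= negb_and.
    by move: cB; rewrite inE => -[/=]; rewrite /itv12/= in_itv/= => /andP[c1 _] _;
      rewrite gt_eqF// (lt_le_trans _ c1).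
  transitivity (@lebesgue_complex R B); first by rewrite integral_indic// setIT.
  rewrite /B /lebesgue_complex product_measure1E; [|exact: measurable_itv..].
  transitivity (1 * 1 : \bar R); last by rewrite mule1.
  by congr (_ * _); exact: mu_itv12.
rewrite E; first last.
- exact: Jpsi1.
- by move=> x y Jx Jy; rewrite mulCVK.
- by move=> x y Jx Jy; rewrite mulCK.
- move=> y h Jy mh h0.
  have Ji : Jc (invC y) != 0%R by rewrite Jc_neq0 /invC ofCK invr_eq0 -Jc_neq0.
  rewrite -[RHS](inv1 _ Ji)//; apply: eq_integral => x _; congr (_ * h _).
  by rewrite /mulC mulrC.
- move=> x h Jx mh h0.
  have Ji : Jc (invC x) != 0%R by rewrite Jc_neq0 /invC ofCK invr_eq0 -Jc_neq0.
  rewrite -(inv2 _ Ji)//; apply: eq_integral => c _; congr (_ * h _).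
  by rewrite /mulC /invC !ofCK invfM invrK.
(* Here u is the inversion itself, so psi (1 / u(y)) = psi(y) and the constant of proportionality is
   1. *)
rewrite -[RHS]mul1e; congr (_ * _).
  by rewrite -Jpsi1; apply: eq_integral => c _; rewrite /invC ofCK invrK toCK.
apply: (Cint_eq_ne0 (f := fun c => (absq c)^-1%:E * ((absq c)%:E * f c))) => //.
- by do 2 apply: emeasurable_funM => //.
- by move=> c; rewrite !mule_ge0// lee_fin invr_ge0 absq_ge0.
- by move=> c c0; rewrite muleA -EFinM mulVf ?mul1e// absq_eq0.
Qed.

(** The map c |-> |c|^2 carries the Haar measure |c|^-2 dc to a multiple of dx / x on the half-line.
    The number [K] is pi, left unevaluated. *)
Lemma Cint_radial : exists K : \bar R, 0 <= K /\
  forall h : R -> \bar R, measurable_fun setT h -> (forall x, 0 <= h x) ->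
  Cint (fun c => h (absq c)) = K * \int[mu]_x ((0 < x)%R%:R%:E * h x).
Proof.
pose JX (x : measurableTypeR R) : R := ((0 < x)%R%:R / x)%R.
have mpos : measurable_fun setT (fun x : measurableTypeR R => (0 < x)%R%:R : R).
  by apply: measurable_lt_ind.
have mJX : measurable_fun setT JX.
  by apply: measurable_funM => //; exact: measurable_fun_inv.
have JX0 x : (0 <= JX x)%R by rewrite /JX; case: ltP => x0; rewrite ?mul0r// mul1r invr_ge0 ltW.
have JXneq0 x : JX x != 0%R -> (0 < x)%R by rewrite /JX; case: ltP => //; rewrite mul0r eqxx.
pose psi (x : measurableTypeR R) : \bar R := (x * \1_itv12 x)%:E.
have mpsi : measurable_fun setT psi.
  by apply/measurable_EFinP; exact: measurable_funM.
have itv_gt0 x : x \in itv12 -> (0 < x)%R.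
  by rewrite inE /itv12/= in_itv/= => /andP[x1 _]; rewrite (lt_le_trans _ x1).
have psi0 x : 0 <= psi x.
  rewrite /psi lee_fin indicE; case: (boolP (x \in itv12)) => [/itv_gt0 x0|_].
    by rewrite mulr1 ltW.
  by rewrite mulr0.
have Jpsi1 : \int[mu]_x ((JX x)%:E * psi x) = 1.
  rewrite -mu_itv12 -[itv12 in RHS]setIT -integral_indic//; last exact: measurable_itv.
  apply: eq_integral => x _; rewrite /psi -EFinM /JX indicE.
  case: (boolP (x \in itv12)) => [/itv_gt0 x0|_]; last by rewrite !mulr0.
  by rewrite x0 mulr1 mul1r mulVf// gt_eqF.
have mu_ : measurable_fun setT (fun c : CR => absq (toC c) : measurableTypeR R).
  by apply: measurable_absq; exact: cmeas_toC.
exists (\int[@lebesgue_complex R]_y ((Jc y)%:E * psi (absq (toC y))^-1%R)).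
split; first by apply: integral_ge0 => c _; apply: mule_ge0; [rewrite lee_fin|exact: psi0].
move=> h mh h0.
have mg : measurable_fun setT (fun x : measurableTypeR R => x%:E * ((0 < x)%R%:R%:E * h x)).
  apply: emeasurable_funM; first exact/measurable_EFinP.
  by apply: emeasurable_funM => //; exact/measurable_EFinP.
have g0 x : 0 <= x%:E * ((0 < x)%R%:R%:E * h x).
  by case: ltP => x0; rewrite ?mul0e ?mule0// mul1e mule_ge0// lee_fin ltW.
have mmul : measurable_fun setT (fun p : CR => (p.1 * p.2)%R : measurableTypeR R).
  by apply: measurable_funM; [exact: measurable_fst|exact: measurable_snd].
have minv : measurable_fun setT (GRing.inv : measurableTypeR R -> measurableTypeR R).
  exact: measurable_fun_inv.
have := @haar_transfer _ _ _ _ R mu (@lebesgue_complex R) JX Jc _ _ _ mJX mJc JX0 Jc0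
  mmul minv mu_.
move=> /(_ _ _ _ _ psi _ mpsi psi0 mg g0) E.
transitivity (\int[@lebesgue_complex R]_y ((Jc y)%:E *
    (fun x : R => x%:E * ((0 < x)%R%:R%:E * h x)) (absq (toC y)))).
  apply: (Cint_eq_ne0 (g := fun c => (absq c)^-1%:E *
    (fun x : R => x%:E * ((0 < x)%R%:R%:E * h x)) (absq c))) => //.
  - exact: (measurableT_comp mh mu_).
  - apply: emeasurable_funM; first by apply/measurable_EFinP; exact: mJc.
    exact: (measurableT_comp mg mu_).
  - by move=> c; apply: mule_ge0 => //; rewrite lee_fin invr_ge0 absq_ge0.
  - move=> c c0; rewrite absq_gt0 c0 mul1e muleA -EFinM mulVf ?mul1e//.
    by rewrite absq_eq0.
rewrite E.
- congr (_ * _); apply: eq_integral => x _; rewrite /JX.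
  by case: ltP => x0; rewrite ?mul0r ?mul0e// mul1r mul1e muleA -EFinM mulVf ?mul1e// gt_eqF.
- move=> x k /JXneq0 x0 mk k0.
  have s0 : ((Num.sqrt x)%:C != 0 :> R[i])%R by rewrite fmorph_eq0 sqrtr_eq0 -ltNge.
  have := Cint_absqV_scale s0 (f := fun c => k (absq c)).
  rewrite /Cint /Cmeas => /(_ (measurableT_comp mk mu_) (fun c => k0 _)) <-.
  apply: eq_integral => c _; congr (_ * k _).
  by rewrite absqM absq_real sqr_sqrtr// ltW.
- move=> c k; rewrite Jc_neq0 -absq_gt0 => c0 mk k0.
  pose F x := (JX x)%:E * k x.
  have mF : measurable_fun setT F by apply: emeasurable_funM => //; exact/measurable_EFinP.
  have F0 x : 0 <= F x by apply: mule_ge0; rewrite ?lee_fin.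
  transitivity (\int[mu]_x ((absq (toC c))%:E * F (absq (toC c) * x + 0)%R)).
    apply: eq_integral => x _; rewrite /F addr0 muleA -EFinM mulrC.
    congr (_%:E * k _).
    by rewrite /JX pmulr_rgt0// invfM mulrCA (mulrA (absq _)) mulfV ?mul1r// gt_eqF.
  rewrite ge0_integralTZl ?lee_fin ?absq_ge0//; last first.
    by apply: (measurableT_comp mF); exact: measurable_affine.
  rewrite ge0_integral_affine ?gt_eqF// muleA -EFinM gtr0_norm//.
  by rewrite mulfV ?mul1e// gt_eqF.
- by move=> x c /JXneq0 x0; rewrite Jc_neq0 -absq_eq0 => c0; rewrite mulfK.
- move=> x c /JXneq0 x0; rewrite Jc_neq0 -absq_eq0 => c0.
  by rewrite invfM mulrA mulfV ?mul1r// gt_eqF.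
- exact: Jpsi1.
Qed.

(** The measure dx / x on the half-line is invariant under x |-> 1 / x, with constant 1 for the same
    reason as in [Cint_inv]. *)
Lemma integral_inv_gt0 (h : R -> \bar R) : measurable_fun setT h ->
  (forall x, 0 <= h x) ->
  \int[mu]_x ((0 < x)%R%:R%:E * h x) =
  \int[mu]_x (((0 < x)%R%:R / x ^+ 2)%:E * h x^-1%R).
Proof.
move=> mh h0.
pose JX (x : measurableTypeR R) : R := ((0 < x)%R%:R / x)%R.
have mpos : measurable_fun setT (fun x : measurableTypeR R => (0 < x)%R%:R : R).
  by apply: measurable_lt_ind.
have mJX : measurable_fun setT JX.
  by apply: measurable_funM => //; exact: measurable_fun_inv.
have JX0 x : (0 <= JX x)%R by rewrite /JX; case: ltP => x0; rewrite ?mul0r// mul1r invr_ge0 ltW.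
have JXneq0 x : JX x != 0%R -> (0 < x)%R by rewrite /JX; case: ltP => //; rewrite mul0r eqxx.
pose psi (x : measurableTypeR R) : \bar R := (x * \1_itv12 x)%:E.
have mpsi : measurable_fun setT psi.
  by apply/measurable_EFinP; exact: measurable_funM.
have itv_gt0 x : x \in itv12 -> (0 < x)%R.
  by rewrite inE /itv12/= in_itv/= => /andP[x1 _]; rewrite (lt_le_trans _ x1).
have psi0 x : 0 <= psi x.
  rewrite /psi lee_fin indicE; case: (boolP (x \in itv12)) => [/itv_gt0 x0|_].
    by rewrite mulr1 ltW.
  by rewrite mulr0.
have Jpsi1 : \int[mu]_x ((JX x)%:E * psi x) = 1.
  rewrite -mu_itv12 -[itv12 in RHS]setIT -integral_indic//; last exact: measurable_itv.
  apply: eq_integral => x _; rewrite /psi -EFinM /JX indicE.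
  case: (boolP (x \in itv12)) => [/itv_gt0 x0|_]; last by rewrite !mulr0.
  by rewrite x0 mulr1 mul1r mulVf// gt_eqF.
pose g (x : measurableTypeR R) := x%:E * ((0 < x)%R%:R%:E * h x).
have mg : measurable_fun setT g.
  apply: emeasurable_funM; first exact/measurable_EFinP.
  by apply: emeasurable_funM => //; exact/measurable_EFinP.
have g0 x : 0 <= g x.
  by rewrite /g; case: ltP => x0; rewrite ?mul0e ?mule0// mul1e mule_ge0// lee_fin ltW.
have mmul : measurable_fun setT (fun p : CR => (p.1 * p.2)%R : measurableTypeR R).
  by apply: measurable_funM; [exact: measurable_fst|exact: measurable_snd].
have minv : measurable_fun setT (GRing.inv : measurableTypeR R -> measurableTypeR R).
  exact: measurable_fun_inv.
have scale y k : (0 < y)%R -> measurable_fun setT k -> (forall x, 0 <= k x) ->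
    \int[mu]_x ((JX x)%:E * k (y * x)%R) = \int[mu]_x ((JX x)%:E * k x).
  move=> y0 mk k0.
  pose F x := (JX x)%:E * k x.
  have mF : measurable_fun setT F by apply: emeasurable_funM => //; exact/measurable_EFinP.
  have F0 x : 0 <= F x by apply: mule_ge0; rewrite ?lee_fin.
  transitivity (\int[mu]_x (y%:E * F (y * x + 0)%R)).
    apply: eq_integral => x _; rewrite /F addr0 muleA -EFinM.
    congr (_%:E * k _).
    by rewrite /JX pmulr_rgt0// invfM mulrCA (mulrA y) mulfV ?mul1r// gt_eqF.
  rewrite ge0_integralTZl ?lee_fin ?ltW//; last first.
    by apply: (measurableT_comp mF); exact: measurable_affine.
  rewrite ge0_integral_affine ?gt_eqF// muleA -EFinM gtr0_norm//.
  by rewrite mulfV ?mul1e// gt_eqF.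
have := @haar_transfer _ _ _ _ R mu mu JX JX _ _ _ mJX mJX JX0 JX0 mmul minv minv.
move=> /(_ _ _ _ _ psi _ mpsi psi0 mg g0) E.
transitivity (\int[mu]_x ((JX x)%:E * g x)).
  apply: eq_integral => x _; rewrite /JX /g.
  by case: ltP => x0; rewrite ?mul0r ?mul0e// mul1r mul1e muleA -EFinM mulVf ?mul1e// gt_eqF.
transitivity (\int[mu]_x ((JX x)%:E * g x^-1%R)); last first.
  apply: eq_integral => x _; rewrite /JX /g invr_gt0.
  case: ltP => x0; rewrite ?mul0r ?mul0e// !mul1r mul1e muleA -EFinM.
  by rewrite expr2 invfM.
rewrite E.
- rewrite -[LHS]mul1e; congr (_ * _).
  by rewrite -Jpsi1; apply: eq_integral => x _; rewrite invrK.
- move=> x k /JXneq0 x0 mk k0.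
  have mki : measurable_fun setT (k \o GRing.inv) by exact: (measurableT_comp mk minv).
  rewrite -[RHS](scale x^-1%R (k \o GRing.inv)) ?invr_gt0//; last by move=> y; exact: k0.
  by apply: eq_integral => y _; rewrite /= invfM invrK.
- move=> y k /JXneq0 y0 mk k0.
  rewrite -[RHS](scale y^-1%R)// ?invr_gt0//.
  by apply: eq_integral => x _; rewrite mulrC.
- by move=> x c /JXneq0 x0 /JXneq0 c0; rewrite invrK mulfVK// gt_eqF.
- move=> x c /JXneq0 x0 /JXneq0 c0.
  by rewrite invfM mulrA mulfV ?mul1r// gt_eqF.
- exact: Jpsi1.
Qed.

End Inversion.

(** * Integration over tuples *)

Section TupleIntegral.
Context {R : realType}.
Local Notation CR := (measurableTypeR R * measurableTypeR R)%type.
Local Open Scope ereal_scope.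

Definition tuple_unrcons n (t : n.+1.-tuple CR) : n.-tuple CR * CR :=
  ([tuple tnth t (widen_ord (leqnSn n) i) | i < n], tnth t ord_max).

Lemma tuple_rconsK n : cancel (@tuple_rcons R n) (@tuple_unrcons n).
Proof.
move=> [t c]; congr pair.
  apply: eq_from_tnth => i; rewrite tnth_mktuple !(tnth_nth point)/= nth_rcons.
  by rewrite size_tuple ltn_ord.
by rewrite (tnth_nth point)/= nth_rcons size_tuple ltnn eqxx.
Qed.

Lemma measurable_tuple_unrcons n : measurable_fun setT (@tuple_unrcons n).
Proof.
apply: measurable_fun_pair; last exact: measurable_tnth.
apply/measurable_fun_tnthP => i.
rewrite (_ : _ \o _ = fun t => tnth t (widen_ord (leqnSn n) i)).
  exact: measurable_tnth.
by apply/funext => t; rewrite /= tnth_mktuple.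
Qed.

(** A named copy of [lebesgue_tuple], to which the sigma-finite structure required by Tonelli is
    attached. *)
Definition ltup n : set (n.-tuple CR) -> \bar R := lebesgue_tuple R n.

HB.instance Definition _ n := Measure.on (@ltup n).

Let sigma_finite_ltup n : sigma_finite setT (@ltup n).
Proof.
elim: n => [|n ih].
  exists (fun=> setT); first by rewrite bigcup_const.
  by move=> k; split => //; rewrite /ltup /= diracT ltry.
have /sigma_finiteP[F [TF ndF Foo]] := ih.
have /sigma_finiteP[G [TG ndG Goo]] := sigma_finiteT (@lebesgue_complex R).
have [mu1 mu2] := (@measurable_tuple_rcons R n, @measurable_tuple_unrcons n).
exists (fun k => @tuple_unrcons n @^-1` (F k `*` G k)).
  apply/esym/seteqP; split => // t _.
  have : [set: n.-tuple CR] (tuple_unrcons t).1 by [].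
  rewrite TF => -[i _ Fi].
  have : [set: CR] (tuple_unrcons t).2 by [].
  rewrite TG => -[j _ Gj].
  exists (maxn i j) => //; split.
  - by have /subsetPset := ndF i _ (leq_maxl i j); exact.
  - by have /subsetPset := ndG j _ (leq_maxr i j); exact.
move=> k; have [mFk Fkoo] := Foo k; have [mGk Gkoo] := Goo k.
have mFG : measurable (F k `*` G k) by exact: measurableX.
split; first by rewrite -[X in measurable X]setTI; exact: mu2.
rewrite /ltup /= /pushforward.
have -> : @tuple_rcons R n @^-1` (@tuple_unrcons n @^-1` (F k `*` G k)) = F k `*` G k.
  by apply/seteqP; split => p; rewrite /preimage /mkset tuple_rconsK.
rewrite product_measure1E//.
by rewrite lte_mul_pinfty// ge0_fin_numE.
Qed.

HB.instance Definition _ n := Measure_isSigmaFinite.Build _ _ _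
  (@ltup n) (sigma_finite_ltup n).

Implicit Types f g : seq CR -> \bar R.

(** Integrands are functions of sequences rather than tuples, so that splitting and concatenating
    coordinates involves no cast between tuple types. *)
Definition Tint n f : \bar R := \int[@ltup n]_t f (tval t).
Definition Tmeas d (U : measurableType d) n (f : seq CR -> U) :=
  measurable_fun setT (fun t : n.-tuple CR => f (tval t)).

Lemma eq_Tint n f g : (forall s, size s = n -> f s = g s) -> Tint n f = Tint n g.
Proof. by move=> fg; apply: eq_integral => t _; rewrite fg// size_tuple. Qed.

Lemma Tint_ge0 n f : (forall s, 0 <= f s) -> 0 <= Tint n f.
Proof. by move=> f0; apply: integral_ge0 => t _. Qed.

Lemma TintZl n f k : Tmeas n f -> (forall s, 0 <= f s) -> 0 <= k ->
  Tint n (fun s => k * f s) = k * Tint n f.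
Proof. by move=> mf f0 k0; rewrite /Tint ge0_integralTZl. Qed.

Lemma Tmeas_comp d d' (U : measurableType d) (X : measurableType d') n
    (f : seq CR -> U) (h : X -> seq CR) : Tmeas n f ->
  (forall x, size (h x) = n) ->
  (forall i, measurable_fun setT (fun x => nth point (h x) i)) ->
  measurable_fun setT (fun x => f (h x)).
Proof.
move=> mf sh mh.
pose ht x : n.-tuple CR := Tuple (introT eqP (sh x)).
have mht : measurable_fun setT ht.
  apply/measurable_fun_tnthP => i.
  rewrite (_ : _ \o _ = fun x => nth point (h x) i) //.
  by apply/funext => x; rewrite /= (tnth_nth point).
exact: (measurableT_comp mf mht).
Qed.

Lemma Tmeas_nth n i : Tmeas n (fun s => nth point s i : CR).
Proof.
have [lt_in|le_ni] := ltnP i n.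
  rewrite /Tmeas (_ : (fun _ => _) = (fun t => tnth t (Ordinal lt_in))).
    exact: measurable_tnth.
  by apply/funext => t; rewrite (tnth_nth point).
rewrite /Tmeas (_ : (fun _ => _) = cst point); first exact: measurable_cst.
by apply/funext => t; rewrite nth_default// size_tuple.
Qed.

Lemma Tint0 f : Tint 0 f = f [::].
Proof.
rewrite /Tint /ltup/= (@integral_dirac _ (0.-tuple CR) [tuple] R setT)//.
  by rewrite diracT mul1e.
rewrite (_ : (fun t : 0.-tuple CR => f (tval t)) = cst (f [::])) //.
by apply/funext => t; rewrite (tuple0 t).
Qed.

Lemma measurable_nth_rcons n i :
  measurable_fun setT (fun p : n.-tuple CR * CR => nth point (rcons p.1 p.2) i : CR).
Proof.
rewrite (_ : (fun _ => _) = (fun p : n.-tuple CR * CR => if (i < n)%N then nth point p.1 i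
  else if i == n then p.2 else point)).
  case: (i < n)%N; first exact: (measurable_comp_fst (@Tmeas_nth n i)).
  by case: (i == n); [exact: measurable_snd|exact: measurable_cst].
by apply/funext => p; rewrite nth_rcons size_tuple.
Qed.

Lemma Tint_rcons n f : Tmeas n.+1 f -> (forall s, 0 <= f s) ->
  Tint n.+1 f = Tint n (fun s => \int[@lebesgue_complex R]_c f (rcons s c)).
Proof.
move=> mf f0; rewrite /Tint {1}/ltup/=.
rewrite ge0_integral_pushforward//; last exact: measurable_tuple_rcons.
have mf' : measurable_fun setT (fun p : n.-tuple CR * CR => f (rcons p.1 p.2)).
  apply: (Tmeas_comp mf) => [p|i]; first by rewrite size_rcons size_tuple.
  exact: measurable_nth_rcons.
by rewrite preimage_setT (@fubini_tonelli1 _ _ _ _ R (@ltup n) (@lebesgue_complex R) _ mf').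
Qed.

Lemma Tmeas_cat m k f : Tmeas (m + k) f -> (forall s, 0 <= f s) ->
  Tmeas m (fun s => Tint k (fun u => f (s ++ u))).
Proof.
move=> mf f0; rewrite /Tmeas /Tint.
apply: (@measurable_integral2 _ _ _ _ R (@ltup k)
  (fun (s : m.-tuple CR) (u : k.-tuple CR) => f (s ++ u))) => //.
apply: (Tmeas_comp mf) => [p|i]; first by rewrite size_cat !size_tuple.
rewrite (_ : (fun _ => _) = (fun p : m.-tuple CR * k.-tuple CR => if (i < m)%N then nth point
  p.1 i
  else nth point p.2 (i - m))).
  case: (i < m)%N; first exact: (measurable_comp_fst (@Tmeas_nth m i)).
  exact: (measurable_comp_snd (@Tmeas_nth k (i - m))).
by apply/funext => p; rewrite nth_cat size_tuple.
Qed.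

Lemma Tint1 f : Tmeas 1 f -> (forall s, 0 <= f s) ->
  Tint 1 f = \int[@lebesgue_complex R]_c f [:: c].
Proof. by move=> mf f0; rewrite Tint_rcons// Tint0. Qed.

Lemma Tmeas_rcons n f : Tmeas n.+1 f -> (forall s, 0 <= f s) ->
  Tmeas n (fun s => \int[@lebesgue_complex R]_c f (rcons s c)).
Proof.
move=> mf f0; apply: measurable_integral2 => //.
apply: (Tmeas_comp mf) => [p|i]; first by rewrite size_rcons size_tuple.
exact: measurable_nth_rcons.
Qed.

Lemma Tint_cat m k f : Tmeas (m + k) f -> (forall s, 0 <= f s) ->
  Tint (m + k) f = Tint m (fun s => Tint k (fun u => f (s ++ u))).
Proof.
elim: k f => [|k ih] f mf f0.
  by rewrite addn0; apply: eq_Tint => s _; rewrite Tint0 cats0.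
rewrite addnS in mf *; rewrite Tint_rcons//.
rewrite ih; last 2 first.
- exact: Tmeas_rcons.
- by move=> s; exact: integral_ge0.
apply: eq_Tint => s sm; rewrite Tint_rcons; last by move=> u; exact: f0.
  by apply: eq_Tint => u _; apply: eq_integral => c _; rewrite rcons_cat.
apply: (Tmeas_comp mf) => [t|i]; first by rewrite size_cat sm size_tuple addnS.
rewrite (_ : (fun _ => _) = (fun t : k.+1.-tuple CR => if (i < m)%N then nth point s i
  else nth point t (i - m))).
  by case: (i < m)%N; [exact: measurable_cst|exact: (@Tmeas_nth k.+1 (i - m))].
by apply/funext => t; rewrite nth_cat sm.
Qed.

Lemma measurable_nth_cons n i :
  measurable_fun setT (fun p : CR * n.-tuple CR => nth point (p.1 :: p.2) i : CR).
Proof.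
case: i => [|i] /=; first exact: measurable_fst.
exact: (measurable_comp_snd (@Tmeas_nth n i)).
Qed.

Lemma Tint_cons n f : Tmeas n.+1 f -> (forall s, 0 <= f s) ->
  Tint n.+1 f = Tint n (fun s => \int[@lebesgue_complex R]_c f (c :: s)).
Proof.
move=> mf f0; rewrite -[n.+1]add1n Tint_cat// Tint1.
- rewrite /Tint (integral_swap (@lebesgue_complex R) (@ltup n)
    (f := fun c (s : n.-tuple CR) => f (c :: s)))//.
  apply: (Tmeas_comp mf) => [p|i]; first by rewrite /= size_tuple.
  exact: measurable_nth_cons.
- exact: Tmeas_cat.
- by move=> s; exact: Tint_ge0.
Qed.

End TupleIntegral.

(** * Positive definite matrices and integration of a column *)

Section PositiveDefinite.
Context {R : realType}.
Local Notation C := R[i].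
Local Open Scope sesquilinear_scope.

Lemma posC_real (x : C) : 0 < x -> x = (complex.Re x)%:C /\ 0 < complex.Re x.
Proof. by case: x => a b; rewrite ltcE/= => /andP[/eqP -> a0]. Qed.

Let addmxE m n (A B : 'M[C]_(m, n)) i j : (A + B) i j = A i j + B i j.
Proof. by rewrite mxE. Qed.

Let oppmxE m n (A : 'M[C]_(m, n)) i j : (- A) i j = - A i j.
Proof. by rewrite mxE. Qed.

Let scalemxE m n c (A : 'M[C]_(m, n)) i j : (c *: A) i j = c * A i j.
Proof. by rewrite mxE. Qed.

Let scalar11 (c : C) : (c%:M : 'M[C]_1) 0 0 = c.
Proof. by rewrite mxE. Qed.

Lemma ctrmxK m n (A : 'M[C]_(m, n)) : A^t*^t* = A.
Proof. by apply/matrixP => i j; rewrite !mxE conjCK. Qed.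

Lemma ctrmxE m n (A : 'M[C]_(m, n)) i j : (A^t*) i j = (A j i)^*.
Proof. by rewrite !mxE. Qed.

Lemma ctrmx_mul m n p (A : 'M[C]_(m, n)) (B : 'M[C]_(n, p)) :
  (A *m B)^t* = B^t* *m A^t*.
Proof. by rewrite trmx_mul map_mxM. Qed.

Lemma row_sqnorm n (x : 'rV[C]_n) :
  (x *m x^t*) 0 0 = (\sum_j absq (x 0 j))%:C.
Proof.
rewrite mxE rmorph_sum/=; apply: eq_bigr => j _.
by rewrite !mxE mul_conj_absq.
Qed.

Lemma row_sqnorm_ge0 n (x : 'rV[C]_n) : 0 <= (x *m x^t*) 0 0.
Proof.
by rewrite row_sqnorm lecR sumr_ge0// => j _; exact: absq_ge0.
Qed.

Lemma row_sqnorm_gt0 n (x : 'rV[C]_n) : x != 0 -> 0 < (x *m x^t*) 0 0.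
Proof.
move=> x0; rewrite lt_neqAle row_sqnorm_ge0 andbT eq_sym; apply: contra x0.
rewrite row_sqnorm fmorph_eq0 psumr_eq0; last by move=> j _; exact: absq_ge0.
move=> /allP h; apply/eqP/rowP => j; rewrite mxE; apply/eqP.
by rewrite -absq_eq0; apply: h; rewrite mem_index_enum.
Qed.

Definition posdef n (M : 'M[C]_n) :=
  M^t* = M /\ forall x : 'rV[C]_n, x != 0 -> 0 < (x *m M *m x^t*) 0 0.

Lemma posdef_unit n (M : 'M[C]_n) : posdef M -> M \in unitmx.
Proof.
move=> [_ Mp]; rewrite -row_free_unit; apply/row_freeP; apply: contrapT => nf.
have : ~~ row_free M by apply/negP => /row_freeP.
rewrite -kermx_eq0 => /rowV0Pn[v /sub_kermxP vM v0].
by have := Mp _ v0; rewrite vM mul0mx mxE ltxx.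
Qed.

Lemma posdef_gram m n (B : 'M[C]_(m, n)) : posdef (1%:M + B *m B^t*).
Proof.
split.
  by rewrite linearD/= map_mxD trmx1 map_mx1 ctrmx_mul ctrmxK.
move=> x x0; rewrite mulmxDr mulmxDl mulmx1 mxE addrC ltr_wpDl//.
  rewrite !mulmxA -[_ *m B^t* *m _]mulmxA -ctrmx_mul.
  exact: row_sqnorm_ge0.
exact: row_sqnorm_gt0.
Qed.

Lemma posdef_conj n (M S : 'M[C]_n) : posdef M -> S \in unitmx ->
  posdef (S *m M *m S^t*).
Proof.
move=> [Mh Mp] Su; split; first by rewrite !ctrmx_mul ctrmxK Mh mulmxA.
move=> x x0; rewrite !mulmxA -[_ *m S^t* *m _]mulmxA -ctrmx_mul.
apply: Mp; apply: contra x0 => /eqP xS0; apply/eqP.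
by rewrite -(mulmxK Su x) xS0 mul0mx.
Qed.

Let conj_quad (c e s : C) :
  - ((c - e) / s * Num.conj e) + Num.conj c * ((c - e) / s) = (absq (c - e))%:C / s.
Proof.
have -> : (absq (c - e))%:C = (c - e) * (Num.conj c - Num.conj e).
  by rewrite -rmorphB; exact/esym/mul_conj_absq.
ring.
Qed.

Section Schur.
Context {m : nat}.
Variables (M : 'M[C]_m) (a : 'cV[C]_m) (d : C).
Let B : 'M[C]_(m + 1) := block_mx M a (a^t*) (d%:M).
Hypothesis PB : posdef B.

Lemma posdef_ulblock : posdef M.
Proof.
have [Bh Bp] := PB; split.
  have := congr1 (fun X => ulsubmx X) Bh.
  by rewrite /B tr_block_mx map_block_mx !block_mxKul.
move=> x x0; have := Bp (row_mx x 0).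
rewrite mul_row_block !mul0mx !addr0 tr_row_mx map_col_mx mul_row_col.
rewrite trmx0 map_mx0 mulmx0 addr0; apply.
by rewrite row_mx_eq0 negb_and x0.
Qed.

Let Mu : M \in unitmx := posdef_unit posdef_ulblock.

Lemma invmx_herm : (invmx M)^t* = invmx M.
Proof.
have [Mh _] := posdef_ulblock.
apply: (can_inj (mulmxK Mu)); rewrite mulVmx// -{2}Mh -ctrmx_mul mulmxV//.
by rewrite trmx1 map_mx1.
Qed.

Definition schur_compl : C := d - (a^t* *m invmx M *m a) 0 0.

Lemma schur_compl_gt0 : 0 < schur_compl.
Proof.
have [_ Bp] := PB.
have := Bp (row_mx (- (a^t* *m invmx M)) 1%:M).
rewrite mul_row_block mulNmx mulmxKV// mul1mx addNr tr_row_mx map_col_mx.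
rewrite mul_row_col mul0mx add0r trmx1 map_mx1 mulmx1 mulNmx mul1mx.
rewrite addmxE oppmxE scalar11 addrC; apply.
rewrite -row_mx0 -[0]/(0 : 'M[C]_(_, _)).
apply/eqP => /eq_row_mx[_ /matrixP/(_ 0 0)/eqP].
by rewrite !mxE oner_eq0.
Qed.

Lemma det_schur : \det B = \det M * schur_compl.
Proof.
have -> : B = block_mx 1%:M 0 (a^t* *m invmx M) 1%:M *m
             block_mx M a 0 schur_compl%:M.
  rewrite mulmx_block !mul1mx !mul0mx !addr0 mulmxKV//; congr block_mx.
  apply/matrixP => i j; rewrite !ord1 addmxE !scalar11 /schur_compl.
  by rewrite addrC subrK.
by rewrite det_mulmx det_lblock !det1 !mul1r det_ublock det_scalar1.
Qed.

(** This completes the square in the last coordinate c, so that integrating over c amounts to a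
    translated and dilated copy of one fixed integral. *)
Lemma quad_schur (v : 'cV[C]_m) (c : C) :
  ((col_mx v c%:M)^t* *m invmx B *m col_mx v c%:M) 0 0 =
  (v^t* *m invmx M *m v) 0 0 +
  (absq (c - (a^t* *m invmx M *m v) 0 0))%:C / schur_compl.
Proof.
have s0 : schur_compl != 0 by rewrite gt_eqF// schur_compl_gt0.
pose e : C := (a^t* *m invmx M *m v) 0 0.
pose w : C := (c - e) / schur_compl.
(* The solution of B y = (v, c), found by block elimination. *)
pose y := col_mx (invmx M *m v - w *: (invmx M *m a)) w%:M.
have Ey : B *m y = col_mx v c%:M.
  rewrite mul_block_col mulmxBr mulKVmx// -scalemxAr mulKVmx//; congr col_mx.
    by rewrite mul_mx_scalar subrK.
  apply/matrixP => i j; rewrite !ord1 mulmxBr -scalemxAr !mulmxA.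
  rewrite -scalar_mxM !addmxE oppmxE scalemxE -/e !scalar11 /w.
  have -> : (a^t* *m invmx M *m a) 0 0 = d - schur_compl by rewrite /schur_compl subKr.
  by field.
have -> : (col_mx v c%:M)^t* *m invmx B *m col_mx v c%:M = (col_mx v c%:M)^t* *m y.
  by rewrite -mulmxA -{2}Ey mulKmx// posdef_unit.
rewrite tr_col_mx map_row_mx mul_row_col tr_scalar_mx map_scalar_mx mul_scalar_mx.
rewrite mulmxBr -scalemxAr !mulmxA.
have Ec : (v^t* *m invmx M *m a) 0 0 = e^*.
  have -> : v^t* *m invmx M *m a = (a^t* *m invmx M *m v)^t*.
    by rewrite !ctrmx_mul ctrmxK invmx_herm mulmxA.
  by rewrite ctrmxE.
rewrite !addmxE oppmxE !scalemxE Ec scalar11 -addrA; congr (_ + _).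
exact: conj_quad.
Qed.

End Schur.

Lemma herm_block k (B : 'M[C]_(k + 1)) : B^t* = B ->
  B = block_mx (ulsubmx B) (ursubmx B) ((ursubmx B)^t*) (drsubmx B 0 0)%:M.
Proof.
move=> Bh; rewrite -[LHS]submxK; congr block_mx; last exact: mx11_scalar.
by rewrite -{1}Bh; apply/matrixP => i j; rewrite !mxE.
Qed.

Lemma posdef_det_gt0 k (M : 'M[C]_k) : posdef M -> 0 < \det M.
Proof.
elim: k M => [|k ih]; first by move=> M _; rewrite det_mx00 ltr01.
rewrite -[k.+1]addn1 => B PB; have [Bh _] := PB.
have BE := herm_block Bh; rewrite BE in PB *.
rewrite det_schur// mulr_gt0 ?schur_compl_gt0//.
by apply: ih; exact: (posdef_ulblock PB).
Qed.

(** Eliminating the last row and column of the Gram matrix leaves D = M + u u^* / e with e = 1 +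
    |l|^2, because 1 - |l|^2 / e = 1 / e. The same D is a Schur complement of the matrix with blocks
    M, -u, u^* and e, whose other Schur complement is the scalar e + u^* M^-1 u. *)
Lemma det_gram_block m (T : 'M[C]_m) (u : 'cV[C]_m) (l : C) :
  \det (1%:M + block_mx T u 0 l%:M *m (block_mx T u 0 l%:M)^t*) =
  \det (1%:M + T *m T^t*) *
  ((1 + absq l)%:C + (u^t* *m invmx (1%:M + T *m T^t*) *m u) 0 0).
Proof.
set M := 1%:M + T *m T^t*.
have Mu : M \in unitmx by apply: posdef_unit; exact: posdef_gram.
pose e : C := (1 + absq l)%:C.
have e0 : e != 0 by rewrite fmorph_eq0 gt_eqF// ltr_wpDr// absq_ge0.
have -> : 1%:M + block_mx T u 0 l%:M *m (block_mx T u 0 l%:M)^t* =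
    block_mx (M + u *m u^t*) (l^* *: u) (l *: u^t*) e%:M.
  rewrite tr_block_mx map_block_mx mulmx_block trmx0 map_mx0 !mulmx0 !mul0mx !add0r.
  rewrite tr_scalar_mx map_scalar_mx -scalar_mxM mul_mx_scalar mul_scalar_mx.
  rewrite scalar_mx_block add_block_mx !add0r addrA; congr block_mx.
  apply/matrixP => i j; rewrite !ord1 addmxE !scalar11 mul_conj_absq /e.
  by apply/eqP; rewrite eq_complex/= addr0 !eqxx.
pose D := M + e^-1 *: (u *m u^t*).
have E1 : block_mx 1%:M (- (l^* / e) *: u) 0 1%:M *m
    block_mx (M + u *m u^t*) (l^* *: u) (l *: u^t*) e%:M =
    block_mx D 0 (l *: u^t*) e%:M.
  rewrite mulmx_block !mul1mx !mul0mx !add0r -!scalemxAl -scalemxAr mul_mx_scalar.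
  rewrite !scalerA !mulNr divfK// !scaleNr subrr; congr block_mx.
  rewrite /D -addrA; congr (_ + _).
  rewrite -[X in X - _]scale1r -scalerBl; congr (_ *: _).
  have Ee : e = 1 + l * Num.conj l.
    by rewrite mul_conj_absq; apply/eqP; rewrite eq_complex/= addr0 !eqxx.
  rewrite mulrAC [_ * l]mulrC -[l * _](addrK 1) [_ + 1]addrC -Ee.
  by rewrite mulrBl mulfV// mul1r subKr.
have E2 : block_mx 1%:M (e^-1 *: u) 0 1%:M *m block_mx M (- u) (u^t*) e%:M =
    block_mx D 0 (u^t*) e%:M.
  rewrite mulmx_block !mul1mx !mul0mx !add0r -!scalemxAl mul_mx_scalar scalerA.
  by rewrite mulVf// scale1r addNr.
have E3 : block_mx M (- u) (u^t*) e%:M =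
    block_mx 1%:M 0 (u^t* *m invmx M) 1%:M *m
    block_mx M (- u) 0 (e + (u^t* *m invmx M *m u) 0 0)%:M.
  rewrite mulmx_block !mul1mx !mul0mx !addr0 mulmxKV// mulmxN; congr block_mx.
  apply/matrixP => i j; rewrite !ord1 addmxE oppmxE !scalar11 addrC.
  by rewrite addrK.
have := congr1 determinant E1.
rewrite det_mulmx det_ublock !det1 !mul1r => ->.
rewrite det_lblock.
have := congr1 determinant E2.
rewrite det_mulmx det_ublock !det1 !mul1r det_lblock => <-.
by rewrite E3 det_mulmx det_lblock !det1 !mul1r det_ublock det_scalar1.
Qed.

End PositiveDefinite.

Section MatrixMeasurable.
Context {R : realType} d (T : measurableType d).
Local Notation C := R[i].
Local Open Scope sesquilinear_scope.

Definition mmeas m n (F : T -> 'M[C]_(m, n)) := forall i j, cmeas (fun x => F x i j).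

Lemma mmeas_cst m n (A : 'M[C]_(m, n)) : mmeas (fun=> A).
Proof. by move=> i j; exact: cmeas_cst. Qed.

Lemma mmeas_mul m n p (F : T -> 'M[C]_(m, n)) (G : T -> 'M[C]_(n, p)) :
  mmeas F -> mmeas G -> mmeas (fun x => F x *m G x).
Proof.
move=> mF mG i j; apply: (cmeas_eq (g := fun x => \sum_k F x i k * G x k j)) => [x|].
  by rewrite mxE.
by apply: cmeas_sum => k; exact: cmeasM.
Qed.

Lemma mmeas_ct m n (F : T -> 'M[C]_(m, n)) : mmeas F -> mmeas (fun x => (F x)^t*).
Proof.
move=> mF i j; apply: (cmeas_eq (g := fun x => (F x j i)^*)) => [x|].
  by rewrite ctrmxE.
exact: cmeasJ.
Qed.

Lemma mmeasD m n (F G : T -> 'M[C]_(m, n)) :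
  mmeas F -> mmeas G -> mmeas (fun x => F x + G x).
Proof.
move=> mF mG i j; apply: (cmeas_eq (g := fun x => F x i j + G x i j)) => [x|].
  by rewrite mxE.
exact: cmeasD.
Qed.

End MatrixMeasurable.

(** * Integration of a column of the Schur form *)

Section ColumnIntegral.
Context {R : realType}.
Local Notation C := R[i].
Local Notation CR := (measurableTypeR R * measurableTypeR R)%type.
Local Open Scope sesquilinear_scope.

Definition colv k (s : seq CR) : 'cV[C]_k := \col_(i < k) toC (nth point s i).

Definition qform k (M : 'M[C]_k) (v : 'cV[C]_k) : R :=
  complex.Re ((v^t* *m invmx M *m v) 0 0).

Lemma mulmx_row_col m n p (X : 'M[C]_(m, n)) (Y : 'M[C]_(n, p)) i j :
  (X *m Y) i j = (row i X *m col j Y) 0 0.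
Proof. by rewrite !mxE; apply: eq_bigr => k _; rewrite !mxE. Qed.

Lemma ReDreal (x : C) (r : R) : complex.Re (x + r%:C) = complex.Re x + r.
Proof. by case: x. Qed.

Lemma ReDdiv (x : C) (r t : R) : complex.Re (x + r%:C / t%:C) = complex.Re x + r / t.
Proof. by rewrite -fmorphV -rmorphM ReDreal. Qed.

Lemma qform_ge0 k (M : 'M[C]_k) v : posdef M -> 0 <= qform M v.
Proof.
move=> PM; have [Mh Mp] := PM; have Mu := posdef_unit PM.
rewrite /qform.
have -> : v^t* *m invmx M *m v =
    (invmx M *m v)^t* *m M *m ((invmx M *m v)^t*)^t*.
  rewrite ctrmxK ctrmx_mul.
  have -> : (invmx M)^t* = invmx M.
    apply: (can_inj (mulmxK Mu)); rewrite mulVmx// -{2}Mh -ctrmx_mul mulmxV//.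
    by rewrite trmx1 map_mx1.
  by rewrite -!mulmxA mulKVmx.
have [->|x0] := eqVneq ((invmx M *m v)^t*) 0.
  by rewrite !mul0mx mxE.
by have /posC_real[_ /ltW] := Mp _ x0.
Qed.

Lemma measurable_invX d (T : measurableType d) (f : T -> R) n :
  measurable_fun setT f -> measurable_fun setT (fun x => (f x)^-1 ^+ n).
Proof. by move=> mf; apply: measurable_funX; exact: measurable_fun_inv. Qed.

Lemma Tmeas_colv n k : mmeas (fun t : n.-tuple CR => colv k t).
Proof.
move=> i j; apply: (cmeas_eq (g := fun t => toC (nth point (tval t) i))) => [t|].
  by rewrite mxE.
by apply: cmeas_comp; [exact: cmeas_toC|exact: Tmeas_nth].
Qed.

Lemma measurable_qform d (T : measurableType d) k (M : 'M[C]_k) (v : T -> 'cV[C]_k) :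
  mmeas v -> measurable_fun setT (fun x => qform M (v x)).
Proof.
move=> mv; apply: measurable_Re.
apply: mmeas_mul => //; apply: mmeas_mul; first exact: mmeas_ct.
exact: mmeas_cst.
Qed.

Lemma colv_rcons k u c : size u = k ->
  colv (k + 1) (rcons u c) = col_mx (colv k u) (toC c)%:M.
Proof.
move=> uk; apply/matrixP => i j; rewrite !mxE nth_rcons uk.
case: splitP => i' ei; rewrite !mxE ei//.
have i'0 : i' = 0%N :> nat by rewrite (ord1 i').
by rewrite i'0 addn0 eqxx !ord1 eqxx.
Qed.

Local Open Scope ereal_scope.

Lemma Cmeas_absq (G : R -> \bar R) : measurable_fun setT G ->
  Cmeas (fun c => G (absq c)).
Proof.
move=> mG; apply: (measurableT_comp mG); apply: measurable_absq.
exact: cmeas_toC.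
Qed.

Lemma Cint_absq_scale (G : R -> \bar R) (a : R) : (0 < a)%R ->
  measurable_fun setT G -> (forall x, 0 <= G x) ->
  Cint (fun c => G (absq c)) = a%:E * Cint (fun c => G (a * absq c)%R).
Proof.
move=> a0 mG G0.
have s0 : ((Num.sqrt a)%:C != 0 :> C)%R by rewrite fmorph_eq0 sqrtr_eq0 -ltNge.
have := Cint_scale s0 (Cmeas_absq mG) (fun c => G0 _).
rewrite absq_real sqr_sqrtr ?ltW// => E.
transitivity (a%:E * Cint (fun c => G (absq ((Num.sqrt a)%:C * c)%R))).
  by rewrite E muleA -EFinM mulfV ?gt_eqF// mul1e.
congr (_ * _); apply: eq_Cint => c.
by rewrite absqM absq_real sqr_sqrtr// ltW.
Qed.

Definition cauchy_mass (n : nat) : \bar R := Cint (fun v => ((1 + absq v)^-1 ^+ n)%:E).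

Lemma cauchy_mass_ge0 n : 0 <= cauchy_mass n.
Proof.
by apply: Cint_ge0 => v; rewrite lee_fin exprn_ge0// invr_ge0 addr_ge0// absq_ge0.
Qed.

(** Translation by c0 and dilation by the factor s B on |c|^2 reduce the integral to
    [cauchy_mass]. *)
Lemma Cint_cauchy n (B s : R) (c0 : C) : (0 < B)%R -> (0 < s)%R ->
  Cint (fun c => ((B + absq (c - c0) / s)^-1 ^+ n.+1)%:E) =
  (s * B^-1 ^+ n)%:E * cauchy_mass n.+1.
Proof.
move=> B0 s0.
(* The absolute value makes [G] nonnegative on all of R without changing it at [absq c]; the same
   device recurs below. *)
pose G (x : R) := ((B + `|x| / s)^-1 ^+ n.+1)%:E.
have mG : measurable_fun setT G.
  apply/measurable_EFinP; apply: measurable_invX; apply: measurable_funD => //.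
  by apply: measurable_funM => //; exact: measurableT_comp.
have G0 x : 0 <= G x.
  by rewrite lee_fin exprn_ge0// invr_ge0 addr_ge0 ?(ltW B0)// divr_ge0// ltW.
have GE (c : C) : ((B + absq c / s)^-1 ^+ n.+1)%:E = G (absq c).
  by rewrite /G ger0_norm// absq_ge0.
transitivity (Cint (fun c => G (absq (c - c0)%R))).
  by apply: eq_Cint => c; rewrite GE.
rewrite (Cint_translate (f := fun c => G (absq c)) (- c0)%R) //; last exact: Cmeas_absq.
have sB : (0 < s * B)%R by rewrite mulr_gt0.
rewrite (Cint_absq_scale sB)//.
rewrite 2!EFinM -!muleA; congr (_ * _).
transitivity (B%:E * Cint (fun c => (B^-1 ^+ n.+1)%:E * ((1 + absq c)^-1 ^+ n.+1)%:E)).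
  congr (_ * _); apply: eq_Cint => c; rewrite /G -EFinM -exprMn; congr (_ ^+ _)%:E.
  rewrite normrM !ger0_norm ?absq_ge0// ?ltW//.
  rewrite -invfM; congr (_^-1)%R; field.
  by rewrite gt_eqF.
rewrite CintZl; last 3 first.
- apply/measurable_EFinP; apply: measurable_invX; apply: measurable_funD => //.
  by apply: measurable_absq; exact: cmeas_toC.
- by move=> v; rewrite lee_fin exprn_ge0// invr_ge0 addr_ge0// absq_ge0.
- by rewrite lee_fin exprn_ge0// invr_ge0 ltW.
by rewrite muleA -EFinM exprS mulrA mulfV ?mul1r// gt_eqF.
Qed.

(** Coordinates are integrated from the last one down, each contributing a Schur complement to the
    determinant of M. The first coordinate, on which G depends, remains for k = 1, where M is its
    corner entry. [K] depends on p and k only, which is what allows M and A to vary with the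
    remaining variables later. *)
Lemma column_integral_first p k : exists K : \bar R, 0 <= K /\
  forall (i0 : 'I_k) (M : 'M[C]_k) (A : R) (G : R -> \bar R),
  i0 = 0%N :> nat -> posdef M -> (0 < A)%R ->
  measurable_fun setT G -> (forall x, 0 <= G x) ->
  Tint k (fun u => G (absq (toC (nth point u 0))) *
                   ((A + qform M (colv k u))^-1 ^+ (p + k))%:E) =
  K * ((complex.Re (\det M) * A^-1 ^+ p)%:E *
  Cint (fun v => G (complex.Re (M i0 i0) * A * absq v)%R * ((1 + absq v)^-1 ^+ p.+1)%:E)).
Proof.
(* For k = 0 there is no index [i0] and the claim is vacuous; the induction really starts at k =
   1. *)
elim: k => [|k [K [K0 ih]]]; first by exists 0; split => // -[].
have [k0|k_gt0] := posnP k.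
  subst k; exists 1; split => // i0 B A G i00 [_ Bp] A0 mG G0.
  have Bm := mx11_scalar B; set m := (B 0 0)%R in Bm.
  have [mE m0] : m = (complex.Re m)%:C /\ (0 < complex.Re m)%R.
    apply: posC_real; have := Bp (1%:M)%R; rewrite mul1mx trmx1 map_mx1 mulmx1; apply.
    by apply/eqP => /matrixP/(_ 0%R 0%R)/eqP; rewrite !mxE oner_eq0.
  set r := complex.Re m in mE m0.
  have rA : (0 < r * A)%R by rewrite mulr_gt0.
  have qE (u : seq CR) : qform B (colv 1 u) = (absq (toC (nth point u 0)) / r)%R.
    rewrite /qform Bm invmx_scalar mul_mx_scalar -scalemxAl mxE.
    rewrite mxE big_ord1 !mxE [X in (_ * X)%R]mulrC.
    by rewrite mul_conj_absq mE -fmorphV -rmorphM/= mulrC.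
  pose H (x : R) := G x * ((A + `|x| / r)^-1 ^+ p.+1)%:E.
  have mH : measurable_fun setT H.
    apply: emeasurable_funM => //.
    apply/measurable_EFinP; apply: measurable_invX; apply: measurable_funD => //.
    by apply: measurable_funM => //; exact: measurableT_comp.
  have H0 x : 0 <= H x.
    by rewrite mule_ge0// lee_fin exprn_ge0// invr_ge0 addr_ge0 ?(ltW A0)// divr_ge0// ltW.
  transitivity (Cint (fun c => H (absq c))).
    rewrite Tint1.
    - apply: eq_integral => c _; rewrite qE addn1 /H/= ger0_norm// absq_ge0 //.
    - apply: emeasurable_funM.
        apply: (measurableT_comp mG); apply: measurable_absq.
        by apply: cmeas_comp; [exact: cmeas_toC|exact: Tmeas_nth].
      apply/measurable_EFinP; apply: measurable_invX; apply: measurable_funD => //.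
      apply: measurable_qform; exact: Tmeas_colv.
    - move=> u; rewrite mule_ge0// lee_fin exprn_ge0// invr_ge0 qE addr_ge0 ?(ltW A0)//.
      by rewrite divr_ge0 ?absq_ge0// ltW.
  rewrite (Cint_absq_scale rA)// mul1e.
  have -> : complex.Re (\det B) = r by rewrite Bm det_scalar1.
  have -> : B i0 i0 = m by rewrite (ord1 i0).
  rewrite 2!EFinM -!muleA; congr (_ * _).
  have mI : Cmeas (fun c : C => G (r * A * absq c)%R * ((1 + absq c)^-1 ^+ p.+1)%:E).
    apply: (@Cmeas_absq (fun x => G (r * A * x)%R * ((1 + x)^-1 ^+ p.+1)%:E)).
    apply: emeasurable_funM.
      by apply: (measurableT_comp mG); exact: measurable_funM.
    by apply/measurable_EFinP; apply: measurable_invX; exact: measurable_funD.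
  transitivity (A%:E * Cint (fun c => (A^-1 ^+ p.+1)%:E *
      (G (r * A * absq c)%R * ((1 + absq c)^-1 ^+ p.+1)%:E))).
    congr (_ * _); apply: eq_Cint => c; rewrite /H muleCA -EFinM -exprMn.
    congr (_ * (_ ^+ _)%:E); rewrite normrM !ger0_norm ?absq_ge0// ?ltW//.
    rewrite -invfM; congr (_^-1)%R; field.
    by rewrite gt_eqF.
  rewrite CintZl//; last 2 first.
  - move=> c; rewrite mule_ge0// lee_fin exprn_ge0// invr_ge0 addr_ge0// absq_ge0 //.
  - by rewrite lee_fin exprn_ge0// invr_ge0 ltW.
  by rewrite muleA -EFinM exprS mulrA mulfV ?mul1r// gt_eqF.
exists (K * cauchy_mass (p + k).+1); split; first by rewrite mule_ge0 ?cauchy_mass_ge0.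
rewrite -[k.+1]addn1 => i0 B A G i00 PB A0 mG G0.
pose M := ulsubmx B; pose a := ursubmx B; pose dd : C := (drsubmx B 0 0)%R.
have BE : B = block_mx M a (a^t*) (dd%:M)%R by have [Bh _] := PB; exact: herm_block.
rewrite BE in PB *.
have PM := posdef_ulblock PB.
have [sE s0] := posC_real (schur_compl_gt0 PB).
set s := complex.Re _ in sE s0.
pose i1 := Ordinal k_gt0.
have -> : i0 = lshift 1 i1 by apply: ord_inj; rewrite /= i00.
rewrite block_mxEul det_schur//.
have detM : complex.Re (\det M * schur_compl M a dd)%R = (complex.Re (\det M) * s)%R.
  by rewrite sE; case: (\det M) => x y /=; rewrite mulr0 subr0.
have pk : (p + (k + 1))%N = (p + k).+1 by rewrite addn1 addnS.
have q0 u : (0 < A + qform M (colv k u))%R by rewrite ltr_wpDr// qform_ge0.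
have mq n m : mmeas (fun t : n.-tuple CR => colv m t) by exact: Tmeas_colv.
rewrite detM [X in Tint X]addn1 Tint_rcons; last 2 first.
- apply: emeasurable_funM.
    apply: (measurableT_comp mG); apply: measurable_absq.
    by apply: cmeas_comp; [exact: cmeas_toC|exact: Tmeas_nth].
  apply/measurable_EFinP; apply: measurable_invX; apply: measurable_funD => //.
  by apply: measurable_qform; exact: Tmeas_colv.
- move=> u; rewrite mule_ge0// lee_fin exprn_ge0// invr_ge0 addr_ge0 ?(ltW A0)//.
  exact: qform_ge0.
transitivity (Tint k (fun u => (s%:E * cauchy_mass (p + k).+1) *
   (G (absq (toC (nth point u 0))) * ((A + qform M (colv k u))^-1 ^+ (p + k))%:E))).
  apply: eq_Tint => u uk.
  pose c0 : C := ((a^t* *m invmx M *m colv k u) 0 0)%R.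
  transitivity (\int[@lebesgue_complex R]_c (G (absq (toC (nth point u 0))) *
     ((A + qform M (colv k u) + absq (toC c - c0) / s)^-1 ^+ (p + k).+1)%:E)).
    apply: eq_integral => c _; rewrite nth_rcons uk k_gt0 pk colv_rcons//.
    congr (_ * (_^-1 ^+ _)%:E); rewrite -addrA; congr (_ + _)%R.
    have qE := quad_schur PB (colv k u) (toC c).
    by rewrite /qform qE -/c0 sE ReDdiv.
  rewrite ge0_integralTZl//; last 2 first.
  - apply/measurable_EFinP; apply: measurable_invX; apply: measurable_funD => //.
    apply: measurable_funM => //; apply: measurable_absq; apply: cmeasB.
      exact: cmeas_toC.
    exact: cmeas_cst.
  - move=> c; rewrite lee_fin exprn_ge0// invr_ge0 addr_ge0 ?(ltW (q0 u))//.
    by rewrite divr_ge0 ?absq_ge0// ltW.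
  rewrite [X in _ * X](Cint_cauchy (p + k) c0 (q0 u) s0) EFinM.
  by rewrite muleCA -!muleA; congr (_ * _); rewrite muleCA [in RHS]muleCA; congr (_ * _);
    rewrite muleC.
rewrite TintZl; last 3 first.
- apply: emeasurable_funM.
    apply: (measurableT_comp mG); apply: measurable_absq.
    by apply: cmeas_comp; [exact: cmeas_toC|exact: Tmeas_nth].
  apply/measurable_EFinP; apply: measurable_invX; apply: measurable_funD => //.
  by apply: measurable_qform; exact: Tmeas_colv.
- move=> u; rewrite mule_ge0// lee_fin exprn_ge0// invr_ge0.
  exact/ltW.
- by rewrite mule_ge0 ?cauchy_mass_ge0// lee_fin ltW.
rewrite (ih i1)// !EFinM !muleA; congr (_ * _ * _).
by rewrite [RHS]muleC -!muleA; congr (_ * _); rewrite muleCA.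
Qed.

Lemma qform_conj k (M S : 'M[C]_k) v : posdef M -> S \in unitmx ->
  qform (S *m M *m S^t*) (S *m v) = qform M v.
Proof.
move=> PM Su; have Mu := posdef_unit PM.
have Nu := posdef_unit (posdef_conj PM Su).
have S'u : S^t* \in unitmx by rewrite map_unitmx unitmx_tr.
rewrite /qform -mulmxA; congr (complex.Re (_ _ _)).
have E : S *m v = (S *m M *m S^t*) *m (invmx (S^t*) *m (invmx M *m v)).
  by rewrite -!mulmxA (mulKVmx S'u) (mulKVmx Mu).
have -> : invmx (S *m M *m S^t*) *m (S *m v) = invmx (S^t*) *m (invmx M *m v).
  by rewrite [in LHS]E (mulKmx Nu).
by rewrite ctrmx_mul -mulmxA (mulKVmx S'u) mulmxA.
Qed.

Lemma Tint_shear k (F H : seq CR -> \bar R) (l : seq CR -> C) : (0 < k)%N ->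
  Tmeas k F -> (forall s, 0 <= F s) -> Tmeas k H -> (forall s, 0 <= H s) ->
  (forall c t, size t = k.-1 -> F (c :: t) = H (ofC (toC c + l t)%R :: t)) ->
  Tint k F = Tint k H.
Proof.
case: k => // k _ mF F0 mH H0 FH.
rewrite (Tint_cons mF F0) (Tint_cons mH H0); apply: eq_Tint => t tk.
transitivity (Cint (fun x => H (ofC (x + l t)%R :: t))).
  by apply: eq_integral => c _; rewrite FH.
have mHt : Cmeas (fun x => H (ofC x :: t)).
  rewrite /Cmeas; under eq_fun do rewrite toCK.
  apply: (Tmeas_comp mH) => [c|i]; first by rewrite /= tk.
  by case: i => [|i] /=; [exact: measurable_id|exact: measurable_cst].
rewrite (Cint_translate (f := fun x => H (ofC x :: t)))//.
by apply: eq_integral => c _; rewrite toCK.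
Qed.

(* Shearing the first coordinate, which preserves Lebesgue measure as L has
   first entry 1, turns the linear form L into that coordinate. *)
Lemma column_integral p k : exists K : \bar R, 0 <= K /\
  forall (i0 : 'I_k) (M : 'M[C]_k) (L : 'rV[C]_k) (A : R) (G : R -> \bar R),
  i0 = 0%N :> nat -> posdef M -> L 0%R i0 = 1%R -> (0 < A)%R ->
  measurable_fun setT G -> (forall x, 0 <= G x) ->
  Tint k (fun u => G (absq ((L *m colv k u) 0 0)%R) *
                   ((A + qform M (colv k u))^-1 ^+ (p + k))%:E) =
  K * ((complex.Re (\det M) * A^-1 ^+ p)%:E *
  Cint (fun v => G (complex.Re ((L *m M *m L^t*) 0 0)%R * A * absq v)%R *
                 ((1 + absq v)^-1 ^+ p.+1)%:E)).
Proof.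
have [K [K0 colK]] := column_integral_first p k; exists K; split => //.
move=> i0 M L A G i00 PM Li0 A0 mG G0.
(* The identity with first row replaced by L: a unit upper triangular matrix, so S u has first entry
   L u and otherwise the entries of u, while S M S^* has corner entry L M L^* and the determinant of
   M. *)
pose S : 'M[C]_k := (\matrix_(i, j) if i == i0 then L 0 j else (i == j)%:R)%R.
have rowS : row i0 S = L by apply/rowP => j; rewrite !mxE eqxx.
have detS : (\det S = 1)%R.
  rewrite -det_tr det_trig; last first.
    apply/is_trig_mxP => i j ij; rewrite !mxE.
    case: eqP => [jE|_]; first by move: ij; rewrite jE i00.
    by case: eqP => // ji; move: ij; rewrite ji ltnn.
  apply: big1 => i _; rewrite !mxE eqxx; case: eqP => // ->; exact: Li0.
have Su : S \in unitmx by rewrite unitmxE detS unitr1.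
have := colK i0 (S *m M *m S^t*) A G i00 (posdef_conj PM Su) A0 mG G0.
have -> : (S *m M *m S^t*) i0 i0 = ((L *m M *m L^t*) 0 0)%R.
  rewrite -rowS; have -> : (row i0 S)^t* = col i0 (S^t*).
    by apply/matrixP => i j; rewrite !mxE.
  by rewrite -row_mul -mulmx_row_col.
have -> : (\det (S *m M *m S^t*) = \det M)%R.
  by rewrite !det_mulmx det_map_mx det_tr detS rmorph1 mul1r mulr1.
move=> <-.
pose H (s : seq CR) := G (absq (toC (nth point s 0))) *
  ((A + qform (S *m M *m S^t*) (colv k s))^-1 ^+ (p + k))%:E.
pose F (s : seq CR) := G (absq ((L *m colv k s) 0 0)%R) *
  ((A + qform M (colv k s))^-1 ^+ (p + k))%:E.
have mF : Tmeas k F.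
  apply: emeasurable_funM.
    apply: (measurableT_comp mG); apply: measurable_absq.
    by apply: mmeas_mul; [exact: mmeas_cst|exact: Tmeas_colv].
  apply/measurable_EFinP; apply: measurable_invX; apply: measurable_funD => //.
  by apply: measurable_qform; exact: Tmeas_colv.
have F0 s : 0 <= F s.
  by rewrite mule_ge0// lee_fin exprn_ge0// invr_ge0 addr_ge0 ?(ltW A0) ?qform_ge0.
have mH : Tmeas k H.
  apply: emeasurable_funM.
    apply: (measurableT_comp mG); apply: measurable_absq.
    by apply: cmeas_comp; [exact: cmeas_toC|exact: Tmeas_nth].
  apply/measurable_EFinP; apply: measurable_invX; apply: measurable_funD => //.
  by apply: measurable_qform; exact: Tmeas_colv.
have H0 s : 0 <= H s.
  rewrite mule_ge0// lee_fin exprn_ge0// invr_ge0 addr_ge0 ?(ltW A0)//.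
  by apply: qform_ge0; exact: posdef_conj.
rewrite -/(Tint k F) -/(Tint k H).
have FE s : F s = G (absq ((S *m colv k s) i0 0)%R) *
    ((A + qform (S *m M *m S^t*) (S *m colv k s))^-1 ^+ (p + k))%:E.
  rewrite qform_conj//; congr (G (absq _) * _).
  by rewrite -{1}rowS -row_mul mxE.
have [l FH] : exists l : seq CR -> C, forall c t, size t = k.-1 ->
    F (c :: t) = H (ofC (toC c + l t)%R :: t).
  exists (fun t => (\sum_(j < k | j != i0) L 0 j * toC (nth point t j.-1))%R) => c t tk.
  have SE : S *m colv k (c :: t) =
      colv k (ofC (toC c + \sum_(j < k | j != i0) L 0 j * toC (nth point t j.-1))%R :: t).
    apply/matrixP => i j; rewrite !mxE; have [->|ii0] := eqVneq i i0.
      rewrite i00 /= ofCK (bigD1 i0)//= !mxE eqxx Li0 mul1r i00/=; congr (_ + _)%R.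
      apply: eq_bigr => j' j'i0; rewrite !mxE eqxx; congr (_ * toC _)%R.
      have : j' != 0%N :> nat by apply: contra j'i0 => /eqP j0; apply/eqP/ord_inj; rewrite j0 i00.
      by case: (nat_of_ord j').
    rewrite (bigD1 i)//= !mxE (negbTE ii0) eqxx mul1r big1 ?addr0; last first.
      by move=> j' j'i; rewrite !mxE (negbTE ii0) eq_sym (negbTE j'i) mul0r.
    have : i != 0%N :> nat by apply: contra ii0 => /eqP j0; apply/eqP/ord_inj; rewrite j0 i00.
    by case: (nat_of_ord i).
  rewrite FE SE /H; congr (G (absq _) * _).
  by rewrite mxE i00.
apply: (Tint_shear (l := l) _ mF F0 mH H0 FH).
by rewrite -i00.
Qed.

End ColumnIntegral.

(** * Orthogonality on the sphere *)

Section Moebius.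
Context {R : realType}.
Local Notation C := R[i].
Variable z : C.
Local Open Scope ereal_scope.

(** The rotation of the Riemann sphere that takes z to 0. *)
Definition moebius (l : C) : C := ((l - z) / (1 + z^* * l))%R.

(** Divided by |1 + conj(z) l|^2, this identity computes 1 + |w|^2 for the image w of l; it
    expresses that the map is an isometry of the sphere. *)
Lemma absq_moebius_den (l : C) :
  (absq (1 + z^* * l) + absq (l - z) = (1 + absq z) * (1 + absq l))%R.
Proof. by case: z l => [a b] [c e]; rewrite /absq /=; ring. Qed.

(** The map is a composition of affine maps and an inversion: its value at l is 1 / conj(z) - v (1 +
    |z|^2) / conj(z) with v = 1 / (1 + conj(z) l). The division by conj(z) sets the case z = 0
    apart. *)
Lemma Cint_moebius (f : C -> \bar R) : Cmeas f -> (forall x, 0 <= f x) ->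
  Cint (fun l => ((absq (1 + z^* * l))^-1 ^+ 2)%:E * f (moebius l)) =
  ((1 + absq z)^-1 ^+ 2)%:E * Cint f.
Proof.
move=> mf f0; have [z0|z0] := eqVneq z 0%R.
  rewrite z0 absq0 addr0 invr1 expr1n mul1e; apply: eq_Cint => l.
  rewrite /moebius z0 rmorph0 mul0r addr0 absq1 invr1 expr1n mul1e subr0.
  by rewrite divr1.
set s : R := (1 + absq z)%R.
have s0 : (0 < s)%R by rewrite ltr_wpDr ?absq_ge0.
have c0 : (z^* != 0)%R by rewrite conjc_eq0.
have cs : (1 + z^* * z = s%:C)%R.
  by rewrite mulrC mul_conj_absq; apply/eqP; rewrite eq_complex/= addr0 !eqxx.
have sC0 : (s%:C != 0 :> C)%R by rewrite fmorph_eq0 gt_eqF.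
pose k (v : C) := f ((- s%:C / z^*) * (v + (- s%:C / z^*)^-1 / z^*))%R.
have kE (v : C) : k v = f ((z^*)^-1 - s%:C / z^* * v)%R.
  by congr f; field; rewrite c0 sC0.
have k0 v : 0 <= k v by exact: f0.
have mk0 : Cmeas (fun v => f ((- s%:C / z^*) * v)%R).
  by apply: Cmeas_comp => //; apply: cmeasM; [exact: cmeas_cst|exact: cmeas_toC].
have mk : Cmeas k.
  apply: (Cmeas_comp (f := fun v => f ((- s%:C / z^*) * v)%R)) => //.
  by apply: cmeasD; [exact: cmeas_toC|exact: cmeas_cst].
have Ck : Cint k = ((absq z) * s^-1 ^+ 2)%:E * Cint f.
  rewrite (Cint_translate (f := fun v => f ((- s%:C / z^*) * v)%R)) //.
  rewrite Cint_scale//; last by rewrite mulf_neq0 ?oppr_eq0 ?invr_eq0.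
  congr (_%:E * _); rewrite absqM absqN absqV absqJ absq_real invfM invrK.
  by rewrite exprVn mulrC.
pose g (m : C) := ((absq m)^-1 ^+ 2)%:E * k m^-1%R.
have mg : Cmeas g.
  apply: emeasurable_funM.
    apply/measurable_EFinP; apply: measurable_invX; apply: measurable_absq.
    exact: cmeas_toC.
  by apply: Cmeas_comp => //; apply: cmeasV; exact: cmeas_toC.
have g0 m : 0 <= g m by rewrite mule_ge0// lee_fin exprn_ge0// invr_ge0 absq_ge0.
have mg1 : Cmeas (fun m => g (m + 1)%R).
  by apply: Cmeas_comp => //; apply: cmeasD; [exact: cmeas_toC|exact: cmeas_cst].
have Cg : Cint (fun l => g (z^* * l + 1)%R) = ((absq z)^-1)%:E * Cint k.
  rewrite (Cint_scale (f := fun m => g (m + 1)%R) c0)// absqJ; congr (_ * _).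
  by rewrite Cint_translate// Cint_inv.
have az : absq z != 0%R by rewrite absq_eq0.
transitivity (Cint (fun l => g (z^* * l + 1)%R)); last first.
  by rewrite Cg Ck muleA -EFinM mulrA mulVf// mul1r.
have mm : cmeas (fun c : (measurableTypeR R * measurableTypeR R)%type => moebius (toC c)).
  apply: cmeasM; first by apply: cmeasB; [exact: cmeas_toC|exact: cmeas_cst].
  apply: cmeasV; apply: cmeasD; first exact: cmeas_cst.
  by apply: cmeasM; [exact: cmeas_cst|exact: cmeas_toC].
have E (l : C) : (1 + z^* * l != 0)%R ->
    ((absq (1 + z^* * l))^-1 ^+ 2)%:E * f (moebius l) = g (z^* * l + 1)%R.
  move=> l0; rewrite /g kE [(_ + 1)%R]addrC; congr (_ * f _).
  rewrite -cs /moebius; field.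
  by rewrite c0 l0.
(* At the pole both weights vanish, the inverse of 0 being 0. *)
apply: eq_Cint => l; have [l0|l0] := eqVneq (1 + z^* * l)%R 0%R; last exact: E.
by rewrite /g [(_ + 1)%R]addrC l0 absq0 invr0 expr0n /= !mul0e.
Qed.

End Moebius.

Section RootsOfUnity.
Context {R : realType}.
Local Notation C := R[i].

(** A root of order 2^m of -1 has multiplicative order exactly 2^(m + 1), which exceeds m. *)
Lemma root_unity_exists (m : nat) : exists n (e : C),
  [/\ (m < n)%N, absq e = 1, e ^+ n = 1 & forall d, (0 < d < n)%N -> e ^+ d != 1].
Proof.
pose e : C := (2 ^ m).-root (-1).
have em : e ^+ (2 ^ m) = -1 by rewrite rootCK// expn_gt0.
exists (2 ^ m.+1)%N, e; split.
- by rewrite (ltn_trans (ltn_expl m (ltnSn 1)))// ltn_exp2l.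
- have := congr1 absq em; rewrite absqX absqN absq1 => /eqP.
  by rewrite pexpr_eq1 ?absq_ge0 ?expn_gt0// => /eqP.
- by rewrite expnS mulnC exprM em sqrrN expr1n.
move=> d /andP[d0 dn]; apply/negP => /eqP ed.
(* Write d = 2^s q with q odd; s <= m since d < 2^(m + 1). Raising e^d = 1 to the power 2^(m - s)
   would give (-1)^q = 1. *)
have [s le_sm [q qodd dE]] : exists2 s, (s <= m)%N & exists2 q, odd q & d = (2 ^ s * q)%N.
  have [q q2 dE] := pfactor_coprime (isT : prime 2) d0.
  exists (logn 2 d); last by exists q; [rewrite -coprime2n|rewrite mulnC].
  rewrite -ltnS -(ltn_exp2l _ _ (ltnSn 1)) (leq_ltn_trans _ dn)//.
  by rewrite dvdn_leq// pfactor_dvdnn.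
have : e ^+ (2 ^ m * q) = 1.
  by rewrite -(subnK le_sm) expnD -mulnA -dE mulnC exprM ed expr1n.
rewrite exprM em -signr_odd qodd expr1 => /eqP.
by rewrite eq_sym -subr_eq0 opprK -mulr2n pnatr_eq0.
Qed.

(** Distinct exponents below n are distinct modulo n, so in each cross term the sum over j is a
    geometric sum of a nontrivial root of unity, hence 0. *)
Lemma parseval_roots n (e : C) k (A : 'I_k -> nat) (y : 'I_k -> C) :
  absq e = 1 -> e ^+ n = 1 -> (forall d, (0 < d < n)%N -> e ^+ d != 1) ->
  injective A -> (forall i, (A i < n)%N) ->
  \sum_(j < n) absq (\sum_i y i * (e ^+ j) ^+ A i) = n%:R * \sum_i absq (y i).
Proof.
move=> e1 en ed Ai An.
have ee : e * Num.conj e = 1 by rewrite mul_conj_absq e1.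
have e0 : e != 0 by rewrite -absq_eq0 e1 oner_eq0.
have ce : Num.conj e = e^-1 by apply: (mulfI e0); rewrite ee mulfV.
apply: (@complexI R); rewrite rmorphM rmorph_nat !rmorph_sum/=.
transitivity (\sum_(j < n) \sum_i \sum_i' (y i * Num.conj (y i') * (e ^+ A i / e ^+ A i') ^+ j)).
  apply: eq_bigr => j _; rewrite -mul_conj_absq -[X in _ * X]/(Num.conj _) rmorph_sum mulr_suml.
  apply: eq_bigr => i _; rewrite mulr_sumr; apply: eq_bigr => i' _.
  rewrite rmorphM !rmorphXn /= ce mulrACA; congr (_ * _).
  by rewrite exprMn !exprVn -!exprM [(j * _)%N]mulnC [(j * A i')%N]mulnC.
rewrite exchange_big mulr_sumr/=; apply: eq_bigr => i _.
rewrite exchange_big (bigD1 i)//= [X in _ + X]big1 ?addr0.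
  rewrite -mul_conj_absq mulfV ?expf_neq0// (eq_bigr (fun=> y i * Num.conj (y i))).
    by rewrite sumr_const card_ord mulr_natl.
  by move=> j _; rewrite expr1n mulr1.
move=> i' i'i; rewrite -mulr_sumr; set r := e ^+ A i / e ^+ A i'.
have rn : r ^+ n = 1 by rewrite exprMn exprVn -!exprM ![(_ * n)%N]mulnC !exprM en !expr1n invr1
  mulr1.
have r1 : r != 1.
  have Ai0 m : e ^+ m != 0 by rewrite expf_neq0.
  apply: contra i'i => /eqP rE.
  have {}rE : e ^+ A i = e ^+ A i' by rewrite -[LHS](divfK (Ai0 (A i'))) -/r rE mul1r.
  apply/eqP/Ai; apply/eqP; rewrite eqn_leq; apply/andP; split; rewrite leqNgt; apply/negP => lt.
    have := ed (A i' - A i)%N; rewrite subn_gt0 lt (leq_ltn_trans (leq_subr _ _) (An _)).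
    by move=> /(_ isT)/eqP; apply; apply: (mulIf (Ai0 (A i))); rewrite -exprD subnK ?mul1r// ltnW.
  have := ed (A i - A i')%N; rewrite subn_gt0 lt (leq_ltn_trans (leq_subr _ _) (An _)).
  by move=> /(_ isT)/eqP; apply; apply: (mulIf (Ai0 (A i'))); rewrite -exprD subnK ?mul1r// ltnW.
have : (r - 1) * (\sum_(j < n) r ^+ j) = 0 by rewrite -subrX1 rn subrr.
by move=> /eqP; rewrite mulf_eq0 subr_eq0 (negbTE r1)/= => /eqP ->; rewrite mulr0.
Qed.

Local Open Scope ereal_scope.

Lemma ge0_sum_const n (x : \bar R) : 0 <= x -> \sum_(j < n) x = n%:R%:E * x.
Proof.
move=> x0; elim: n => [|n ih]; first by rewrite big_ord0 mul0e.
by rewrite big_ord_recr ih/= -[in RHS]addn1 natrD EFinD ge0_muleDl ?lee_fin// mul1e.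
Qed.

Lemma Cint_rotate (f : C -> \bar R) (e : C) : absq e = 1%R -> Cmeas f ->
  (forall x, 0 <= f x) -> Cint (fun c => f (e * c)%R) = Cint f.
Proof.
move=> e1 mf f0; rewrite Cint_scale ?e1 ?invr1 ?mul1e//.
by rewrite -absq_eq0 e1 oner_eq0.
Qed.

Lemma Cmeas_ratio (h : R -> \bar R) (p q : C -> R) :
  measurable_fun setT h -> measurable_fun setT (fun c : (measurableTypeR R * measurableTypeR
    R)%type => p (toC c)) ->
  measurable_fun setT (fun c : (measurableTypeR R * measurableTypeR R)%type => q (toC c)) ->
  Cmeas (fun c => h (p c / q c)%R).
Proof.
move=> mh mp mq; apply: (measurableT_comp mh); apply: measurable_funM => //.
exact: measurable_fun_inv.
Qed.

(** The weight and h depend on |w| only, so the integral is unchanged by w |-> e^j w. Summing over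
    the n rotations before integrating removes the cross terms pointwise; only nonnegative functions
    are ever integrated. *)
Lemma Cint_orthogonal_monomials M k (A : 'I_k -> nat) (x : 'I_k -> C)
    (h : R -> \bar R) : injective A -> (forall i, (A i <= M)%N) ->
  measurable_fun setT h -> (forall t, 0 <= h t) ->
  Cint (fun w => (absq (\sum_i x i * w ^+ A i) * (1 + absq w)^-1 ^+ (M + 2))%:E *
                 h ((1 + absq w) / absq w)%R) =
  \sum_i (absq (x i))%:E *
    Cint (fun w => (absq w ^+ A i * (1 + absq w)^-1 ^+ (M + 2))%:E *
                 h ((1 + absq w) / absq w)%R).
Proof.
move=> Ai AM mh h0.
have [n [e [Mn e1 en ed]]] := root_unity_exists M.
have mabs : measurable_fun setT (fun c : (measurableTypeR R * measurableTypeR R)%type => absq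
  (toC c)).
  by apply: measurable_absq; exact: cmeas_toC.
have m1abs : measurable_fun setT (fun c : (measurableTypeR R * measurableTypeR R)%type => (1 +
  absq (toC c))%R).
  exact: measurable_funD.
have mpow (a : nat) : cmeas (fun c : (measurableTypeR R * measurableTypeR R)%type => toC c ^+
  a)%R.
  by apply: cmeasX; exact: cmeas_toC.
pose W (w : C) : R := ((1 + absq w)^-1 ^+ (M + 2))%R.
have W0 w : (0 <= W w)%R by rewrite exprn_ge0// invr_ge0 addr_ge0// absq_ge0.
have mW : measurable_fun setT (fun c : (measurableTypeR R * measurableTypeR R)%type => W (toC c)).
  exact: measurable_invX.
pose H (w : C) := h ((1 + absq w) / absq w)%R.
have mH : Cmeas H by exact: Cmeas_ratio.
pose f (w : C) := (absq (\sum_i x i * w ^+ A i)%R * W w)%:E * H w.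
have mf : Cmeas f.
  apply: emeasurable_funM => //; apply/measurable_EFinP; apply: measurable_funM => //.
  apply: measurable_absq; apply: cmeas_sum => i; apply: cmeasM => //.
  exact: cmeas_cst.
have f0 w : 0 <= f w.
  by apply: mule_ge0; [rewrite lee_fin mulr_ge0// absq_ge0|exact: h0].
have n0 : (0 < n)%N by exact: leq_ltn_trans Mn.
have nR0 : (n%:R != 0 :> R)%R by rewrite pnatr_eq0 -lt0n.
have mg i : Cmeas (fun w => (absq w ^+ A i * W w)%:E * H w).
  apply: emeasurable_funM => //; apply/measurable_EFinP; apply: measurable_funM => //.
  exact: measurable_funX.
have g0 i w : 0 <= (absq w ^+ A i * W w)%:E * H w.
  by apply: mule_ge0; [rewrite lee_fin mulr_ge0// exprn_ge0// absq_ge0|exact: h0].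
have nE : n%:R%:E * Cint f =
    n%:R%:E * \sum_i (absq (x i))%:E * Cint (fun w => (absq w ^+ A i * W w)%:E * H w).
  transitivity (\sum_(j < n) Cint (fun w => f (e ^+ j * w)%R)).
    rewrite (eq_bigr (fun=> Cint f)); last first.
      by move=> j _; rewrite Cint_rotate// absqX e1 expr1n.
    by rewrite ge0_sum_const// Cint_ge0.
  rewrite /Cint -ge0_integral_sum//; last first.
    move=> j; apply: (Cmeas_comp (f := f)) => //.
    by apply: cmeasM; [exact: cmeas_cst|exact: cmeas_toC].
  transitivity (\int[@lebesgue_complex R]_c (n%:R%:E * \sum_i (absq (x i))%:E *
      ((absq (toC c) ^+ A i * W (toC c))%:E * H (toC c)))).
    apply: eq_integral => c _; set w := toC c.
    have E j : f (e ^+ j * w)%R =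
        (absq (\sum_i x i * w ^+ A i * (e ^+ j) ^+ A i)%R)%:E * ((W w)%:E * H w).
      rewrite muleA -EFinM /f /W /H absqM absqX e1 expr1n mul1r.
      congr ((absq _ * _)%:E * _); apply: eq_bigr => i _.
      by rewrite exprMn mulrAC mulrA.
    under eq_bigr do rewrite E.
    rewrite -ge0_sume_distrl; last by move=> j _; rewrite lee_fin absq_ge0.
    rewrite sumEFin (parseval_roots _ e1 en ed Ai); last first.
      by move=> i; rewrite (leq_ltn_trans (AM i)).
    rewrite EFinM -sumEFin -muleA; congr (_ * _).
    rewrite ge0_sume_distrl; last by move=> j _; rewrite lee_fin absq_ge0.
    apply: eq_bigr => i _; rewrite absqM absqX EFinM -muleA; congr (_ * _).
    by rewrite muleA -EFinM.
  rewrite ge0_integralTZl//; last 2 first.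
  - by apply: emeasurable_sum => i; apply: emeasurable_funM => //; exact: mg.
  - by move=> c; apply: sume_ge0 => i _; rewrite mule_ge0// lee_fin absq_ge0.
  rewrite ge0_integral_sum//; last 2 first.
  - by move=> i; apply: emeasurable_funM => //; exact: mg.
  - by move=> i c _; rewrite mule_ge0// lee_fin absq_ge0.
  congr (_ * _); apply: eq_bigr => i _; rewrite ge0_integralTZl//.
  + exact: mg.
  + by rewrite lee_fin absq_ge0.
have := congr1 (mule (n%:R^-1)%:E) nE.
by rewrite !muleA -EFinM mulVf// !mul1e.
Qed.

End RootsOfUnity.

Section SphericalOrthogonality.
Context {R : realType}.
Local Notation C := R[i].
Local Open Scope ereal_scope.

Definition rot_monomial (z : C) (M a : nat) (l : C) : C :=
  ((l - z) ^+ a * (1 + z^* * l) ^+ (M - a))%R.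

(** The substitution w = [moebius z l] turns the rotated monomials into ordinary ones and the
    argument of h into (1 + |w|^2) / |w|^2. In the exponent M + 2, M accounts for the common factor
    |1 + conj(z) l|^(2 M) of the monomials and 2 for the area element. *)
Lemma spherical_orthogonality (z : C) M k (A : 'I_k -> nat) (x : 'I_k -> C)
    (h : R -> \bar R) : injective A -> (forall i, (A i <= M)%N) ->
  measurable_fun setT h -> (forall t, 0 <= h t) ->
  Cint (fun l => (absq (\sum_i x i * rot_monomial z M (A i) l) *
                  (1 + absq l)^-1 ^+ (M + 2))%:E *
                 h ((1 + absq z) * (1 + absq l) / absq (l - z))%R) =
  ((1 + absq z) ^+ M)%:E * \sum_i (absq (x i))%:E *
    Cint (fun w => (absq w ^+ A i * (1 + absq w)^-1 ^+ (M + 2))%:E *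
                 h ((1 + absq w) / absq w)%R).
Proof.
move=> Ai AM mh h0; rewrite -Cint_orthogonal_monomials//.
pose f (w : C) := (absq (\sum_i x i * w ^+ A i)%R * (1 + absq w)^-1 ^+ (M + 2))%:E *
  h ((1 + absq w) / absq w)%R.
transitivity (((1 + absq z) ^+ M)%:E * Cint f); last by [].
pose CR := (measurableTypeR R * measurableTypeR R)%type.
have mabs : measurable_fun setT (fun c : CR => absq (toC c)).
  by apply: measurable_absq; exact: cmeas_toC.
have m1abs : measurable_fun setT (fun c : CR => (1 + absq (toC c))%R).
  exact: measurable_funD.
have mH : Cmeas (fun w : C => h ((1 + absq w) / absq w)%R) by exact: Cmeas_ratio.
have mf : Cmeas f.
  apply: emeasurable_funM; last exact: mH.
  apply/measurable_EFinP; apply: measurable_funM; last exact: measurable_invX.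
  apply: measurable_absq; apply: cmeas_sum => i; apply: cmeasM.
    exact: cmeas_cst.
  by apply: cmeasX; exact: cmeas_toC.
have f0 w : 0 <= f w.
  rewrite /f mule_ge0// lee_fin mulr_ge0 ?absq_ge0// exprn_ge0// invr_ge0 addr_ge0// absq_ge0 //.
have ml : cmeas (fun c : CR => (toC c - z)%R).
  by apply: cmeasB; [exact: cmeas_toC|exact: cmeas_cst].
have md : cmeas (fun c : CR => (1 + z^* * toC c)%R).
  apply: cmeasD; first exact: cmeas_cst.
  by apply: cmeasM; [exact: cmeas_cst|exact: cmeas_toC].
have mm : cmeas (fun c : CR => moebius z (toC c)).
  by apply: cmeasM => //; exact: cmeasV.
set s : R := (1 + absq z)%R.
have s0 : (0 < s)%R by rewrite ltr_wpDr ?absq_ge0.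
pose g (l : C) := ((absq (1 + z^* * l)%R)^-1 ^+ 2)%:E * f (moebius z l).
have g0 l : 0 <= g l by rewrite mule_ge0// lee_fin exprn_ge0// invr_ge0 absq_ge0.
have mg : Cmeas g.
  apply: emeasurable_funM; last exact: Cmeas_comp.
  by apply/measurable_EFinP; apply: measurable_invX; exact: measurable_absq.
have -> : (s ^+ M)%:E * Cint f = Cint (fun l => (s ^+ (M + 2))%:E * g l).
  rewrite CintZl// ?lee_fin ?exprn_ge0 ?(ltW s0)// Cint_moebius// muleA -EFinM.
  by rewrite exprD -mulrA exprVn mulfV ?mulr1// expf_neq0// gt_eqF.
(* The pole of the rotation. For z = 0 there is none; the default inverse then gives p = 0, whose
   exclusion is harmless. *)
pose p : C := (- (z^*)^-1)%R.
apply: (Cint_eq_neq (p := p)).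
- apply: emeasurable_funM.
    apply/measurable_EFinP; apply: measurable_funM; last exact: measurable_invX.
    apply: measurable_absq; apply: cmeas_sum => i; apply: cmeasM.
      exact: cmeas_cst.
    by apply: cmeasM; exact: cmeasX.
  apply: (@Cmeas_ratio _ h (fun l => s * (1 + absq l))%R (fun l => absq (l - z))%R) => //.
    exact: measurable_funM.
  exact: measurable_absq.
- exact: emeasurable_funM.
- move=> l; rewrite mule_ge0// lee_fin mulr_ge0 ?absq_ge0// exprn_ge0// invr_ge0 addr_ge0//
  absq_ge0 //.
- by move=> l; rewrite mule_ge0// lee_fin exprn_ge0// ltW.
move=> l lp; rewrite /g.
have d0 : (1 + z^* * l != 0)%R.
  have [z0|z0] := eqVneq z 0%R; first by rewrite z0 rmorph0 mul0r addr0 oner_eq0.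
  have c0 : (z^* != 0)%R by rewrite conjc_eq0.
  apply: contra lp => /eqP e; apply/eqP; apply: (mulfI c0).
  by rewrite /p mulrN mulfV//; apply/eqP; rewrite -addr_eq0 addrC e.
have a0 : (0 < absq (1 + z^* * l))%R by rewrite absq_gt0.
have w1 : (1 + absq (moebius z l) = s * (1 + absq l) / absq (1 + z^* * l))%R.
  have D := absq_moebius_den z l; rewrite -/s in D.
  by rewrite /moebius absqM absqV -D; field; rewrite gt_eqF.
rewrite /f w1 muleA [RHS]muleA -!EFinM; congr (_%:E * h _).
  have -> : (\sum_i x i * rot_monomial z M (A i) l =
      (1 + z^* * l) ^+ M * \sum_i x i * moebius z l ^+ A i)%R.
    rewrite mulr_sumr; apply: eq_bigr => i _; rewrite [RHS]mulrCA; congr (_ * _)%R.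
    rewrite /rot_monomial /moebius exprMn [RHS]mulrCA; congr (_ * _)%R.
    rewrite -{2}(subnK (AM i)) exprD -mulrA exprVn mulfV ?mulr1// expf_neq0//.
  rewrite absqM absqX !exprD !invfM !invrK !exprMn !exprVn.
  have l1 : (1 + absq l != 0)%R by rewrite gt_eqF// ltr_wpDr ?absq_ge0.
  have sn : (s != 0)%R by rewrite gt_eqF.
  have an : (absq (1 + z^* * l) != 0)%R by rewrite gt_eqF.
  field.
  by rewrite an sn l1 !expf_neq0.
(* At l = z both arguments of h are quotients by 0, hence both are 0. *)
have [lz|lz] := eqVneq l z.
  by rewrite /moebius lz subrr absq0 mul0r absq0 !invr0 !mulr0.
rewrite /moebius absqM absqV; field.
by rewrite !absq_eq0 subr_eq0 lz d0.
Qed.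

End SphericalOrthogonality.

(** * Commuting operators acting on the law of the squared norm *)

Section Operators.
Context {R : realType}.
Local Notation C := R[i].
Local Notation CR := (measurableTypeR R * measurableTypeR R)%type.
Local Open Scope ereal_scope.
Implicit Types (F G : R -> \bar R) (a b : nat).

Lemma measurable_absq_toC : measurable_fun setT (fun c : CR => absq (toC c)).
Proof. by apply: measurable_absq; exact: cmeas_toC. Qed.

Lemma onem_absq_gt0 (v : C) : (0 < 1 + absq v)%R.
Proof. by rewrite ltr_wpDr ?absq_ge0. Qed.

Lemma invX_absq_ge0 (v : C) n : 0 <= ((1 + absq v)^-1 ^+ n)%:E.
Proof. by rewrite lee_fin exprn_ge0// invr_ge0 ltW// onem_absq_gt0. Qed.

Lemma measurable_invX_absq n :
  measurable_fun setT (fun c : CR => ((1 + absq (toC c))^-1 ^+ n)%:E).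
Proof.
apply/measurable_EFinP; apply: measurable_invX; apply: measurable_funD => //.
exact: measurable_absq_toC.
Qed.

Lemma measurable_Cint d (T : measurableType d) (f : T -> C -> \bar R) :
  measurable_fun setT (fun p : T * CR => f p.1 (toC p.2)) ->
  (forall x y, 0 <= f x y) -> measurable_fun setT (fun x => Cint (f x)).
Proof.
move=> mf f0.
exact: (measurable_integral2 (@lebesgue_complex R) (f := fun x c => f x (toC c))).
Qed.

Lemma Cint_swap (f : C -> C -> \bar R) :
  measurable_fun setT (fun p : CR * CR => f (toC p.1) (toC p.2)) ->
  (forall x y, 0 <= f x y) ->
  Cint (fun w => Cint (fun v => f w v)) = Cint (fun v => Cint (fun w => f w v)).
Proof.
move=> mf f0.
exact: (integral_swap (@lebesgue_complex R) (@lebesgue_complex R)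
  (f := fun w v => f (toC w) (toC v))).
Qed.

(* Up to normalisation, [beta_op a F x] is the expectation of F (x / B) for B of
   law Beta(a + 2, 1). *)
Definition beta_op a F (x : R) : \bar R :=
  Cint (fun y => F (x * (1 + absq y))%R * ((1 + absq y)^-1 ^+ (a + 3))%:E).

Lemma beta_op_ge0 a F : (forall x, 0 <= F x) -> forall x, 0 <= beta_op a F x.
Proof. by move=> F0 x; apply: Cint_ge0 => y; rewrite mule_ge0// invX_absq_ge0. Qed.

Lemma measurable_beta_op a F : measurable_fun setT F -> (forall x, 0 <= F x) ->
  measurable_fun setT (beta_op a F).
Proof.
move=> mF F0; apply: measurable_Cint => [|x y].
  apply: emeasurable_funM; last exact: (measurable_comp_snd (measurable_invX_absq _)).
  apply: (measurableT_comp mF); apply: measurable_funM; first exact: measurable_fst.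
  apply: measurable_funD => //.
  exact: (measurable_comp_snd measurable_absq_toC).
by rewrite mule_ge0// invX_absq_ge0.
Qed.

(** In either order x is multiplied by the product of the two factors, and Tonelli exchanges the
    integrals. *)
Lemma beta_op_comm a b F : measurable_fun setT F -> (forall x, 0 <= F x) ->
  beta_op a (beta_op b F) = beta_op b (beta_op a F).
Proof.
move=> mF F0; apply/funext => x.
pose f a b (v w : C) := F (x * (1 + absq v) * (1 + absq w))%R *
  ((1 + absq w)^-1 ^+ (b + 3))%:E * ((1 + absq v)^-1 ^+ (a + 3))%:E.
have mFx : measurable_fun setT (fun p : CR * CR =>
    F (x * (1 + absq (toC p.1)) * (1 + absq (toC p.2)))%R).
  apply: (measurableT_comp mF); apply: measurable_funM.
    apply: measurable_funM => //; apply: measurable_funD => //.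
    exact: (measurable_comp_fst measurable_absq_toC).
  apply: measurable_funD => //.
  exact: (measurable_comp_snd measurable_absq_toC).
have fE a' b' : beta_op a' (beta_op b' F) x = Cint (fun v => Cint (fun w => f a' b' v w)).
  apply: eq_Cint => v; rewrite muleC -CintZl.
  - by apply: eq_Cint => w; rewrite muleC.
  - apply: emeasurable_funM; last exact: measurable_invX_absq.
    exact: (measurableT_comp mFx (measurable_pair1 (ofC v))).
  - by move=> w; rewrite mule_ge0// invX_absq_ge0.
  - exact: invX_absq_ge0.
rewrite !fE Cint_swap; last 2 first.
- apply: emeasurable_funM; last exact: (measurable_comp_fst (measurable_invX_absq _)).
  apply: emeasurable_funM => //.
  exact: (measurable_comp_snd (measurable_invX_absq _)).
- by move=> v w; rewrite !mule_ge0// invX_absq_ge0.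
apply: eq_Cint => v; apply: eq_Cint => w; rewrite /f -!muleA; congr (F _ * _).
  by rewrite mulrAC.
by rewrite muleC.
Qed.

Definition beta_ops (l : seq nat) F := foldr beta_op F l.

Lemma beta_ops_meas l F : measurable_fun setT F -> (forall x, 0 <= F x) ->
  measurable_fun setT (beta_ops l F) /\ forall x, 0 <= beta_ops l F x.
Proof.
move=> mF F0; elim: l => //= a l [ml l0].
by split; [exact: measurable_beta_op|exact: beta_op_ge0].
Qed.

Lemma beta_ops_op l a F : measurable_fun setT F -> (forall x, 0 <= F x) ->
  beta_ops l (beta_op a F) = beta_op a (beta_ops l F).
Proof.
move=> mF F0; elim: l => //= b l ->.
by have [ml l0] := beta_ops_meas l mF F0; rewrite beta_op_comm.
Qed.

Lemma beta_ops_cat l l' F : beta_ops (l ++ l') F = beta_ops l (beta_ops l' F).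
Proof. exact: foldr_cat. Qed.

Lemma beta_ops_comm l l' F : measurable_fun setT F -> (forall x, 0 <= F x) ->
  beta_ops l (beta_ops l' F) = beta_ops l' (beta_ops l F).
Proof.
move=> mF F0; elim: l => //= a l ->.
by have [ml l0] := beta_ops_meas l mF F0; rewrite beta_ops_op.
Qed.

(** The composite depends only on the multiset of exponents; this is what merges the terms of the
    cofactor expansion. *)
Lemma beta_ops_perm l l' F : measurable_fun setT F -> (forall x, 0 <= F x) ->
  perm_eq l l' -> beta_ops l F = beta_ops l' F.
Proof.
move=> mF F0 pl.
pose P s := beta_ops l F = beta_ops s F.
apply: (@catCA_perm_ind _ P _ l l' pl) => // s1 s2 s3; rewrite /P => ->.
rewrite !beta_ops_cat.
by have [m3 s30] := beta_ops_meas s3 mF F0; exact: beta_ops_comm.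
Qed.

Definition eigen_mass (n a : nat) : \bar R :=
  Cint (fun w => (absq w ^+ a.+2 * (1 + absq w)^-1 ^+ n)%:E).

Lemma eigen_mass_ge0 n a : 0 <= eigen_mass n a.
Proof.
apply: Cint_ge0 => w; rewrite lee_fin mulr_ge0 ?exprn_ge0 ?absq_ge0//.
by rewrite invr_ge0 ltW ?onem_absq_gt0.
Qed.

(** The integrated effect on F of adding a column whose eigenvalue l has kappa(l) = k: the norm S
    becomes S (1 + k |v|^2). The factor 1 / k is the part of the repulsion |z - l|^2 that depends on
    k. *)
Definition overlap_kernel (n : nat) F (S k : R) : \bar R :=
  (k^-1)%:E * Cint (fun v => F (S * (1 + k * absq v))%R *
                          ((1 + absq v)^-1 ^+ (n + 2))%:E).

Lemma measurable_overlap_kernel n F (S : R) : measurable_fun setT F ->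
  (forall x, 0 <= F x) -> measurable_fun setT (overlap_kernel n F S).
Proof.
move=> mF F0; apply: emeasurable_funM.
  by apply/measurable_EFinP; exact: measurable_fun_inv.
apply: measurable_Cint => [|x y]; last by rewrite mule_ge0// invX_absq_ge0.
apply: emeasurable_funM; last exact: (measurable_comp_snd (measurable_invX_absq _)).
apply: (measurableT_comp mF); apply: measurable_funM => //.
apply: measurable_funD => //; apply: measurable_funM; first exact: measurable_fst.
exact: (measurable_comp_snd measurable_absq_toC).
Qed.

(** Let r = |w|^2 and k = (1 + r) / r. Dilating v so that k |v|^2 becomes |v|^2 turns 1 + |v|^2 into
    (1 + (1 + |v|^2) r) / (1 + r); the powers of 1 + r cancel and F no longer involves w. Dividing w
    by the square root of 1 + |v|^2 then separates the variables and leaves (1 + |v|^2)^-(a + 3). *)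
Lemma Cint_overlap_kernel n a F S : measurable_fun setT F -> (forall x, 0 <= F x) ->
  (a < n)%N ->
  Cint (fun w => (absq w ^+ a * (1 + absq w)^-1 ^+ n)%:E *
                 overlap_kernel n F S ((1 + absq w) / absq w)%R) =
  eigen_mass (n + 2) a * beta_op a F S.
Proof.
move=> mF F0 an.
pose f (w v : C) := (absq w ^+ a.+2 * (1 + (1 + absq v) * absq w)^-1 ^+ (n + 2))%:E *
   F (S * (1 + absq v))%R.
have p0 (w v : C) : (0 < 1 + (1 + absq v) * absq w)%R.
  by rewrite ltr_wpDr// mulr_ge0 ?absq_ge0// ltW// onem_absq_gt0.
have f0 w v : 0 <= f w v.
  rewrite mule_ge0// lee_fin mulr_ge0 ?exprn_ge0 ?absq_ge0//.
  by rewrite invr_ge0 ltW ?p0.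
have mFS : Cmeas (fun v : C => F (S * (1 + absq v))%R).
  apply: (measurableT_comp mF); apply: measurable_funM => //.
  by apply: measurable_funD => //; exact: measurable_absq_toC.
have mf : measurable_fun setT (fun p : CR * CR => f (toC p.1) (toC p.2)).
  have m1 : measurable_fun setT (fun p : CR * CR => absq (toC p.1)).
    exact: (measurable_comp_fst measurable_absq_toC).
  have m2 : measurable_fun setT (fun p : CR * CR => absq (toC p.2)).
    exact: (measurable_comp_snd measurable_absq_toC).
  apply: emeasurable_funM; last exact: (measurable_comp_snd mFS).
  apply/measurable_EFinP; apply: measurable_funM; first exact: measurable_funX.
  apply: measurable_invX; apply: measurable_funD => //.
  by apply: measurable_funM => //; exact: measurable_funD.
transitivity (Cint (fun w => Cint (fun v => f w v))).
  apply: eq_Cint => w; rewrite /overlap_kernel.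
  (* At w = 0 the quotient k is 0 by default, hence so is 1 / k, and [f w v] vanishes as well. *)
  have [w0|w0] := eqVneq (absq w) 0%R.
    rewrite w0 invr0 mulr0 invr0 mul0e mule0 /Cint integral0_eq// => v _.
    by rewrite /f w0 expr0n/= mul0r mul0e.
  have r0 : (0 < absq w)%R by rewrite lt_neqAle eq_sym w0 absq_ge0.
  set r := absq w in w0 r0 *.
  have q0 : (0 < r / (1 + r))%R by rewrite divr_gt0// /r onem_absq_gt0.
  pose k : R := ((1 + r) / r)%R.
  have rr0 : (0 <= 1 + r)%R by rewrite ltW// /r onem_absq_gt0.
  have r1 : (1 + r != 0)%R by rewrite gt_eqF// /r onem_absq_gt0.
  pose G (t : R) := F (S * (1 + k * t))%R * ((1 + `|t|)^-1 ^+ (n + 2))%:E.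
  have mG : measurable_fun setT G.
    apply: emeasurable_funM.
      apply: (measurableT_comp mF); apply: measurable_funM => //.
      by apply: measurable_funD => //; exact: measurable_funM.
    by apply/measurable_EFinP; apply: measurable_invX; exact: measurable_funD.
  have G0 t : 0 <= G t by rewrite mule_ge0// lee_fin exprn_ge0// invr_ge0 addr_ge0.
  have -> : Cint (fun v => F (S * (1 + k * absq v))%R *
      ((1 + absq v)^-1 ^+ (n + 2))%:E) = Cint (fun v => G (absq v)).
    by apply: eq_Cint => v; rewrite /G ger0_norm// absq_ge0.
  rewrite (Cint_absq_scale q0)// !muleA -!EFinM.
  rewrite -CintZl; last 3 first.
  - apply: (measurableT_comp mG); apply: measurable_funM => //.
    exact: measurable_absq_toC.
  - by move=> v; exact: G0.
  - by rewrite lee_fin !mulr_ge0 ?exprn_ge0 ?invr_ge0 ?(ltW r0)// ?mulr_ge0 ?invr_ge0 ?(ltW r0).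
  apply: eq_Cint => v; rewrite /f /G -/r muleCA muleC; congr (_ * F _).
    rewrite -EFinM; congr EFin.
    rewrite ger0_norm; last by rewrite mulr_ge0 ?(ltW q0) ?absq_ge0.
    have e1 : (1 + r / (1 + r) * absq v = (1 + (1 + absq v) * r) / (1 + r))%R by field.
    have v1 : (1 + (1 + absq v) * r != 0)%R by rewrite gt_eqF// /r p0.
    rewrite e1 !invf_div -[a.+2]addn2 !exprMn !exprVn !exprD.
    have r1n := expf_neq0 n r1; have v1n := expf_neq0 n v1.
    by field; rewrite ?w0 ?r1 ?v1 ?r1n ?v1n.
  by rewrite mulrA; congr (_ * _)%R; rewrite /k; field; rewrite w0 r1.
rewrite Cint_swap// /beta_op -CintZl; last 3 first.
- by apply: emeasurable_funM => //; exact: measurable_invX_absq.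
- by move=> v; rewrite mule_ge0// invX_absq_ge0.
- exact: eigen_mass_ge0.
apply: eq_Cint => v; set x : R := (1 + absq v)%R.
have x0 : (0 < x)%R by exact: onem_absq_gt0.
pose g (t : R) := (`|t| ^+ a.+2 * (1 + x * `|t|)^-1 ^+ (n + 2))%:E.
have mg : measurable_fun setT g.
  have mn : measurable_fun setT (fun t : R => `|t|%R) by exact: measurableT_comp.
  apply/measurable_EFinP; apply: measurable_funM; first exact: measurable_funX.
  by apply: measurable_invX; apply: measurable_funD => //; exact: measurable_funM.
have g0 t : 0 <= g t.
  by rewrite lee_fin mulr_ge0 ?exprn_ge0// invr_ge0 addr_ge0// mulr_ge0// ltW.
transitivity (F (S * x)%R * Cint (fun w => g (absq w))).
  rewrite -CintZl//; last exact: Cmeas_absq.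
  by apply: eq_Cint => w; rewrite /g ger0_norm ?absq_ge0// muleC.
rewrite muleCA; congr (_ * _).
have xV0 : (0 < x^-1)%R by rewrite invr_gt0.
rewrite (Cint_absq_scale xV0)// addn3 exprS EFinM muleCA; congr (_ * _).
rewrite /eigen_mass muleC -CintZl; last 3 first.
- apply/measurable_EFinP; apply: measurable_funM.
    by apply: measurable_funX; exact: measurable_absq_toC.
  by apply: measurable_invX; apply: measurable_funD => //; exact: measurable_absq_toC.
- move=> w; rewrite lee_fin mulr_ge0 ?exprn_ge0 ?absq_ge0// invr_ge0 ltW//.
  exact: onem_absq_gt0.
- by rewrite lee_fin exprn_ge0// ltW.
apply: eq_Cint => w; rewrite /g -EFinM ger0_norm ?mulr_ge0 ?absq_ge0 ?(ltW xV0)//.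
rewrite (mulrA x) mulfV ?gt_eqF// mul1r.
by rewrite exprMn -mulrA.
Qed.

End Operators.

(** * Schur coordinates *)

Section SchurCoordinates.
Context {R : realType}.
Local Notation C := R[i].
Local Notation CR := (measurableTypeR R * measurableTypeR R)%type.
Local Open Scope sesquilinear_scope.
Variable z : C.
Implicit Types s u v : seq CR.

(* The number of free coordinates of a matrix of size m + 1. *)
Definition ncoord (m : nat) : nat := 'C(m.+2, 2).-1.

Lemma ncoordS m : ncoord m.+1 = (ncoord m + m.+2)%N.
Proof.
rewrite /ncoord [in LHS]binS bin1.
have : (0 < 'C(m.+2, 2))%N by rewrite bin_gt0.
by case: 'C(m.+2, 2).
Qed.

Definition entry s i j : C := (z :: [seq toC c | c <- s])`_('C(j.+1, 2) + i).

Definition eigen s j : C := entry s j j.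

Definition triang s k : 'M[C]_k :=
  \matrix_(i, j) if (i <= j)%N then entry s i j else 0.

(* Entries of the left eigenvector for z with first entry 1 of the leading block
   of size k, provided that z is not an eigenvalue of the rest of the block. *)
Fixpoint leftvec s k : seq C :=
  if k is k'.+1 then
    rcons (leftvec s k') (if k' == 0 then 1 else
      (\sum_(i < k') (leftvec s k')`_i * entry s i k') / (z - eigen s k'))
  else [::].

Definition leftrow s k : 'rV[C]_k := \row_i (leftvec s k)`_i.

Definition sqnorm s k : R := \sum_(x <- leftvec s k) absq x.

Definition gramdet s k : R := complex.Re (\det (1%:M + triang s k *m (triang s k)^t*)).

Lemma size_leftvec s k : size (leftvec s k) = k.
Proof. by elim: k => //= k ih; rewrite size_rcons ih. Qed.

Lemma leftvec_prefix s k i : (i < k)%N -> (leftvec s k.+1)`_i = (leftvec s k)`_i.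
Proof. by move=> ik; rewrite /= nth_rcons size_leftvec ik. Qed.

Lemma leftvec_nth s k i : (i < k)%N -> (leftvec s k)`_i = (leftvec s i.+1)`_i.
Proof.
elim: k => // k ih; rewrite ltnS leq_eqVlt => /predU1P[->//|ik].
by rewrite leftvec_prefix// ih.
Qed.

Lemma leftvec_last s i : (leftvec s i.+1)`_i = if i == 0%N then 1 else
  (\sum_(j < i) (leftvec s i)`_j * entry s j i) / (z - eigen s i).
Proof. by rewrite /= nth_rcons size_leftvec ltnn eqxx. Qed.

Lemma Re_mul_real (r : R) (x : C) : complex.Re (r%:C * x) = r * complex.Re x.
Proof. by case: x => a b /=; rewrite mul0r subr0. Qed.

Lemma entry00 s : entry s 0 0 = z. Proof. by []. Qed.

(** T is upper triangular, so column j of the eigenvector equation involves entries up to j only and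
    gives entry j from the previous ones after division by z - l_j. This is the recursion of
    [leftvec]. *)
Lemma leftrow_eigen s k : (forall j, (0 < j < k)%N -> eigen s j != z) ->
  leftrow s k *m triang s k = z *: leftrow s k.
Proof.
move=> ez; apply/rowP => j; rewrite !mxE.
transitivity (\sum_(i < j.+1) (leftvec s k)`_i * entry s i j).
  rewrite (big_ord_widen k (fun i => (leftvec s k)`_i * entry s i j)) ?ltn_ord//.
  rewrite [RHS]big_mkcond; apply: eq_bigr => i _.
  by rewrite !mxE ltnS; case: ifP; rewrite ?mulr0.
rewrite big_ord_recr/= (leftvec_nth _ (ltn_ord j)) leftvec_last.
have [j0|j_gt0] := posnP j.
  by rewrite j0 big_ord0 add0r mul1r mulr1 entry00.
have jk := ltn_ord j.
have jz : z - eigen s j != 0 by rewrite subr_eq0 eq_sym ez// j_gt0.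
rewrite (eq_bigr (fun i : 'I_j => (leftvec s j)`_i * entry s i j)).
  by rewrite -/(eigen s j); field.
move=> i _; congr (_ * _).
by rewrite (leftvec_nth _ (ltn_trans (ltn_ord i) jk)) [in RHS](leftvec_nth _ (ltn_ord i)).
Qed.

Lemma leftrow0 s k (i0 : 'I_k) : i0 = 0%N :> nat -> leftrow s k 0 i0 = 1.
Proof. by move=> i00; rewrite mxE (leftvec_nth _ (ltn_ord i0)) i00. Qed.

Lemma sqnorm_row s k : (leftrow s k *m (leftrow s k)^t*) 0 0 = (sqnorm s k)%:C.
Proof.
rewrite row_sqnorm /sqnorm (big_nth 0) size_leftvec big_mkord; congr (_%:C).
by apply: eq_bigr => i _; rewrite mxE.
Qed.

Lemma sqnorm_ge0 s k : 0 <= sqnorm s k.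
Proof. by apply: sumr_ge0 => x _; exact: absq_ge0. Qed.

Section Step.
Variables (m : nat) (s : seq CR).
Hypothesis sm : size s = ncoord m.

Let size_zs : size (z :: [seq toC c | c <- s]) = 'C(m.+2, 2).
Proof.
rewrite /= size_map sm /ncoord prednK// bin_gt0//.
Qed.

Lemma entry_cat u i j : (i <= j)%N -> (j <= m)%N -> entry (s ++ u) i j = entry s i j.
Proof.
move=> ij jm; rewrite /entry map_cat -cat_cons nth_cat size_zs ifT//.
rewrite (@leq_trans 'C(j.+2, 2))//; last exact: leq_bin2l.
by rewrite [X in (_ < X)%N]binS bin1 ltn_add2l ltnS.
Qed.

Lemma entry_new u i : entry (s ++ u) i m.+1 = [seq toC c | c <- u]`_i.
Proof.
by rewrite /entry map_cat -cat_cons nth_cat size_zs ltnNge leq_addr/= addKn.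
Qed.

Lemma leftvec_cat u k : (k <= m.+1)%N -> leftvec (s ++ u) k = leftvec s k.
Proof.
elim: k => //= k ih km; rewrite ih ?(ltnW km)//; congr rcons.
case: eqP => // _; rewrite /eigen entry_cat//; congr (_ / _).
by apply: eq_bigr => i _; rewrite entry_cat// ltnW.
Qed.

(** Coordinates are stored column by column, so enlarging the matrix appends [rcons v c]: v is the
    new column above the diagonal and c the new eigenvalue. *)
Variables (v : seq CR) (c : CR).
Hypothesis vm : size v = m.+1.

Lemma entry_col (i : 'I_m.+1) : entry (s ++ rcons v c) i m.+1 = colv m.+1 v i 0.
Proof.
rewrite entry_new mxE map_rcons nth_rcons size_map vm ltn_ord.
by rewrite (nth_map point) ?vm.
Qed.

Lemma eigen_new : eigen (s ++ rcons v c) m.+1 = toC c.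
Proof. by rewrite /eigen entry_new map_rcons nth_rcons size_map vm ltnn eqxx. Qed.

Lemma eigen_cat u j : (j <= m)%N -> eigen (s ++ u) j = eigen s j.
Proof. by move=> jm; rewrite /eigen entry_cat. Qed.

Lemma leftvec_step : leftvec (s ++ rcons v c) m.+2 =
  rcons (leftvec s m.+1) ((leftrow s m.+1 *m colv m.+1 v) 0 0 / (z - toC c)).
Proof.
have -> : leftvec (s ++ rcons v c) m.+2 = rcons (leftvec (s ++ rcons v c) m.+1)
    ((\sum_(i < m.+1) (leftvec (s ++ rcons v c) m.+1)`_i *
      entry (s ++ rcons v c) i m.+1) / (z - eigen (s ++ rcons v c) m.+1)) by [].
rewrite leftvec_cat// eigen_new mxE; congr (rcons _ (_ / _)).
by apply: eq_bigr => i _; rewrite entry_col [leftrow _ _ _ _]mxE.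
Qed.

Lemma sqnorm_step : sqnorm (s ++ rcons v c) m.+2 =
  sqnorm s m.+1 + absq ((leftrow s m.+1 *m colv m.+1 v) 0 0) / absq (z - toC c).
Proof. by rewrite /sqnorm leftvec_step -cats1 big_cat big_seq1/= absqM absqV. Qed.

Lemma triang_step : triang (s ++ rcons v c) (m.+1 + 1) =
  block_mx (triang s m.+1) (colv m.+1 v) 0 (toC c)%:M.
Proof.
apply/matrixP => i j; rewrite !mxE.
case: splitP => i' ei; rewrite mxE; case: splitP => j' ej; rewrite ?mxE ei ej.
- by case: ifP => // ij; rewrite entry_cat// -ltnS.
- by rewrite (ord1 j')/= addn0 ltnW// entry_col mxE.
- by rewrite leqNgt (leq_trans (ltn_ord j')) ?leq_addr.
- by rewrite (ord1 i') (ord1 j')/= addn0 leqnn -/(eigen _ _) eigen_new.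
Qed.

Lemma gramdet_step : gramdet (s ++ rcons v c) m.+2 = gramdet s m.+1 *
  ((1 + absq (toC c)) +
   qform (1%:M + triang s m.+1 *m (triang s m.+1)^t*) (colv m.+1 v)).
Proof.
rewrite /gramdet -[m.+2]addn1 triang_step det_gram_block.
have [E _] := posC_real (posdef_det_gt0 (posdef_gram (triang s m.+1))).
rewrite {1}E Re_mul_real; congr (_ * _).
by rewrite [X in complex.Re X]addrC ReDreal [RHS]addrC.
Qed.

End Step.

Lemma gramdet_gt0 s k : 0 < gramdet s k.
Proof. by have [] := posC_real (posdef_det_gt0 (posdef_gram (triang s k))). Qed.

Section Measurability.
Variable n : nat.

Lemma cmeas_entry i j : cmeas (fun t : n.-tuple CR => entry t i j).
Proof.
rewrite /entry; case: (_ + _)%N => [|k] /=; first exact: cmeas_cst.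
have [kn|nk] := ltnP k n.
  apply: (cmeas_eq (g := fun t : n.-tuple CR => toC (nth point t k))) => [t|].
    by rewrite (nth_map point)// size_tuple.
  by apply: cmeas_comp; [exact: cmeas_toC|exact: Tmeas_nth].
apply: (cmeas_eq (g := fun=> 0)) => [t|]; last exact: cmeas_cst.
by rewrite nth_default// size_map size_tuple.
Qed.

Lemma cmeas_leftvec k i : cmeas (fun t : n.-tuple CR => (leftvec t k)`_i).
Proof.
elim: k i => [|k ih] i.
  by apply: (cmeas_eq (g := fun=> 0)) => [t|]; [rewrite nth_nil|exact: cmeas_cst].
pose g (t : n.-tuple CR) : C := if k == 0%N then 1 else
  (\sum_(i < k) (leftvec t k)`_i * entry t i k) / (z - eigen t k).
have mg : cmeas g.
  rewrite /g; case: (k == 0%N); first exact: cmeas_cst.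
  apply: cmeasM.
    by apply: cmeas_sum => j; apply: cmeasM => //; exact: cmeas_entry.
  by apply: cmeasV; apply: cmeasB; [exact: cmeas_cst|exact: cmeas_entry].
apply: (cmeas_eq (g := fun t : n.-tuple CR => if (i < k)%N then (leftvec t k)`_i else
   if i == k then g t else 0)) => [t|].
  by rewrite /= nth_rcons size_leftvec.
case: (i < k)%N; first exact: ih.
by case: (i == k); [|exact: cmeas_cst].
Qed.

Lemma Tmeas_sqnorm k : Tmeas n (fun s => sqnorm s k).
Proof.
rewrite /Tmeas (_ : (fun _ => _) =
    (fun t : n.-tuple CR => \sum_(i < k) absq (leftvec t k)`_i)).
  by apply: measurable_sum => i; apply: measurable_absq; exact: cmeas_leftvec.
by apply/funext => t; rewrite /sqnorm (big_nth 0) size_leftvec big_mkord.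
Qed.

Lemma mmeas_triang k : mmeas (fun t : n.-tuple CR => triang t k).
Proof.
move=> i j; apply: (cmeas_eq (g := fun t : n.-tuple CR => if (i <= j)%N then entry t i j else
  0)) => [t|].
  by rewrite mxE.
by case: (i <= j)%N; [exact: cmeas_entry|exact: cmeas_cst].
Qed.

Lemma Tmeas_gramdet k : Tmeas n (fun s => gramdet s k).
Proof.
apply: measurable_Re; apply: cmeas_det.
apply: mmeasD; first exact: mmeas_cst.
by apply: mmeas_mul; [exact: mmeas_triang|apply: mmeas_ct; exact: mmeas_triang].
Qed.

End Measurability.

Definition eigen_det (M m : nat) (A : 'I_m -> nat) s : C :=
  \det (\matrix_(i < m, j < m) rot_monomial z M (A i) (eigen s j.+1)).

(* For m = M + 1 and A the identity this is the Schur density up to a constant.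
   Other exponents A arise from expanding the determinant along its last
   column, which lets the induction on m go through. *)
Definition schur_weight (M m : nat) (A : 'I_m -> nat) s : R :=
  (gramdet s m.+1)^-1 ^+ (M + m + 3) *
  (absq (eigen_det M A s) * \prod_(j < m) absq (z - eigen s j.+1)).

Lemma schur_weight_ge0 M m A s : 0 <= @schur_weight M m A s.
Proof.
rewrite mulr_ge0 ?exprn_ge0 ?invr_ge0 ?(ltW (gramdet_gt0 _ _))//.
by rewrite mulr_ge0 ?absq_ge0// prodr_ge0// => j _; exact: absq_ge0.
Qed.

Lemma Tmeas_schur_weight n M m A : Tmeas n (@schur_weight M m A).
Proof.
apply: measurable_funM; first by apply: measurable_invX; exact: Tmeas_gramdet.
apply: measurable_funM.
  apply: measurable_absq; apply: cmeas_det => i j.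
  apply: (cmeas_eq (g := fun t : n.-tuple CR => rot_monomial z M (A i) (eigen t j.+1))) => [t|].
    by rewrite mxE.
  have me := @cmeas_entry n j.+1 j.+1.
  apply: cmeasM; apply: cmeasX.
    by apply: cmeasB => //; exact: cmeas_cst.
  by apply: cmeasD; [exact: cmeas_cst|apply: cmeasM => //; exact: cmeas_cst].
apply: measurable_prod => j _; apply: measurable_absq.
by apply: cmeasB; [exact: cmeas_cst|exact: cmeas_entry].
Qed.

(** Cofactor expansion along the last column, the only one that contains the new eigenvalue. Up to
    sign, the coefficient of index i is the determinant for the exponents without A_i. *)
Lemma eigen_det_step M m (A : 'I_m.+1 -> nat) s v :
  size s = ncoord m -> size v = m.+1 ->
  exists x : 'I_m.+1 -> C,
    (forall i, absq (x i) = absq (eigen_det M (A \o lift i) s)) /\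
    (forall c : CR, eigen_det M A (s ++ rcons v c) =
      \sum_i x i * rot_monomial z M (A i) (toC c)).
Proof.
move=> sm vm.
pose x (i : 'I_m.+1) : C := (-1) ^+ (i + m) * eigen_det M (A \o lift i) s.
exists x; split => [i|c'].
  by rewrite absqM absqX absqN absq1 expr1n mul1r.
rewrite /eigen_det (expand_det_col _ ord_max); apply: eq_bigr => i _.
rewrite !mxE eigen_new// mulrC; congr (_ * _).
rewrite /x /cofactor; congr (_ * \det _).
apply/matrixP => i' j'; rewrite !mxE.
have jm : (lift ord_max j' : nat) = j' by rewrite /= /bump leqNgt ltn_ord.
by rewrite jm (eigen_cat sm).
Qed.

End SchurCoordinates.

(** * Integrating out the last column and its eigenvalue *)

Section SchurIntegral.
Context {R : realType}.
Local Notation C := R[i].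
Local Notation CR := (measurableTypeR R * measurableTypeR R)%type.
Local Open Scope sesquilinear_scope.
Local Open Scope ereal_scope.
Implicit Types s u : seq CR.

Lemma Tint_rcons_Cint n (f : seq CR -> \bar R) : Tmeas n.+1 f -> (forall s, 0 <= f s) ->
  Tint n.+1 f = Cint (fun l => Tint n (fun u => f (rcons u (ofC l)))).
Proof.
move=> mf f0; rewrite Tint_rcons// /Cint /Tint.
pose g (t : n.-tuple CR) c := f (rcons t c).
have mg : measurable_fun setT (fun p : n.-tuple CR * CR => g p.1 p.2).
  apply: (Tmeas_comp mf) => [p|i]; first by rewrite size_rcons size_tuple.
  exact: measurable_nth_rcons.
have g0 t c : 0 <= g t c by exact: f0.
have E := integral_swap (@ltup R n) (@lebesgue_complex R) mg g0.
apply: (eq_trans E).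
by apply: eq_integral => c _; rewrite toCK.
Qed.

Lemma Tmeas_cat_left d (U : measurableType d) m k (f : seq CR -> U) s :
  Tmeas (m + k) f -> size s = m -> Tmeas k (fun u => f (s ++ u)).
Proof.
move=> mf sm; apply: (Tmeas_comp mf) => [t|i]; first by rewrite size_cat sm size_tuple.
rewrite (_ : (fun _ => _) = (fun t : k.-tuple CR => if (i < m)%N then nth point s i
  else nth point t (i - m))).
  by case: (i < m)%N; [exact: measurable_cst|exact: (@Tmeas_nth R k (i - m))].
by apply/funext => t; rewrite nth_cat sm.
Qed.

Lemma sqnorm_shift (S a b c w : R) : c != 0%R ->
  (S + S * a * b * w / c = S * (1 + a * b / c * w))%R.
Proof. by move=> c0; field. Qed.

Lemma ge0_esum_distrr n (f : 'I_n -> \bar R) (k : \bar R) : (forall i, 0 <= f i) ->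
  k * \sum_i f i = \sum_i k * f i.
Proof. by move=> f0; rewrite ge0_sume_distrr. Qed.

Variable z : C.

(** Since L T = z L, the term L T T^* L^* equals |z|^2 |L|^2. *)
Lemma leftrow_quad s k : (forall j, (0 < j < k)%N -> eigen z s j != z) ->
  (complex.Re ((leftrow z s k *m (1%:M + triang z s k *m (triang z s k)^t*) *m
    (leftrow z s k)^t*) 0 0) = sqnorm z s k * (1 + absq z))%R.
Proof.
move=> ez; set L := leftrow z s k; set T := triang z s k.
have E : (L *m (1%:M + T *m T^t*) *m L^t* = L *m L^t* + (z * z^*) *: (L *m L^t*))%R.
  rewrite mulmxDr mulmx1 mulmxDl; congr (_ + _)%R.
  rewrite mulmxA -mulmxA -ctrmx_mul leftrow_eigen//.
  by rewrite -scalemxAl; apply/matrixP => i j; rewrite !mxE mulr_sumr -mulrA mulr_sumr mulr_sumr;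
     apply: eq_bigr => k' _; rewrite !mxE rmorphM/=; ring.
rewrite E mxE [X in complex.Re (_ + X)%R]mxE mul_conj_absq /L sqnorm_row.
by rewrite -rmorphM -rmorphD /= mulrDr mulr1 [(absq _ * _)%R]mulrC.
Qed.

Lemma schur_weight_step M m (A : 'I_m.+1 -> nat) s (v : seq CR) (c : CR) :
  size s = ncoord m -> size v = m.+1 ->
  schur_weight z M A (s ++ rcons v c) =
  ((gramdet z s m.+1)^-1 ^+ (M + m.+1 + 3) *
   (absq (eigen_det z M A (s ++ rcons v c)) *
     (\prod_(j < m) absq (z - eigen z s j.+1) * absq (z - toC c))) *
   ((1 + absq (toC c)) + qform (1%:M + triang z s m.+1 *m (triang z s m.+1)^t*)
       (colv m.+1 v))^-1 ^+ (M + 3 + m.+1))%R.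
Proof.
move=> sm vm; rewrite /schur_weight (gramdet_step _ sm _ vm) big_ord_recr/=.
rewrite (eigen_new _ sm _ vm).
rewrite (eq_bigr (fun j : 'I_m => absq (z - eigen z s j.+1)%R)); last first.
  by move=> j _; rewrite (eigen_cat _ sm).
rewrite invfM exprMn; set q := (M + m.+1 + 3)%N.
have -> : (M + 3 + m.+1)%N = q by rewrite /q addnAC.
by rewrite mulrAC.
Qed.

(** Exponents: a column of length m + 1 lowers the power of the inverse Gram determinant from M + m
    + 4 to M + m + 3 and leaves (1 + |l|^2)^-(M + 3). Writing |z - l|^2 as (1 + |z|^2) (1 + |l|^2) /
    kappa(l) uses up one factor, so the weight (1 + |l|^2)^-(M + 2) of [spherical_orthogonality]
    remains. *)
Lemma schur_weight_integral M m : exists K : \bar R, 0 <= K /\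
  forall (A : 'I_m.+1 -> nat) (F : R -> \bar R) s, injective A -> (forall i, (A i <= M)%N) ->
  measurable_fun setT F -> (forall x, 0 <= F x) -> size s = ncoord m ->
  Tint m.+2 (fun u => F (sqnorm z (s ++ u) m.+2) *
                      (schur_weight z M A (s ++ u))%:E) =
  \sum_i (K * @eigen_mass R (M + 2 + 2) (A i)) *
    (beta_op (A i) F (sqnorm z s m.+1) * (schur_weight z M (A \o lift i) s)%:E).
Proof.
have [K [K0 colK]] := @column_integral R (M + 3) m.+1.
exists (K * ((1 + absq z) ^+ M.+1)%:E); split.
  by rewrite mule_ge0// lee_fin exprn_ge0// ltW// onem_absq_gt0.
move=> A F s Ai AM mF F0 sm.
set D := gramdet z s m.+1; set S := sqnorm z s m.+1.
have D0 : (0 < D)%R by exact: gramdet_gt0.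
pose W := (\prod_(j < m) absq (z - eigen z s j.+1))%R.
have W0 : (0 <= W)%R by apply: prodr_ge0 => j _; exact: absq_ge0.
pose v0 : m.+1.-tuple CR := [tuple of nseq m.+1 point].
have [x [xA xE]] := eigen_det_step z M A sm (size_tuple v0).
(* The coefficients were obtained for the dummy column [v0]; the determinant involves eigenvalues
   only, so they serve every column u. *)
have xE' u c : size u = m.+1 -> eigen_det z M A (s ++ rcons u c) =
    (\sum_i x i * rot_monomial z M (A i) (toC c))%R.
  move=> um; rewrite -xE /eigen_det; congr (\det _); apply/matrixP => i j.
  rewrite !mxE; have [jm|mj] := ltnP j m.
    by rewrite !(eigen_cat _ sm).
  have -> : nat_of_ord j = m by apply/eqP; rewrite eqn_leq mj -ltnS ltn_ord.
  by rewrite !(eigen_new _ sm)// size_tuple.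
pose h u := F (sqnorm z u m.+2) * (schur_weight z M A u)%:E.
have mh : Tmeas m.+2 (fun u => h (s ++ u)).
  apply: (@Tmeas_cat_left _ _ (ncoord m)) => //; apply: emeasurable_funM.
    by apply: (measurableT_comp mF); exact: Tmeas_sqnorm.
  by apply/measurable_EFinP; exact: Tmeas_schur_weight.
have h0 u : 0 <= h u by rewrite /h mule_ge0// lee_fin schur_weight_ge0.
rewrite (Tint_rcons_Cint mh) => [|u]; last exact: h0.
pose E l := (\sum_i x i * rot_monomial z M (A i) l)%R.
pose k l := ((1 + absq z) * (1 + absq l) / absq (l - z))%R.
transitivity (Cint (fun l => (K * (D^-1 ^+ (M + m + 3) * (W * (1 + absq z)))%:E) *
  ((absq (E l) * (1 + absq l)^-1 ^+ (M + 2))%:E * overlap_kernel (M + 2) F S (k l)))).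
  apply: eq_Cint => l.
  set Wl := (W * absq (z - l))%R.
  have hE u : size u = m.+1 -> h (s ++ rcons u (ofC l)) =
      F (S + absq ((leftrow z s m.+1 *m colv m.+1 u) 0 0) / absq (z - l))%R *
      (D^-1 ^+ (M + m.+1 + 3) * (absq (E l) * Wl) *
       ((1 + absq l) + qform (1%:M + triang z s m.+1 *m (triang z s m.+1)^t*)
         (colv m.+1 u))^-1 ^+ (M + 3 + m.+1))%:E.
    by move=> um; rewrite /h (sqnorm_step _ sm _ um) (@schur_weight_step M m A s u _ sm um)
      (xE' _ _ um) ofCK.
  (* If z is repeated, the recursion for the left eigenvector is no longer valid, but both sides
     vanish: the weight does, and on the right either W = 0 or l = z, where k l = 0 by default and
     the kernel is 0. *)
  have [W00|Wn0] := eqVneq Wl 0%R.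
    transitivity (0 : \bar R).
      rewrite (@eq_Tint _ _ _ (fun=> 0)); first by rewrite /Tint integral0.
      by move=> u um; rewrite hE// W00 mulr0 mulr0 mul0r mule0.
    move/eqP: W00; rewrite mulf_eq0 absqB => /orP[] /eqP W00.
      by rewrite W00 mul0r mulr0 mule0 mul0e.
    by rewrite /overlap_kernel /k W00 invr0 mulr0 invr0 mul0e mule0 mule0.
  have /andP[Wn lz] : ((W != 0) && (absq (z - l) != 0))%R.
    by move: Wn0; rewrite mulf_eq0 negb_or.
  pose c0 := (D^-1 ^+ (M + m.+1 + 3) * (absq (E l) * Wl))%R.
  pose G x := c0%:E * F (S + x / absq (z - l))%R.
  have c00 : (0 <= c0)%R.
    by rewrite /c0 mulr_ge0 ?exprn_ge0 ?invr_ge0 ?(ltW D0)// mulr_ge0 ?absq_ge0// mulr_ge0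
      ?absq_ge0.
  have mG : measurable_fun setT G.
    apply: emeasurable_funM => //; apply: (measurableT_comp mF).
    by apply: measurable_funD => //; exact: measurable_funM.
  have G0 y : 0 <= G y by rewrite mule_ge0.
  rewrite (@eq_Tint _ _ _ (fun u => G (absq ((leftrow z s m.+1 *m colv m.+1 u) 0 0)%R) *
    (((1 + absq l) + qform (1%:M + triang z s m.+1 *m (triang z s m.+1)^t*)
         (colv m.+1 u))^-1 ^+ (M + 3 + m.+1))%:E)); last first.
    by move=> u um; rewrite hE// /G EFinM muleA; congr (_ * _); rewrite muleC.
  rewrite (colK ord0)//; last 3 first.
  - exact: posdef_gram.
  - exact: leftrow0.
  - exact: onem_absq_gt0.
  rewrite leftrow_quad; last first.
    move=> [//|j] /andP[_ jm]; apply/eqP => ez; move/eqP: Wn; apply; apply/eqP.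
    rewrite /W prodf_seq_eq0; apply/hasP; exists (Ordinal (jm : (j < m)%N));
      first by rewrite mem_index_enum.
    by rewrite /= ez subrr absq0.
  rewrite -/(gramdet z s m.+1) -/D -/S /overlap_kernel.
  pose f (v : C) := F (S * (1 + k l * absq v))%R * ((1 + absq v)^-1 ^+ (M + 2 + 2))%:E.
  have f0 v : 0 <= f v by rewrite mule_ge0// invX_absq_ge0.
  have mf : Cmeas f.
    apply: emeasurable_funM; last exact: measurable_invX_absq.
    apply: (measurableT_comp mF); apply: measurable_funM => //.
    apply: measurable_funD => //; apply: measurable_funM => //.
    exact: measurable_absq_toC.
  rewrite (@eq_Cint _ _ (fun v => c0%:E * f v)); last first.
    move=> v; rewrite /G -muleA; congr (_ * (F _ * _)).
      by rewrite sqnorm_shift// /k absqB.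
    by rewrite !addnS !addn0.
  rewrite CintZl// -/f -[in RHS]muleA; congr (K * _).
  rewrite !muleA -!EFinM; congr (_%:E * _).
  have l0 : (1 + absq l != 0)%R by rewrite gt_eqF// onem_absq_gt0.
  have z0 : (1 + absq z != 0)%R by rewrite gt_eqF// onem_absq_gt0.
  have Dn0 : (D != 0)%R by rewrite gt_eqF.
  rewrite /c0 /k /Wl absqB in lz *; rewrite [absq (l - z)%R]absqB in lz *.
  rewrite !(addnS, addSn, addn0) !exprS.
  by field; rewrite ?l0 ?z0 ?Dn0 ?lz.
pose hk (t : R) := overlap_kernel (M + 2) F S `|t|%R.
have mhk : measurable_fun setT hk.
  apply: measurableT_comp; first exact: measurable_overlap_kernel.
  exact: normr_measurable.
have hk0 t : 0 <= hk t.
  rewrite mule_ge0// ?lee_fin ?invr_ge0//.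
  by apply: Cint_ge0 => v; rewrite mule_ge0// invX_absq_ge0.
have k0 l : (0 <= k l)%R.
  by rewrite /k !mulr_ge0 ?invr_ge0 ?absq_ge0// ltW// onem_absq_gt0.
pose f l := (absq (E l) * (1 + absq l)^-1 ^+ (M + 2))%:E * hk (k l).
rewrite (@eq_Cint _ _ (fun l => (K * (D^-1 ^+ (M + m + 3) * (W * (1 + absq z)))%:E) * f l));
  last first.
  by move=> l; rewrite /f /hk ger0_norm.
have f0 l : 0 <= f l.
  by rewrite mule_ge0// lee_fin mulr_ge0 ?absq_ge0// -lee_fin invX_absq_ge0.
have mrot i : cmeas (fun c : CR => rot_monomial z M (A i) (toC c)).
  apply: cmeasM; apply: cmeasX.
    by apply: cmeasB; [exact: cmeas_toC|exact: cmeas_cst].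
  apply: cmeasD; first exact: cmeas_cst.
  by apply: cmeasM; [exact: cmeas_cst|exact: cmeas_toC].
have mk : measurable_fun setT (fun c : CR => k (toC c)).
  apply: measurable_funM.
    by apply: measurable_funM => //; apply: measurable_funD => //; exact: measurable_absq_toC.
  apply: measurable_fun_inv; apply: measurable_absq.
  by apply: cmeasB; [exact: cmeas_toC|exact: cmeas_cst].
have mf : Cmeas f.
  apply: emeasurable_funM; last exact: (measurableT_comp mhk mk).
  apply/measurable_EFinP; apply: measurable_funM.
    apply: measurable_absq; apply: cmeas_sum => i.
    by apply: cmeasM; [exact: cmeas_cst|exact: mrot].
  by have /measurable_EFinP := @measurable_invX_absq R (M + 2).
rewrite CintZl//; last first.
  rewrite mule_ge0// lee_fin mulr_ge0 ?exprn_ge0 ?invr_ge0 ?(ltW D0)//.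
  by rewrite mulr_ge0// ltW// onem_absq_gt0.
rewrite /f (spherical_orthogonality z x Ai AM mhk hk0).
pose e i := eigen_mass (M + 2 + 2) (A i) * beta_op (A i) F S.
rewrite (eq_bigr (fun i => (absq (x i))%:E * e i)); last first.
  move=> i _; congr (_ * _).
  rewrite /e -(Cint_overlap_kernel _ mF F0); last by rewrite addn2 ltnS ltnW// ltnS.
  apply: eq_Cint => w; congr (_ * _); rewrite /hk ger0_norm//.
  by rewrite mulr_ge0 ?invr_ge0 ?absq_ge0// ltW// onem_absq_gt0.
have e0 i : 0 <= e i by rewrite mule_ge0 ?eigen_mass_ge0// beta_op_ge0.
rewrite muleA ge0_esum_distrr; last by move=> i; rewrite mule_ge0// lee_fin absq_ge0.
apply: eq_bigr => i _; rewrite xA /schur_weight -/D -/W /e.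
rewrite -!muleA; congr (K * _).
rewrite [X in _ = _ * (_ * X)]muleC [X in _ = _ * X]muleCA !muleA -!EFinM.
by congr (_%:E * _ * _); rewrite exprS; ring.
Qed.

End SchurIntegral.

(** * Removing all eigenvalues by induction *)

Section SchurLaw.
Context {R : realType}.
Local Notation C := R[i].
Local Notation CR := (measurableTypeR R * measurableTypeR R)%type.
Local Open Scope ereal_scope.
Implicit Types s u : seq CR.
Variable z : C.

Lemma Tint_sum n k (f : 'I_k -> seq CR -> \bar R) : (forall i, Tmeas n (f i)) ->
  (forall i s, 0 <= f i s) -> Tint n (fun s => \sum_i f i s) = \sum_i Tint n (f i).
Proof.
move=> mf f0; rewrite /Tint.
exact: (@ge0_integral_sum _ _ _ (@ltup R n) setT measurableT _
  (fun i (t : n.-tuple CR) => f i t)).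
Qed.

Lemma perm_lift m (A : 'I_m.+1 -> nat) i :
  perm_eq ([seq A (lift i j) | j <- enum 'I_m] ++ [:: A i]) [seq A j | j <- enum 'I_m.+1].
Proof.
rewrite cats1 perm_rcons (_ : _ :: _ = map A (i :: map (lift i) (enum 'I_m))).
  apply: perm_map; apply: uniq_perm; rewrite ?enum_uniq//=.
    rewrite (map_inj_uniq (@lift_inj _ i)) enum_uniq andbT.
    by apply/mapP => -[j _] /eqP; rewrite (negPf (neq_lift i j)).
  move=> j; rewrite in_cons mem_enum inE.
  case: (unliftP i j) => [j'|] ->; last by rewrite eqxx.
  by rewrite (mem_map (@lift_inj _ i)) mem_enum orbT.
by rewrite /= -map_comp.
Qed.

(** The term of index i applies [beta_op (A i)] and, by induction, the operators of the remaining
    exponents. By commutation every term is a constant times the same composite, and only the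
    constants are summed. The argument 1 is the value of S for the block of size 1. *)
Lemma schur_integral M m (A : 'I_m -> nat) : injective A -> (forall i, (A i <= M)%N) ->
  exists K : \bar R, 0 <= K /\ forall F : R -> \bar R,
  measurable_fun setT F -> (forall x, 0 <= F x) ->
  Tint (ncoord m) (fun s => F (sqnorm z s m.+1) * (schur_weight z M A s)%:E) =
  K * beta_ops [seq A i | i <- enum 'I_m] F 1%R.
Proof.
elim: m A => [|m ih] A Ai AM.
  exists (schur_weight z M A [::])%:E; split; first by rewrite lee_fin schur_weight_ge0.
  move=> F mF F0; rewrite Tint0 muleC; congr (_ * _).
  have -> : enum 'I_0 = [::] by apply: size0nil; rewrite size_enum_ord.
  by rewrite /sqnorm/= big_seq1 absq1.
have Bi i : injective (A \o lift i) by move=> j k /Ai /lift_inj.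
have /choice[K0 K0P] := fun i => ih (A \o lift i) (Bi i) (fun j => AM (lift i j)).
have [K [K1 KP]] := schur_weight_integral z M m.
pose c i := K * eigen_mass (M + 2 + 2) (A i).
have c0 i : 0 <= c i by rewrite mule_ge0 ?eigen_mass_ge0.
exists (\sum_i c i * K0 i); split.
  by apply: sume_ge0 => i _; rewrite mule_ge0//; have [] := K0P i.
move=> F mF F0; rewrite ncoordS Tint_cat; last 2 first.
- apply: emeasurable_funM; first by apply: (measurableT_comp mF); exact: Tmeas_sqnorm.
  by apply/measurable_EFinP; exact: Tmeas_schur_weight.
- by move=> s; rewrite mule_ge0// lee_fin schur_weight_ge0.
pose g i s := beta_op (A i) F (sqnorm z s m.+1) * (schur_weight z M (A \o lift i) s)%:E.
have g0 i s : 0 <= g i s by rewrite mule_ge0 ?beta_op_ge0// lee_fin schur_weight_ge0.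
have mg i : Tmeas (ncoord m) (g i).
  apply: emeasurable_funM; last by apply/measurable_EFinP; exact: Tmeas_schur_weight.
  by apply: (measurableT_comp (measurable_beta_op _ mF F0)); exact: Tmeas_sqnorm.
rewrite (@eq_Tint _ _ _ (fun s => \sum_i c i * g i s)); last first.
  by move=> s sm; exact: KP.
rewrite Tint_sum; last 2 first.
- by move=> i; apply: emeasurable_funM => //; exact: mg.
- by move=> i s; rewrite mule_ge0.
rewrite ge0_sume_distrl; last by move=> i _; rewrite mule_ge0//; have [] := K0P i.
apply: eq_bigr => i _; rewrite (TintZl (mg i) (g0 i) (c0 i)).
have [_ ->] := K0P i; last 2 first.
- exact: measurable_beta_op.
- by move=> x; exact: beta_op_ge0.
rewrite muleA; congr (_ * _).
by rewrite -(beta_ops_perm mF F0 (perm_lift A i)) beta_ops_cat.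
Qed.

End SchurLaw.

(** * The Schur density in terms of rotated monomials *)

Section Density.
Context {R : realType}.
Local Notation C := R[i].
Local Notation CR := (measurableTypeR R * measurableTypeR R)%type.
Local Open Scope sesquilinear_scope.
Variable z : C.

Definition rot_poly (M a : nat) : {poly C} := ('X - z%:P) ^+ a * (1 + z^* *: 'X) ^+ (M - a).

Lemma rot_polyE M a l : (rot_poly M a).[l] = rot_monomial z M a l.
Proof. by rewrite /rot_poly !hornerE. Qed.

Lemma size_rot_poly M a : (a <= M)%N -> (size (rot_poly M a) <= M.+1)%N.
Proof.
move=> aM; apply: (leq_trans (size_polyMleq _ _)).
have s1 : (size (('X - z%:P) ^+ a) <= a.+1)%N.
  by apply: (leq_trans (size_poly_exp_leq _ _)); rewrite size_XsubC mul1n.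
have s2 : (size ((1 + z^* *: 'X : {poly C}) ^+ (M - a)) <= (M - a).+1)%N.
  apply: (leq_trans (size_poly_exp_leq _ _)); rewrite ltnS -[X in (_ <= X)%N]mul1n leq_mul2r.
  apply/orP; right; rewrite -subn1 leq_subLR.
  apply: (leq_trans (size_polyD _ _)); rewrite geq_max size_poly1/=.
  by apply: (leq_trans (size_scale_leq _ _)); rewrite size_polyX.
move: s1 s2; set a1 := size _; set a2 := size _ => h1 h2.
by rewrite -ltnS; lia.
Qed.

(* Transition matrix from the powers of l to [rot_monomial]: it reduces
   [eigen_det] to the Vandermonde determinant of the eigenvalues. *)
Definition rot_basis n : 'M[C]_n.+1 := \matrix_(i, k) (rot_poly n i)`_k.

Lemma rot_basis_mul n (l : 'I_n.+1 -> C) :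
  \matrix_(i < n.+1, j < n.+1) rot_monomial z n i (l j) =
  rot_basis n *m Vandermonde n.+1 (\row_j l j).
Proof.
apply/matrixP => i j; rewrite !mxE -rot_polyE.
rewrite (horner_coef_wide _ (size_rot_poly (_ : i <= n)%N)) -1?ltnS ?ltn_ord//.
by apply: eq_bigr => k _; rewrite !mxE.
Qed.

(** One evaluation suffices. At distinct points l_j where y_j = 1 + conj(z) l_j does not vanish, the
    determinant of the [rot_monomial] is the Vandermonde determinant of the x_j = (l_j - z) / y_j
    times the product of the y_j^n. *)
Lemma det_rot_basis_neq0 n : \det (rot_basis n) != 0.
Proof.
(* With l_j = j z one has y_j = 1 + j |z|^2 > 0; for z = 0 all y_j are 1 and any distinct points
   do. *)
pose c : C := if z == 0 then 1 else z.
have c0 : c != 0 by rewrite /c; case: (eqVneq z 0) => // _; rewrite oner_eq0.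
pose l (j : 'I_n.+1) : C := c * (j%:R).
have li j k : l j = l k -> j = k.
  by move=> /(mulfI c0)/eqP; rewrite eqr_nat => /eqP/val_inj.
pose y (j : 'I_n.+1) := 1 + z^* * l j.
have y0 j : y j != 0.
  have [z0|z0] := eqVneq z 0; first by rewrite /y z0 rmorph0 mul0r addr0 oner_eq0.
  rewrite /y /l /c (negPf z0).
  rewrite mulrA [_^* * _]mulrC mul_conj_absq -(rmorph_nat (real_complex R)).
  rewrite -rmorphM -(rmorph1 (real_complex R)) -rmorphD fmorph_eq0 gt_eqF//.
  by rewrite ltr_wpDr// mulr_ge0 ?absq_ge0.
pose x j := (l j - z) / y j.
have xi j k : x j = x k -> j = k.
  move=> /eqP; rewrite /x eqr_div// /y => E; apply: li.
  apply/eqP; rewrite -subr_eq0.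
  (* Clearing denominators in x_j = x_k leaves (l_j - l_k) (1 + |z|^2) = 0. *)
  have h0 : 1 + z * z^* != 0.
    by rewrite mul_conj_absq -(rmorph1 (real_complex R)) -rmorphD fmorph_eq0 gt_eqF//
      onem_absq_gt0.
  apply/eqP/(mulIf h0); rewrite mul0r; move: E; rewrite -subr_eq0 => /eqP <-.
  by ring.
have : \det (\matrix_(i < n.+1, j < n.+1) rot_monomial z n i (l j)) != 0.
  have -> : \matrix_(i < n.+1, j < n.+1) rot_monomial z n i (l j) =
      Vandermonde n.+1 (\row_j x j) *m diag_mx (\row_j y j ^+ n).
    apply/matrixP => i j; rewrite mul_mx_diag !mxE /x expr_div_n.
    have -> : y j ^+ n = y j ^+ i * y j ^+ (n - i) by rewrite -exprD subnKC// -ltnS.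
    by rewrite mulrA divfK// expf_neq0.
  rewrite det_mulmx det_Vandermonde det_diag mulf_neq0//.
    apply/prodf_neq0 => i _; apply/prodf_neq0 => j ij; rewrite !mxE subr_eq0.
    by apply/eqP => /xi ji; move: ij; rewrite ji ltnn.
  by apply/prodf_neq0 => i _; rewrite mxE expf_neq0.
by rewrite rot_basis_mul det_mulmx mulf_eq0 negb_or => /andP[].
Qed.

Lemma absq_prod (I : Type) (r : seq I) (P : pred I) (f : I -> C) :
  absq (\prod_(i <- r | P i) f i) = \prod_(i <- r | P i) absq (f i).
Proof. by apply: (big_morph _ (@absqM R)); exact: absq1. Qed.

(** In the product of differences the pairs containing index 0 give the factors |z - l_j|^2, and the
    other pairs a Vandermonde determinant of n + 1 eigenvalues. With N = n + 2 the exponent 2 N is n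
    + (n + 1) + 3. *)
Lemma sph_weight_schur n : exists c : R, 0 < c /\ forall t : schur_coords R n.+2,
  sph_weight (schur_mx z t) = c * schur_weight z n (fun i : 'I_n.+1 => i : nat) t.
Proof.
exists (absq (\det (rot_basis n)))^-1; split.
  by rewrite invr_gt0 absq_gt0 det_rot_basis_neq0.
move=> t.
have B0 : absq (\det (rot_basis n)) != 0 by rewrite absq_eq0 det_rot_basis_neq0.
rewrite /schur_weight /eigen_det (rot_basis_mul (fun j : 'I_n.+1 => eigen z t j.+1)).
rewrite det_mulmx absqM det_Vandermonde.
have -> : schur_mx z t = triang z t n.+2 by apply/matrixP => i j; rewrite !mxE.
rewrite /sph_weight.
have [E _] := posC_real (posdef_det_gt0 (posdef_gram (triang z t n.+2))).
rewrite E -/(gramdet z t n.+2).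
rewrite (eq_bigr (fun i : 'I_n.+2 => (\prod_(j < n.+2 | (i < j)%N)
    absq (eigen z t i - eigen z t j))%:C)); last first.
  move=> i _; rewrite rmorph_prod; apply: eq_bigr => j _.
  by rewrite normc_absq !mxE !leqnn.
rewrite -rmorph_prod -rmorphXn -fmorphV -rmorphM /=.
have -> : (2 * n.+2)%N = (n + n.+1 + 3)%N by lia.
rewrite big_ord_recl.
have -> : \prod_(j < n.+2 | ((ord0 : 'I_n.+2) < j)%N) absq (eigen z t (ord0 : 'I_n.+2) - eigen
  z t j) =
    \prod_(j < n.+1) absq (z - eigen z t j.+1).
  by rewrite big_mkcond [LHS]big_ord_recl/= mul1r.
have -> : \prod_(i < n.+1) \prod_(j < n.+2 | (lift ord0 i < j)%N)
    absq (eigen z t (lift ord0 i) - eigen z t j) =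
    absq (\prod_(i < n.+1) \prod_(j < n.+1 | (i < j)%N)
      ((\row_k eigen z t k.+1) 0 j - (\row_k eigen z t k.+1) 0 i)).
  rewrite absq_prod; apply: eq_bigr => i _; rewrite absq_prod.
  rewrite big_mkcond big_ord_recl/= mul1r [RHS]big_mkcond/=.
  by apply: eq_bigr => j _; rewrite /bump !add1n ltnS; case: ifP => // _; rewrite !mxE absqB.
by rewrite -exprVn; field.
Qed.

End Density.

(** * The law of the overlap *)

Section RadialLaw.
Context {R : realType}.
Local Notation mu := (@lebesgue_measure R).
Local Open Scope ereal_scope.
Implicit Types (F : R -> \bar R) (x y : R).

Definition ooind x0 x1 x : R := ((x0 < x) && (x < x1))%R%:R.

Lemma measurable_ooind d (T : measurableType d) (f g h : T -> R) :
  measurable_fun setT f -> measurable_fun setT g -> measurable_fun setT h ->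
  measurable_fun setT (fun t => ooind (f t) (g t) (h t)).
Proof.
move=> mf mg mh.
rewrite (_ : (fun t => _) = (fun t => (f t < h t)%R%:R * (h t < g t)%R%:R)%R).
  by apply: measurable_funM; exact: measurable_lt_ind.
by apply/funext => t; rewrite /ooind; do 2 case: (_ < _)%R; rewrite /= ?mulr0 ?mulr1.
Qed.

Lemma integral_unit_beta a b :
  \int[mu]_x (ooind 0 1 x * (x ^+ a * (1 - x) ^+ b))%:E = (beta_fun a.+1 b.+1 : R)%:E.
Proof.
rewrite EFin_beta_fun integral_XMonemX_restrict setTI.
rewrite integral_itv_bndoo; last first.
  by apply/measurable_EFinP; exact: measurable_XMonemX.
rewrite [RHS]integral_mkcond; apply: eq_integral => x _.
rewrite patchE /ooind mem_setE in_itv/=.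
by case: (_ && _); rewrite ?mul1r ?mul0r.
Qed.

Lemma integral_power_trunc n y :
  \int[mu]_x (ooind 1 y x * (x - 1) ^+ n)%:E =
  ((1 < y)%R%:R * ((y - 1) ^+ n.+1 / n.+1%:R))%:E.
Proof.
have [y1|y1] := ltP; last first.
  rewrite mul0r; apply: integral0_eq => x _; rewrite /ooind.
  have -> : ((1 < x) && (x < y))%R = false.
    by apply/negP => /andP[x1 xy]; move: (lt_trans x1 xy); rewrite ltNge y1.
  by rewrite mul0r.
have y0 : (0 < y - 1)%R by rewrite subr_gt0.
have yn0 := lt0r_neq0 y0.
pose f x := (ooind 1 y x * (x - 1) ^+ n)%:E.
have mpow : measurable_fun setT (fun x : measurableTypeR R => (x - 1) ^+ n : R)%R.
  by apply: measurable_funX; exact: measurable_funB.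
have mf : measurable_fun setT f.
  apply/measurable_EFinP; apply: measurable_funM => //.
  by apply: measurable_ooind.
have pow0 x x1 : (0 <= ooind 1 x1 x * (x - 1) ^+ n)%R.
  rewrite /ooind; case: (ltP 1%R x) => [x0|]; last by rewrite mul0r.
  by rewrite mulr_ge0// exprn_ge0// subr_ge0 ltW.
have f0 x : 0 <= f x by rewrite lee_fin.
transitivity ((y - 1)%:E * \int[mu]_x f ((y - 1) * x + 1)%R).
  rewrite ge0_integral_affine// muleA -EFinM gtr0_norm// mulfV//.
  by rewrite mul1e.
transitivity ((y - 1)%:E * \int[mu]_x (((y - 1) ^+ n)%:E * (ooind 0 1 x * (x ^+ n * (1 - x) ^+
  0))%:E)).
  congr (_ * _); apply: eq_integral => x _; rewrite /f -EFinM; congr (_%:E).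
  rewrite /ooind addrK exprMn expr0 mulr1 [RHS]mulrCA; congr (_ * _)%R.
  have -> : (1 < (y - 1) * x + 1)%R = (0 < x)%R.
    by rewrite ltrDr pmulr_rgt0.
  by rewrite -ltrBrDr gtr_pMr.
rewrite ge0_integralTZl; last 3 first.
- apply/measurable_EFinP; apply: measurable_funM; first exact: measurable_ooind.
  by apply: measurable_funM; apply: measurable_funX => //; exact: measurable_funB.
- move=> x; rewrite lee_fin expr0 mulr1 /ooind.
  case: (ltP 0%R x) => [x0|]; last by rewrite mul0r.
  by rewrite mulr_ge0// exprn_ge0// ltW.
- by rewrite lee_fin exprn_ge0// ltW.
rewrite integral_unit_beta beta_fun_sym beta_fun1Sn muleA -!EFinM mul1r.
by rewrite -exprS.
Qed.

Lemma beta_op_radial : exists K : \bar R, 0 <= K /\ forall a F x0,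
  measurable_fun setT F -> (forall x, 0 <= F x) ->
  beta_op a F x0 =
  K * \int[mu]_x (((1 < x)%R%:R * x^-1 ^+ (a + 3))%:E * F (x0 * x)%R).
Proof.
have [K [K0 KP]] := @Cint_radial R; exists K; split=> // a F x0 mF F0.
pose h x := F (x0 * (1 + `|x|))%R * ((1 + `|x|)^-1 ^+ (a + 3))%:E.
have h0 x : 0 <= h x by rewrite mule_ge0// lee_fin exprn_ge0// invr_ge0 addr_ge0.
have mnx : measurable_fun setT (fun x : measurableTypeR R => 1 + `|x| : R)%R.
  by apply: measurable_funD => //; exact: normr_measurable.
have mh : measurable_fun setT h.
  apply: emeasurable_funM; last by apply/measurable_EFinP; exact: measurable_invX.
  by apply: (measurableT_comp mF); exact: measurable_funM.
transitivity (Cint (fun c => h (absq c))).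
  by apply: eq_Cint => c; rewrite /h ger0_norm// absq_ge0.
rewrite KP//; congr (_ * _).
pose g x := (((1 < x)%R%:R * x^-1 ^+ (a + 3))%:E * F (x0 * x)%R).
have mg : measurable_fun setT g.
  apply: emeasurable_funM; last by apply: (measurableT_comp mF); exact: measurable_funM.
  apply/measurable_EFinP; apply: measurable_funM; last exact: measurable_invX.
  exact: measurable_lt_ind.
have g0 x : 0 <= g x.
  rewrite mule_ge0// lee_fin; case: ltP => x1; last by rewrite mul0r.
  by rewrite mul1r exprn_ge0// invr_ge0 (le_trans ler01)// ltW.
transitivity (\int[mu]_x g (1 * x + 1)%R).
  apply: eq_integral => x _; rewrite /g /h mul1r ltrDr.
  case: ltP => x1; last by rewrite mul0r !mul0e.
  by rewrite mul1e mul1r gtr0_norm// addrC muleC.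
by rewrite ge0_integral_affine ?oner_eq0// normr1 invr1 mul1e.
Qed.

(** In the induction the inner variable y is replaced by y / x. The powers of x then cancel exactly,
    and what remains is the integral of (x - 1)^n over 1 < x < y, that is (y - 1)^(n + 1) / (n +
    1). *)
Lemma beta_ops_iota n : exists K : \bar R, 0 <= K /\ forall F x0,
  measurable_fun setT F -> (forall x, 0 <= F x) ->
  beta_ops (iota 0 n.+1) F x0 =
  K * \int[mu]_x (((1 < x)%R%:R * (x - 1) ^+ n * x^-1 ^+ (n + 3))%:E * F (x0 * x)%R).
Proof.
have [L [L0 LP]] := beta_op_radial.
elim: n => [|n [K [K0 KP]]].
  exists L; split => // F x0 mF F0; rewrite /= LP//; congr (_ * _).
  by apply: eq_integral => x _; rewrite expr0 mulr1.
exists (K * L * (n.+1%:R^-1)%:E); split; first by rewrite !mule_ge0// lee_fin.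
move=> F x0 mF F0.
have -> : beta_ops (iota 0 n.+2) F = beta_ops (iota 0 n.+1) (beta_op n.+1 F).
  by rewrite -[n.+2]addn1 iotaD beta_ops_cat.
rewrite KP; last 2 first.
- exact: measurable_beta_op.
- by move=> x; exact: beta_op_ge0.
rewrite -!muleA; congr (K * _).
pose H x y := (ooind 1 y x * (x - 1) ^+ n * `|y|^-1 ^+ (n + 4))%:E * F (x0 * y)%R.
have H0 x y : 0 <= H x y.
  apply: mule_ge0; last exact: F0.
  rewrite lee_fin /ooind; case: (ltP 1%R x) => [x1|]; last by rewrite !mul0r.
  by rewrite !mulr_ge0// exprn_ge0// ?invr_ge0// subr_ge0 ltW.
have mH : measurable_fun setT (fun p : measurableTypeR R * measurableTypeR R => H p.1 p.2).
  apply: emeasurable_funM.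
    apply/measurable_EFinP; apply: measurable_funM.
      apply: measurable_funM; first exact: measurable_ooind.
      by apply: measurable_funX; exact: measurable_funB.
    by apply: measurable_invX; apply: measurableT_comp => //; exact: normr_measurable.
  by apply: (measurableT_comp mF); exact: measurable_funM.
have mL : measurable_fun setT (fun x : measurableTypeR R => \int[mu]_y H x y).
  exact: (measurable_integral2 mu mH H0).
transitivity (\int[mu]_x (L * \int[mu]_y H x y)).
  apply: eq_integral => x _.
  have [x1|x1] := ltP 1%R x; last first.
    rewrite !mul0r mul0e integral0_eq ?mule0// => y _.
    by rewrite /H /ooind ltNge x1 !mul0r mul0e.
  have xp : (0 < x)%R by exact: lt_trans x1.
  have xn : x != 0%R by rewrite gt_eqF.
  rewrite LP// mul1r muleCA; congr (L * _).
  pose G y := ((x < y)%R%:R * (x ^+ (n + 4) * `|y|^-1 ^+ (n + 4)))%:E * F (x0 * y)%R.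
  have mG : measurable_fun setT G.
    apply: emeasurable_funM; last by apply: (measurableT_comp mF); exact: measurable_funM.
    apply/measurable_EFinP; apply: measurable_funM; first exact: measurable_lt_ind.
    by apply: measurable_funM => //; apply: measurable_invX; exact: normr_measurable.
  have G0 y : 0 <= G y.
    by rewrite mule_ge0// lee_fin !mulr_ge0// exprn_ge0// ?invr_ge0// ltW.
  transitivity (((x - 1) ^+ n * x^-1 ^+ (n + 3))%:E * \int[mu]_y G (x * y + 0)%R).
    congr (_ * _); apply: eq_integral => y _; rewrite /G addr0 (mulrA x0).
    have -> : (x < x * y)%R = (1 < y)%R by rewrite ltr_pMr.
    case: (ltP 1%R y) => y1; last by rewrite !mul0r !mul0e.
    congr (_%:E * _); rewrite !mul1r gtr0_norm; last by rewrite mulr_gt0// (lt_trans _ y1).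
    by rewrite -exprMn invfM mulrA mulfV// mul1r addSn -addnS.
  rewrite ge0_integral_affine// muleA -EFinM gtr0_norm//.
  rewrite -ge0_integralTZl//; last first.
    by rewrite lee_fin mulr_ge0 ?invr_ge0 ?(ltW xp)// mulr_ge0// exprn_ge0// ?invr_ge0
      ?subr_ge0 ?(ltW xp) ?(ltW x1).
  apply: eq_integral => y _; rewrite /G /H muleA -EFinM; congr (_%:E * _).
  rewrite /ooind x1/=; case: (x < y)%R; rewrite ?mul0r ?mulr0// !mul1r.
  have -> : (n + 4 = (n + 3).+1)%N by rewrite !addnS.
  rewrite [(x ^+ (n + 3).+1)%R]exprS.
  set X := (x ^+ (n + 3))%R; have X0 : X != 0%R by rewrite expf_neq0.
  by rewrite exprVn -/X; field; rewrite xn X0.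
rewrite ge0_integralTZl//; last by move=> x; exact: integral_ge0.
congr (L * _); rewrite (integral_swap mu mu mH H0) -ge0_integralTZl; last 3 first.
- apply: emeasurable_funM; last by apply: (measurableT_comp mF); exact: measurable_funM.
  apply/measurable_EFinP; apply: measurable_funM; last exact: measurable_invX.
  apply: measurable_funM; first exact: measurable_lt_ind.
  by apply: measurable_funX; exact: measurable_funB.
- move=> y; rewrite mule_ge0// lee_fin; case: (ltP 1%R y) => [y1|]; last by rewrite !mul0r.
  by rewrite !mulr_ge0// exprn_ge0// ?invr_ge0 ?subr_ge0 ltW// (lt_trans _ y1).
- by rewrite lee_fin.
apply: eq_integral => y _.
transitivity (\int[mu]_x ((`|y|^-1 ^+ (n + 4))%:E * F (x0 * y)%R * (ooind 1 y x * (x - 1) ^+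
  n)%:E)).
  by apply: eq_integral => x _; rewrite /H [in RHS]muleC muleA -EFinM.
rewrite ge0_integralTZl; last 3 first.
- apply/measurable_EFinP; apply: measurable_funM; first exact: measurable_ooind.
  by apply: measurable_funX; exact: measurable_funB.
- move=> x; rewrite lee_fin /ooind; case: (ltP 1%R x) => [x1|]; last by rewrite mul0r.
  by rewrite mulr_ge0// exprn_ge0// subr_ge0 ltW.
- by rewrite mule_ge0// lee_fin exprn_ge0// invr_ge0.
rewrite integral_power_trunc muleAC [in RHS]muleA -!EFinM; congr (_%:E * _).
case: (ltP 1%R y) => y1; last by rewrite !mul0r !mulr0.
have y0 : (0 < y)%R by exact: lt_trans y1.
by rewrite !mul1r gtr0_norm// addSn -addnS; ring.
Qed.

(** The substitution x |-> 1 / x passes from the law of S to that of 1 / S and exhibits, up to a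
    constant, the density of Beta(2, n + 1). *)
Lemma integral_overlap_inv n F : measurable_fun setT F -> (forall x, 0 <= F x) ->
  \int[mu]_x (((1 < x)%R%:R * (x - 1) ^+ n * x^-1 ^+ (n + 3))%:E * F (1 * x)%R) =
  \int[mu]_x ((ooind 0 1 x * (x ^+ 1 * (1 - x) ^+ n))%:E * F x^-1%R).
Proof.
move=> mF F0.
pose h x := (((1 < x)%R%:R * `|(x - 1) ^+ n| * `|x|^-1 ^+ (n + 3))%:E * F x).
have mh : measurable_fun setT h.
  apply: emeasurable_funM => //; apply/measurable_EFinP; apply: measurable_funM.
    apply: measurable_funM; first exact: measurable_lt_ind.
    apply: measurableT_comp; first exact: normr_measurable.
    by apply: measurable_funX; exact: measurable_funB.
  by apply: measurable_invX; exact: normr_measurable.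
have h0 x : 0 <= h x by rewrite mule_ge0// lee_fin !mulr_ge0// exprn_ge0// invr_ge0.
transitivity (\int[mu]_x ((0 < x)%R%:R%:E * h x)).
  apply: eq_integral => x _; rewrite /h mul1r.
  case: (ltP 1%R x) => x1; last by rewrite !mul0r !mul0e mule0.
  have x0 : (0 < x)%R by exact: lt_trans x1.
  by rewrite x0 mul1e !ger0_norm// ?exprn_ge0 ?subr_ge0 ?ltW.
rewrite integral_inv_gt0//; apply: eq_integral => x _; rewrite /h /ooind.
case: (ltP 0%R x) => x0; last by rewrite !mul0r !mul0e.
rewrite muleA -EFinM; congr (_%:E * _).
rewrite invf_gt1//; case: (ltP x 1%R) => x1; last by rewrite !mul0r mulr0.
rewrite !mul1r !ger0_norm ?invr_ge0 ?(ltW x0) ?exprn_ge0 ?subr_ge0 ?invf_ge1 ?(ltW x1)//.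
have xn : x != 0%R by rewrite gt_eqF.
have -> : (x^-1 - 1 = (1 - x) / x)%R by field.
rewrite expr_div_n invrK expr1 exprD.
have xx : (x ^+ n != 0)%R by rewrite expf_neq0.
by field; rewrite xn xx.
Qed.

End RadialLaw.

(** * Overlaps of a unitary conjugate of a triangular matrix *)

Section Overlap.
Context {R : realType}.
Local Notation C := R[i].
Local Notation CR := (measurableTypeR R * measurableTypeR R)%type.
Local Open Scope sesquilinear_scope.

(** Eigenspaces of distinct eigenvalues are in direct sum, so each term x_j L_j of a linear relation
    between the rows vanishes. *)
Lemma eigenvectors_unit N (G L : 'M[C]_N) (lam : 'I_N -> C) : injective lam ->
  (forall j, row j L != 0) -> (forall j, row j L *m G = lam j *: row j L) ->
  L \in unitmx.
Proof.
move=> li L0 LG; rewrite -row_free_unit -kermx_eq0; apply/eqP/row_matrixP => i.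
rewrite row0; set x := row i _.
have xL : x *m L = 0 by rewrite /x -row_mul mulmx_ker row0.
have dx : mxdirect (\sum_(j < N) eigenspace G (lam j)).
  by apply: mxdirect_sum_eigenspace => j k _ _; exact: li.
apply/rowP => j; rewrite [RHS]mxE.
have : (x 0 j *: row j L <= eigenspace G (lam j) :&: \sum_(k < N | k != j) eigenspace G (lam
  k))%MS.
  rewrite sub_capmx; apply/andP; split.
    by apply: scalemx_sub; apply/eigenspaceP; exact: LG.
  have -> : x 0 j *: row j L = - \sum_(k < N | k != j) x 0 k *: row k L.
    have : \sum_k x 0 k *: row k L = 0 by rewrite -mulmx_sum_row xL.
    by rewrite (bigD1 j)//= => /eqP; rewrite addr_eq0 => /eqP.
  rewrite eqmx_opp; apply: summx_sub_sums => k _.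
  by apply: scalemx_sub; apply/eigenspaceP; exact: LG.
have /mxdirect_sumsP := dx => /(_ j isT) /= ->.
rewrite submx0 scalemx_eq0 (negPf (L0 j)) orbF => /eqP; exact.
Qed.

(** Ensures that the choice made in [overlap] is not the default one. Left eigenvectors are the rows
    of an invertible L, and the columns of its inverse are the dual right eigenvectors. *)
Lemma biorthogonal_exists N (G : 'M[C]_N) (lam : 'I_N -> C) : injective lam ->
  (forall j, \det (G - (lam j)%:M) = 0) ->
  exists RL, biorthogonal_eigenvectors G lam RL.1 RL.2.
Proof.
move=> li dG.
have /choice[v vP] : forall j, exists v : 'rV[C]_N, v != 0 /\ v *m G = lam j *: v.
  move=> j; have /eqP/det0P[v v0 vG] := dG j; exists v; split=> //.
  by apply/eqP; rewrite -subr_eq0 -[lam j *: v]mul_mx_scalar -mulmxBr vG.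
pose L := \matrix_j v j.
have Lj j : row j L = v j by exact: rowK.
have LG j : row j L *m G = lam j *: row j L by rewrite Lj; have [] := vP j.
have Lu : L \in unitmx.
  by apply: (eigenvectors_unit li _ LG) => j; rewrite Lj; have [] := vP j.
have LGD : L *m G = diag_mx (\row_j lam j) *m L.
  apply/row_matrixP => j; rewrite row_mul LG; apply/rowP => k.
  by rewrite [RHS]mxE mul_diag_mx !mxE.
exists (invmx L, L); split => //= [j|i j].
  have GR : G *m invmx L = invmx L *m diag_mx (\row_j lam j).
    by apply: (can_inj (mulKmx Lu)); rewrite mulmxA LGD mulmxK// mulKVmx.
  apply/colP => i; have := congr1 (fun M : 'M[C]_N => M i j) GR.
  rewrite mul_mx_diag !mxE mulrC => <-.
  by apply: eq_bigr => k _; rewrite mxE.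
by rewrite -mulmx_row_col mulmxV// mxE.
Qed.

(** Simple spectrum makes the eigenspaces one-dimensional: r = a R_i and l = b L_i, and l r = 1
    forces a b = 1, so the factors |a|^2 and |b|^2 cancel in the product of squared norms. *)
Lemma overlap_eigen N (G : 'M[C]_N) lam Rs Ls (i : 'I_N) (l : 'rV[C]_N) (r : 'cV[C]_N) :
  biorthogonal_eigenvectors G lam Rs Ls ->
  l *m G = lam i *: l -> G *m r = lam i *: r -> (l *m r) 0 0 = 1 ->
  (row i Ls *m (row i Ls)^t*) 0 0 * ((col i Rs)^t* *m col i Rs) 0 0 =
  (l *m l^t*) 0 0 * (r^t* *m r) 0 0.
Proof.
move=> [li GR LG LR] lG Gr lr.
have LR1 : Ls *m Rs = 1%:M.
  by apply/matrixP => j k; rewrite mulmx_row_col LR mxE.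
have RL1 := mulmx1C LR1.
have neq_lam j : j != i -> lam j - lam i != 0.
  by move=> ji; rewrite subr_eq0; apply: contra ji => /eqP/li ->.
pose a := (row i Ls *m r) 0 0.
pose b := (l *m col i Rs) 0 0.
have rE : r = a *: col i Rs.
  rewrite -[r]mul1mx -RL1 -mulmxA colE scalemxAr; congr (_ *m _).
  apply/colP => j; rewrite mulmx_row_col col_id [RHS]mxE [delta_mx _ _ _ _]mxE eqxx andbT.
  have [->|ji] := eqVneq j i; first by rewrite mulr1.
  rewrite mulr0; apply: (mulfI (neq_lam _ ji)); rewrite mulr0 mulrBl.
  have : (row j Ls *m G *m r) 0 0 = (row j Ls *m (G *m r)) 0 0 by rewrite mulmxA.
  by rewrite LG Gr -scalemxAl -scalemxAr [LHS]mxE [RHS]mxE => ->; rewrite subrr.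
have lE : l = b *: row i Ls.
  rewrite -[l]mulmx1 -RL1 mulmxA rowE scalemxAl; congr (_ *m _).
  apply/rowP => j; rewrite mulmx_row_col row_id [RHS]mxE [delta_mx _ _ _ _]mxE eqxx/=.
  have [->|ji] := eqVneq j i; first by rewrite mulr1.
  rewrite mulr0; apply: (mulfI (neq_lam _ ji)); rewrite mulr0 mulrBl.
  have : (l *m G *m col j Rs) 0 0 = (l *m (G *m col j Rs)) 0 0 by rewrite mulmxA.
  by rewrite lG GR -scalemxAl -scalemxAr [LHS]mxE [RHS]mxE => ->; rewrite subrr.
have ab : a * b = 1.
  have scaleE (M : 'M[C]_1) c : (c *: M) 0 0 = c * M 0 0 by rewrite mxE.
  by move: lr; rewrite {1}rE {1}lE -scalemxAl -scalemxAr !scaleE LR eqxx mulr1 mulrC.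
have E1 : (l *m l^t*) 0 0 = (absq b)%:C * (row i Ls *m (row i Ls)^t*) 0 0.
  rewrite {1 2}lE !mxE mulr_sumr; apply: eq_bigr => k _.
  by rewrite !mxE rmorphM -mul_conj_absq /=; ring.
have E2 : (r^t* *m r) 0 0 = (absq a)%:C * ((col i Rs)^t* *m col i Rs) 0 0.
  rewrite {1 2}rE !mxE mulr_sumr; apply: eq_bigr => k _.
  by rewrite !mxE rmorphM -mul_conj_absq /=; ring.
rewrite E1 E2 mulrACA -rmorphM -absqM (mulrC b) ab absq1.
exact: (esym (mul1r _)).
Qed.

(** The right eigenvector of T is a basis vector, of norm 1, so only the left one contributes;
    multiplication by U preserves both norms. *)
Lemma diag_overlap_unitary N (T U : 'M[C]_N) (lam : 'I_N -> C) (i : 'I_N) (l : 'rV[C]_N) :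
  injective lam -> (forall j, \det (T - (lam j)%:M) = 0) -> U \is unitarymx ->
  l *m T = lam i *: l -> T *m delta_mx i 0 = lam i *: (delta_mx i 0 : 'cV_N) -> l 0 i = 1 ->
  diag_overlap (U *m T *m U^t*) lam i = complex.Re ((l *m l^t*) 0 0).
Proof.
move=> li dT /unitarymxP UU lT Te li1.
have UU' := mulmx1C UU.
set G := U *m T *m U^t*.
have dG j : \det (G - (lam j)%:M) = 0.
  have -> : G - (lam j)%:M = U *m (T - (lam j)%:M) *m U^t*.
    by rewrite mulmxBr mulmxBl -/G mul_mx_scalar -scalemxAl UU scalemx1.
  by rewrite !det_mulmx dT mulr0 mul0r.
have := biorthogonal_exists li dG => -[RL0 RLP].
rewrite /diag_overlap /overlap; case: xgetP => [RL _ RLb|/(_ RL0)//].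
rewrite (overlap_eigen (l := l *m U^t*) (r := U *m delta_mx i 0) RLb); first last.
- by rewrite -mulmxA [U^t* *m _]mulmxA UU' mul1mx -colE mxE.
- by rewrite /G -!mulmxA [U^t* *m _]mulmxA UU' mul1mx Te scalemxAr.
- by rewrite /G !mulmxA -[l *m _ *m U]mulmxA UU' mulmx1 lT scalemxAl.
rewrite !ctrmx_mul ctrmxK -mulmxA [U^t* *m _]mulmxA UU' mul1mx.
rewrite mulmxA -[_ *m U^t* *m U]mulmxA UU' mulmx1.
by rewrite -colE !mxE eqxx rmorph1 mulr1.
Qed.

Lemma diag_overlap_degenerate N (G : 'M[C]_N) (lam : 'I_N -> C) (i : 'I_N) :
  ~ injective lam -> diag_overlap G lam i = 0.
Proof.
move=> nli; rewrite /diag_overlap /overlap; case: xgetP => [RL _ [] //|_] /=.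
by rewrite row0 mul0mx mxE mul0r.
Qed.

Lemma diag_overlap_schur (z : C) N (t : schur_coords R N.+1) (U : 'M[C]_N.+1) :
  U \is unitarymx -> injective (fun i => schur_mx z t i i) ->
  diag_overlap (U *m schur_mx z t *m U^t*) (fun i => schur_mx z t i i) ord0 =
  sqnorm z t N.+1.
Proof.
move=> uU; have -> : schur_mx z t = triang z t N.+1 by apply/matrixP => i j; rewrite !mxE.
set T := triang z t N.+1; set lam := fun i => T i i => li.
have lamE i : lam i = eigen z t i by rewrite /lam mxE leqnn.
have lam0 : lam ord0 = z by rewrite lamE.
have li0 : leftrow z t N.+1 0 ord0 = 1 by exact: leftrow0.
rewrite (diag_overlap_unitary (l := leftrow z t N.+1) li)//.
- by rewrite sqnorm_row.
- move=> j; rewrite -det_tr det_trig; last first.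
    apply/is_trig_mxP => i k ik; rewrite !mxE leqNgt ik/=.
    by rewrite -val_eqE gtn_eqF// subr0.
  have jj0 : (T - (lam j)%:M)^T j j = 0.
    by rewrite [LHS]mxE [LHS]mxE [X in _ + X]mxE [X in _ - X]mxE eqxx mulr1n subrr.
  by rewrite (bigD1 j)//= jj0 mul0r.
- rewrite lam0; apply: leftrow_eigen => j /andP[j0 jN].
  apply/eqP => ez; have : lam (Ordinal jN) = lam ord0 by rewrite lam0 lamE.
  by move=> /li/(congr1 val)/= j00; rewrite j00 in j0.
- apply/colP => i; rewrite -colE [RHS]mxE [delta_mx _ _ _ _]mxE eqxx andbT lam0 mxE mxE.
  have [->|i0] := eqVneq i ord0; first by rewrite mulr1.
  rewrite mulr0; case: ifP => //; rewrite leqn0 => /eqP i00.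
  by case/eqP: i0; exact: val_inj.
Qed.

End Overlap.

(** * Expectations computed from the density *)

Section Density.
Context d (T : measurableType d) (R : realType).
Local Open Scope ereal_scope.
Import HBNNSimple.

(** Monotone approximation by simple functions reduces the identity to indicators, where it is the
    hypothesis on [nu]. *)
Lemma integral_density (mu nu : {measure set T -> \bar R}) (g : T -> R) (f : T -> \bar R) :
  measurable_fun setT g -> (forall x, (0 <= g x)%R) ->
  (forall A, measurable A -> nu A = \int[mu]_(x in A) (g x)%:E) ->
  measurable_fun setT f -> (forall x, 0 <= f x) ->
  \int[nu]_x f x = \int[mu]_x (f x * (g x)%:E).
Proof.
move=> mg g0 nuE mf f0.
pose h := nnsfun_approx measurableT mf.
have ch x : (EFin \o h n) x @[n --> \oo] --> f x by exact: cvg_nnsfun_approx.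
have mgE : measurable_fun setT (EFin \o g) by exact/measurable_EFinP.
have -> : \int[nu]_x f x = lim (\int[nu]_x (EFin \o h n) x @[n --> \oo]).
  under eq_integral do rewrite -(cvg_lim _ (ch _))//.
  apply: monotone_convergence => //.
  - by move=> n; apply/measurable_EFinP.
  - by move=> n x _ /=; rewrite lee_fin.
  - by move=> x _ a b ab; rewrite lee_fin; exact/lefP/nd_nnsfun_approx.
have -> : \int[mu]_x (f x * (g x)%:E) =
    lim (\int[mu]_x ((EFin \o h n) x * (g x)%:E) @[n --> \oo]).
  have cg x : (EFin \o h n) x * (g x)%:E @[n --> \oo] --> f x * (g x)%:E.
    exact: cvgeZr.
  under eq_integral do rewrite -(cvg_lim _ (cg _))//.
  apply: monotone_convergence => //.
  - by move=> n; apply: emeasurable_funM => //; exact/measurable_EFinP.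
  - by move=> n x _ /=; rewrite mule_ge0 ?lee_fin.
  - by move=> x _ a b ab/=; rewrite lee_wpmul2r ?lee_fin//; exact/lefP/nd_nnsfun_approx.
congr (lim (_ @ \oo)); apply/funext => n.
have indich r : measurable_fun setT (fun x => (r * \1_(h n @^-1` [set r]) x)%:E).
  by apply: (measurable_comp measurableT) => //; exact: measurable_funM.
transitivity (\int[nu]_x (\sum_(y \in range (h n)) (y * \1_(h n @^-1` [set y]) x)%:E)).
  by apply: eq_integral => t tE; rewrite /= fimfunE -fsumEFin.
rewrite ge0_integral_fsum//; last by move=> m y Ey; exact: nnfun_muleindic_ge0.
transitivity (\int[mu]_x (\sum_(y \in range (h n))
    (y * \1_(h n @^-1` [set y]) x)%:E * (g x)%:E)); last first.
  apply: eq_integral => x _.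
  rewrite -ge0_mule_fsuml => [|y]; last exact: nnfun_muleindic_ge0.
  by rewrite fsumEFin // -(fimfunE _ x).
rewrite ge0_integral_fsum//; last 2 first.
- by move=> y; apply: emeasurable_funM.
- by move=> m y Ey; rewrite mule_ge0 ?lee_fin// -lee_fin nnfun_muleindic_ge0.
apply: eq_fsbigr => r rhn.
under [LHS]eq_integral do rewrite EFinM.
rewrite integralZl_indic_nnsfun => //.
under [RHS]eq_integral do rewrite EFinM -muleA.
have r0 : (0 <= r)%R by move: rhn; rewrite inE => -[x _ <-].
have mr : measurable (h n @^-1` [set r]) by exact: measurable_sfunP.
rewrite ge0_integralZl//.
- rewrite integral_indic// setIT nuE//; congr (_ * _).
  rewrite integral_mkcond; apply: eq_integral => x _.
  by rewrite epatch_indic muleC.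
- apply: emeasurable_funM => //; exact/measurable_EFinP.
- by move=> x _; rewrite mule_ge0 ?lee_fin.
Qed.

End Density.

Section OverlapLaw.
Context {R : realType}.
Local Notation C := R[i].
Local Notation CR := (measurableTypeR R * measurableTypeR R)%type.
Local Notation mu := (@lebesgue_measure R).
Local Open Scope sesquilinear_scope.
Local Open Scope ereal_scope.

(** Matrices with a repeated eigenvalue, to which [overlap] assigns the value 0, thus carry no
    mass. *)
Lemma sph_weight_neq0 (z : C) N (t : schur_coords R N.+1) :
  injective (fun i => schur_mx z t i i) <-> (sph_weight (schur_mx z t) != 0)%R.
Proof.
set T := schur_mx z t; rewrite /sph_weight.
have dT := posdef_det_gt0 (posdef_gram T).
split=> [li|].
  apply/lt0r_neq0.
  suff /posC_real[_] : (0 < (\prod_(i < N.+1) \prod_(j < N.+1 | (i < j)%N) `|T i i - T j j| ^+ 2)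
      / \det (1%:M + T *m T^t*) ^+ (2 * N.+1))%R by [].
  rewrite divr_gt0 ?exprn_gt0//; apply: prodr_gt0 => i _; apply: prodr_gt0 => j ij.
  rewrite exprn_gt0// normr_gt0 subr_eq0; apply/eqP => /li ji.
  by move: ij; rewrite ji ltnn.
apply: contra_neqP => nli.
have [i [j [ij Tij]]] : exists i j : 'I_N.+1, (i < j)%N /\ T i i = T j j.
  apply: contrapT => H; apply: nli => i j Tij; apply: val_inj.
  have [ij|ji|//] := ltngtP i j; exfalso; apply: H.
    by exists i, j.
  by exists j, i.
rewrite (bigD1 i)//= (bigD1 j)//= Tij subrr normr0 expr0n/= !mul0r.
done.
Qed.

Section Law.
Variables (z : C) (n : nat) (d : measure_display) (W : measurableType d).
Variables (P : probability W R) (X : {RV P >-> schur_coords R n.+2}).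
Hypothesis hX : sph_schur_law_given z X.

Let w (t : schur_coords R n.+2) : R := sph_weight (schur_mx z t).

Lemma sph_weight_ge0 t : (0 <= w t)%R.
Proof.
have [c [c0 wE]] := sph_weight_schur z n.
by rewrite /w wE mulr_ge0 ?(ltW c0)// schur_weight_ge0.
Qed.

Lemma measurable_sph_weight : measurable_fun setT w.
Proof.
have [c [c0 wE]] := sph_weight_schur z n.
rewrite (_ : w = fun t => c * schur_weight z n (fun i : 'I_n.+1 => i : nat) t)%R.
  apply: measurable_funM => //.
  exact: (@Tmeas_schur_weight _ z (ncoord n.+1) n n.+1 (fun i : 'I_n.+1 => i : nat)).
by apply/funext => t; rewrite /w wE.
Qed.

Lemma schur_law_density : exists c : R, (0 <= c)%R /\ forall f : schur_coords R n.+2 -> \bar R,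
  measurable_fun setT f -> (forall t, 0 <= f t) ->
  \int[P]_x f (X x) = \int[lebesgue_tuple R _]_t (f t * (c * w t)%:E).
Proof.
have [c cP] := hX; exists c.
(* [sph_schur_law_given] only provides a real constant; a negative one would make the total mass at
   most 0 instead of 1. *)
have c0 : (0 <= c)%R.
  rewrite leNgt; apply/negP => c0.
  have := cP setT measurableT; rewrite preimage_setT probability_setT => E.
  have : \int[lebesgue_tuple R _]_t (c * w t)%:E <= 0.
    have w0 t : 0 <= (- c * w t)%:E by rewrite lee_fin mulr_ge0 ?sph_weight_ge0// oppr_ge0 ltW.
    rewrite (eq_integral (fun t => - (- c * w t)%:E)); last first.
      by move=> t _; rewrite -EFinN mulNr opprK.
    by rewrite integral_ge0N// oppe_le0 integral_ge0.
  by rewrite -E lee_fin ler10.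
split => // f mf f0.
rewrite -(ge0_integral_distribution X)//.
apply: (@integral_density _ _ R (lebesgue_tuple R _) (distribution P X) (fun t => c * w t)%R).
- by apply: measurable_funM => //; exact: measurable_sph_weight.
- by move=> t; rewrite mulr_ge0// sph_weight_ge0.
- by move=> A mA; exact: cP.
- exact: mf.
- exact: f0.
Qed.

(** The accumulated constants do not depend on F. For F = 1 the integral on the right is B(2, n + 1)
    = 1 / ((n + 1) (n + 2)), which determines their product. *)
Lemma overlap_law (F : R -> \bar R) : measurable_fun setT F -> (forall x, 0 <= F x) ->
  \int[P]_x F (sqnorm z (X x) n.+2) =
  (n.+1 * n.+2)%:R%:E * \int[mu]_x ((ooind 0 1 x * (x ^+ 1 * (1 - x) ^+ n))%:E * F x^-1%R).
Proof.
have [c [c0 cP]] := schur_law_density.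
have [c1 [c10 wE]] := sph_weight_schur z n.
have [K [K0 KP]] := @schur_integral R z n n.+1 (fun i => i : nat) (@ord_inj _) (fun i =>
  ltn_ord i).
have [L [L0 LP]] := @beta_ops_iota R n.
have E F' : measurable_fun setT F' -> (forall x, 0 <= F' x) ->
  \int[P]_x F' (sqnorm z (X x) n.+2) = ((c * c1)%:E * (K * L)) *
   \int[mu]_x ((ooind 0 1 x * (x ^+ 1 * (1 - x) ^+ n))%:E * F' x^-1%R).
  move=> mF F0.
  have mS : Tmeas (ncoord n.+1) (fun t => F' (sqnorm z t n.+2)).
    by apply: (measurableT_comp mF); exact: Tmeas_sqnorm.
  rewrite (cP (fun t => F' (sqnorm z t n.+2)))//.
  pose g (t : seq CR) := F' (sqnorm z t n.+2) *
    (schur_weight z n (fun i : 'I_n.+1 => i : nat) t)%:E.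
  transitivity (Tint (ncoord n.+1) (fun t => (c * c1)%:E * g t)).
    by apply: eq_integral => t _; rewrite /w wE /g mulrA EFinM muleCA.
  rewrite TintZl; last 3 first.
  - apply: emeasurable_funM => //; apply/measurable_EFinP.
    exact: Tmeas_schur_weight.
  - by move=> t; rewrite mule_ge0// lee_fin schur_weight_ge0.
  - by rewrite lee_fin mulr_ge0// ltW.
  rewrite KP// -muleA; congr (_ * _); rewrite -muleA; congr (_ * _).
  by rewrite val_enum_ord LP// integral_overlap_inv.
set D := (c * c1)%:E * (K * L) in E.
have DE : D = (n.+1 * n.+2)%:R%:E.
  have P1 : \int[P]_x (cst 1 x) = 1 :> \bar R.
    rewrite (@integral_cst _ _ _ P setT measurableT 1). rewrite mul1e;
      exact: (probability_setT P).
  have := E (cst 1) (measurable_cst _) (fun=> lee01).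
  rewrite [LHS]P1.
  under eq_integral do rewrite mule1.
  rewrite integral_unit_beta beta_fun_fact.
  set b := (_ / _)%R => /esym Db.
  have bE : b = ((n.+1 * n.+2)%:R)^-1%R.
    rewrite /b -[1`!]/1%N mul1n add1n !factS !natrM.
    have nf : (n`!%:R != 0 :> R)%R by rewrite pnatr_eq0 -lt0n fact_gt0.
    have n1 : (n.+1%:R != 0 :> R)%R by rewrite pnatr_eq0.
    have n2 : (n.+2%:R != 0 :> R)%R by rewrite pnatr_eq0.
    move: nf n1 n2; move: (n`!%:R : R) (n.+1%:R : R) (n.+2%:R : R) => u v x u0 v0 x0.
    by field; rewrite u0 v0 x0.
  have b0 : b != 0%R by rewrite bE invr_eq0 pnatr_eq0.
  (* D is a priori an element of [0, +oo]; as b is finite and nonzero, it is recovered from D b =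
     1. *)
  have : D * b%:E * (b^-1)%:E = (b^-1)%:E by rewrite Db mul1e.
  by rewrite -muleA -EFinM mulfV// mule1 bE invrK.
by move=> mF F0; rewrite E// DE.
Qed.

End Law.
End OverlapLaw.

(** * Convergence of the densities *)

Section Limit.
Context {R : realType}.
Local Notation mu := (@lebesgue_measure R).

Lemma cvg_div_nat2 (y : R) : y / n.+2%:R @[n --> \oo] --> (0 : R).
Proof.
rewrite -[X in _ --> X](mulr0 y); apply: cvgM; first exact: cvg_cst.
by have := @cvg_harmonic R; rewrite -cvg_shiftS.
Qed.

Lemma near_div_nat2_lt1 (y : R) : \forall n \near \oo, y / n.+2%:R < 1.
Proof. by apply: (cvgr_lt _ (cvg_div_nat2 y)); exact: ltr01. Qed.

(** Both bounds are instances of 1 + x <= exp x: at -u, and at u / (1 - u), since 1 / (1 - u) = 1 +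
    u / (1 - u). With u = y / (n + 2) one has n u = y - 2 u. *)
Lemma onem_pow_le (y : R) n : 0 <= y -> y / n.+2%:R < 1 ->
  expR (- ((y - 2 * (y / n.+2%:R)) / (1 - y / n.+2%:R))) <= (1 - y / n.+2%:R) ^+ n
    <= expR (- (y - 2 * (y / n.+2%:R))).
Proof.
move=> y0 yN; set u := y / n.+2%:R.
have u1 : 0 < 1 - u by rewrite subr_gt0.
have yE : y - 2 * u = n%:R * u.
  have -> : y = n.+2%:R * u by rewrite /u mulrCA mulfV ?mulr1// pnatr_eq0.
  by rewrite -mulrBl -natrB// subn2.
apply/andP; split.
  rewrite yE -mulrA -mulrN expRM_natl lerXn2r ?nnegrE ?expR_ge0 ?(ltW u1)//.
  rewrite expRN -[leRHS]invrK lef_pV2 ?posrE ?expR_gt0 ?invr_gt0//.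
  by rewrite (le_trans _ (expR_ge1Dx _))// le_eqVlt; apply/orP; left; apply/eqP; field;
    rewrite gt_eqF.
rewrite yE -(mulrN n%:R u) expRM_natl lerXn2r ?nnegrE ?expR_ge0 ?(ltW u1)//.
exact: expR_ge1Dx.
Qed.

Lemma cvg_onem_pow (y : R) : 0 <= y ->
  (1 - y / n.+2%:R) ^+ n @[n --> \oo] --> expR (- y).
Proof.
move=> y0.
have cu := cvg_div_nat2 y.
have c1 : 1 - y / n.+2%:R @[n --> \oo] --> (1 - 0 : R) by apply: cvgB => //; exact: cvg_cst.
have c2 : y - 2 * (y / n.+2%:R) @[n --> \oo] --> (y - 2 * 0 : R).
  by apply: cvgB; [exact: cvg_cst|apply: cvgM => //; exact: cvg_cst].
apply: (@squeeze_cvgr _ _ _ _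
  (fun n => expR (- ((y - 2 * (y / n.+2%:R)) / (1 - y / n.+2%:R)))) (fun n => expR (- (y - 2 *
    (y / n.+2%:R))))).
- near=> n; apply: onem_pow_le => //.
  by near: n; exact: near_div_nat2_lt1.
- rewrite (_ : - y = - ((y - 2 * 0) / (1 - 0))); last by rewrite mulr0 !subr0 divr1.
  apply: continuous_cvg; first exact: continuous_expR.
  by apply: cvgN; apply: cvgM => //; apply: cvgV => //; rewrite subr0 oner_neq0.
- rewrite [X in _ --> expR (- X)](_ : y = y - 2 * 0); last by rewrite mulr0 subr0.
  apply: continuous_cvg; first exact: continuous_expR.
  exact: cvgN.
Unshelve. all: by end_near. Qed.

Lemma gamma2_pdf_ge0 (y : R) : 0 <= gamma2_pdf y.
Proof. by rewrite /gamma2_pdf; case: ltP => // y0; rewrite mulr_ge0 ?expR_ge0 ?ltW. Qed.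

Lemma measurable_gamma2_pdf : measurable_fun setT (@gamma2_pdf R).
Proof.
apply: measurable_fun_ifT => //; first exact: measurable_fun_ltr.
apply: measurable_funM => //; apply: (measurableT_comp (@measurable_expR R)).
exact: oppr_measurable.
Qed.

(** The density of N / S for N = n + 2, obtained from (n + 1) (n + 2) x (1 - x)^n by x = y / N. *)
Definition overlap_pdf n (y : R) : R :=
  n.+1%:R / n.+2%:R * (ooind 0 1 (y / n.+2%:R) * (y * (1 - y / n.+2%:R) ^+ n)).

(** The constant exp 2 bounds exp (2 y / N) for y < N, which is the price of having the exponent N -
    2 instead of N. *)
Lemma overlap_pdf_bound n y : 0 <= overlap_pdf n y <= expR 2 * gamma2_pdf y.
Proof.
rewrite /overlap_pdf /ooind; have N0 : (0 < n.+2%:R :> R) by rewrite ltr0n.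
have [/andP[u0 u1]|_] := boolP ((0 < y / n.+2%:R) && (y / n.+2%:R < 1)); last first.
  by rewrite mul0r mulr0 lexx mulr_ge0 ?expR_ge0 ?gamma2_pdf_ge0.
have y0 : 0 < y by move: u0; rewrite pmulr_lgt0// invr_gt0.
have /andP[_ h] := onem_pow_le (ltW y0) u1.
have c1 : n.+1%:R / n.+2%:R <= 1 :> R by rewrite ler_pdivrMr// mul1r ler_nat.
have p0 : 0 <= (1 - y / n.+2%:R) ^+ n by rewrite exprn_ge0// subr_ge0 ltW.
rewrite mul1r /gamma2_pdf y0; apply/andP; split.
  by rewrite !mulr_ge0// ltW.
apply: (@le_trans _ _ (1 * (y * expR (- (y - 2 * (y / n.+2%:R)))))).
  by rewrite ler_pM// ?mulr_ge0 ?(ltW y0)// ler_wpM2l// ltW.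
rewrite mul1r [leRHS]mulrCA; apply: ler_wpM2l; first exact: ltW.
rewrite -expRD ler_expR opprB; apply: lerB => //.
by rewrite ler_piMr// ltW.
Qed.

Lemma cvg_overlap_pdf y : overlap_pdf n y @[n --> \oo] --> gamma2_pdf y.
Proof.
rewrite /gamma2_pdf; case: ltP => y0; last first.
  rewrite (_ : (fun n => _) = cst 0); first exact: cvg_cst.
  apply/funext => n; rewrite /overlap_pdf /ooind pmulr_lgt0 ?invr_gt0// ltNge y0/=.
  by rewrite mul0r mulr0.
have c : (1 - 1 / n.+2%:R) * (y * (1 - y / n.+2%:R) ^+ n) @[n --> \oo] -->
    (1 - 0) * (y * expR (- y)).
  apply: cvgM; first by apply: cvgB; [exact: cvg_cst|exact: cvg_div_nat2].
  by apply: cvgM; [exact: cvg_cst|apply: cvg_onem_pow; exact: ltW].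
rewrite subr0 mul1r in c; apply: cvg_trans c; apply: near_eq_cvg.
near=> n; rewrite /overlap_pdf /ooind divr_gt0//=.
have -> : y / n.+2%:R < 1 by near: n; exact: near_div_nat2_lt1.
rewrite !mul1r; congr (_ * _).
have N0 : n.+2%:R != 0 :> R by rewrite pnatr_eq0.
by apply: (mulIf N0); rewrite mulrBl mul1r mulVf// divfK// -[n.+2%:R]natr1 addrK.
Unshelve. all: by end_near. Qed.

Lemma measurable_overlap_pdf n : measurable_fun setT (overlap_pdf n).
Proof.
apply: measurable_funM => //; apply: measurable_funM.
  by apply: measurable_ooind => //; exact: measurable_funM.
apply: measurable_funM => //; apply: measurable_funX; apply: measurable_funB => //.
exact: measurable_funM.
Qed.

Local Open Scope ereal_scope.

Lemma cvg_overlap_integral (h : R -> R) (M : R) :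
  mu.-integrable setT (EFin \o @gamma2_pdf R) -> measurable_fun setT h ->
  (forall y, (0 <= h y <= M)%R) ->
  \int[mu]_y (overlap_pdf n y * h y)%:E @[n --> \oo] --> \int[mu]_y (gamma2_pdf y * h y)%:E.
Proof.
move=> ig mh hM.
have M0 : (0 <= M)%R by have /andP[h0 h1] := hM 0%R; exact: le_trans h1.
pose f_ n y : \bar R := (overlap_pdf n y * h y)%:E.
pose g y : \bar R := (M * expR 2)%:E * (gamma2_pdf y)%:E.
have [] := @dominated_convergence _ _ R mu setT measurableT f_
  (fun y => (gamma2_pdf y * h y)%:E) g; last by [].
- by move=> n; apply/measurable_EFinP; apply: measurable_funM => //;
  exact: measurable_overlap_pdf.
- by apply/measurable_EFinP; apply: measurable_funM => //; exact: measurable_gamma2_pdf.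
- apply: aeW => y _; apply/cvg_EFin; first exact: nearW.
  by apply: cvgM; [exact: cvg_overlap_pdf|exact: cvg_cst].
- exact: integrableZl.
- apply: aeW => y n _; have /andP[p0 p1] := overlap_pdf_bound n y.
  have /andP[h0 h1] := hM y.
  rewrite /f_ /g abse_EFin -EFinM lee_fin (ger0_norm (mulr_ge0 p0 h0)).
  by rewrite mulrC -mulrA; exact: ler_pM.
Qed.

(** Adding M makes a bounded test function nonnegative, so that the laws stated for nonnegative
    functions apply to it. *)
Lemma integral_bounded_shift d (W : measurableType d) (P : probability W R)
    (Y : W -> R) (f : R -> R) (M : R) : measurable_fun setT Y ->
  measurable_fun setT f -> (forall x, `|f x| <= M)%R ->
  'E_P[f \o Y] = \int[P]_w (f (Y w) + M)%:E - M%:E.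
Proof.
move=> mY mf fM; rewrite unlock.
have P1 : P setT = 1 := probability_setT P.
have mfY : measurable_fun setT (f \o Y) by exact: measurableT_comp.
have i1 : P.-integrable setT (EFin \o (f \o Y)).
  apply: measurable_bounded_integrable => //; first by rewrite -ge0_fin_numE// fin_num_measure.
  exists M; split; first exact: num_real.
  by move=> x Mx y _ /=; rewrite (le_trans (fM _))// ltW.
have i2 : P.-integrable setT (EFin \o cst M) by exact: finite_measure_integrable_cst.
under [in RHS]eq_integral do rewrite EFinD.
have PM : \int[P]_w (cst M w)%:E = M%:E.
  rewrite (integral_cst P measurableT M%:E).
  by transitivity (M%:E * 1); [congr (_ * _); exact: P1|rewrite mule1].
by rewrite (integralD measurableT i1 i2) PM addeK.
Qed.

End Limit.

(** * The overlap as a random variable *)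

Section RandomOverlap.
Context {R : realType}.
Local Notation C := R[i].
Local Notation mu := (@lebesgue_measure R).
Local Open Scope sesquilinear_scope.
Local Open Scope ereal_scope.
Variables (z : C) (n : nat) (d : measure_display) (W : measurableType d).
Variables (P : probability W R) (X : {RV P >-> schur_coords R n.+2}).
Variable U : W -> 'M[C]_n.+2.
Hypothesis hX : sph_schur_law_given z X.
Hypothesis hU : forall w, U w \is unitarymx.

Definition random_overlap w : R :=
  diag_overlap ((U w *m schur_mx z (X w) *m (U w)^t*)%R : 'M[C]_n.+2)
    (fun i => schur_mx z (X w) i i) ord0.

(** The overlap as a function of the Schur coordinates alone; the value 0 is the default of
    [overlap] outside simple spectra. *)
Let g (t : schur_coords R n.+2) : R :=
  if (sph_weight (schur_mx z t) != 0)%R then sqnorm z t n.+2 else 0%R.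

Lemma random_overlapE w : random_overlap w = g (X w).
Proof.
rewrite /random_overlap /g; case: ifPn => [|/negP wX].
  by move=> /sph_weight_neq0; exact: diag_overlap_schur.
by apply: diag_overlap_degenerate => li; apply: wX; apply/sph_weight_neq0.
Qed.

Let mg : measurable_fun setT g.
Proof.
apply: measurable_fun_ifT => //; last exact: Tmeas_sqnorm.
apply: measurable_neg; apply: measurable_fun_eqr => //.
exact: measurable_sph_weight.
Qed.

(** [U] is an arbitrary unitary-valued function, but the overlap does not depend on it and is a
    measurable function of [X]. *)
Lemma measurable_random_overlap : measurable_fun setT random_overlap.
Proof.
rewrite (_ : random_overlap = g \o X); first exact: measurableT_comp.
by apply/funext => w; exact: random_overlapE.
Qed.

Lemma random_overlap_ge0 w : (0 <= random_overlap w)%R.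
Proof. by rewrite random_overlapE /g; case: ifP => // _; exact: sqnorm_ge0. Qed.

Lemma random_overlap_law (F : R -> \bar R) : measurable_fun setT F -> (forall x, 0 <= F x) ->
  \int[P]_w F (random_overlap w) =
  (n.+1 * n.+2)%:R%:E * \int[mu]_x ((ooind 0 1 x * (x ^+ 1 * (1 - x) ^+ n))%:E * F x^-1%R).
Proof.
move=> mF F0; rewrite -(overlap_law hX mF F0).
have [c [c0 cP]] := schur_law_density hX.
under eq_integral do rewrite random_overlapE.
have mFg : measurable_fun setT (F \o g) by exact: measurableT_comp.
have mFs : measurable_fun setT (fun t : schur_coords R n.+2 => F (sqnorm z t n.+2)).
  by apply: (measurableT_comp mF); exact: (@Tmeas_sqnorm R z (ncoord n.+1)).
rewrite (cP _ mFg (fun t => F0 (g t))) (cP _ mFs (fun t => F0 (sqnorm z t n.+2))).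
(* [g] differs from the squared norm only where the density vanishes. *)
apply: eq_integral => t _; rewrite /g /=; case: eqP => //= ->.
by rewrite mulr0 !mule0.
Qed.

Lemma random_overlap_mean : 'E_P[random_overlap] = n.+2%:R%:E.
Proof.
rewrite unlock; pose F (x : R) : \bar R := `|x|%:E.
have mF : measurable_fun setT F by apply/measurable_EFinP; exact: normr_measurable.
have F0 x : 0 <= F x by rewrite lee_fin.
transitivity (\int[P]_w F (random_overlap w)).
  by apply: eq_integral => w _; rewrite /F ger0_norm// random_overlap_ge0.
rewrite (random_overlap_law mF F0).
have -> : \int[mu]_x ((ooind 0 1 x * (x ^+ 1 * (1 - x) ^+ n))%:E * F x^-1%R) =
    \int[mu]_x (ooind 0 1 x * (x ^+ 0 * (1 - x) ^+ n))%:E.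
  apply: eq_integral => x _; rewrite /F -EFinM /ooind; congr (_%:E).
  case: (ltP 0%R x) => x0; last by rewrite !mul0r.
  rewrite gtr0_norm ?invr_gt0// expr1 expr0 mul1r -mulrA; congr (_ * _)%R.
  by rewrite mulrAC mulfV ?mul1r// gt_eqF.
rewrite integral_unit_beta beta_fun1Sn -EFinM natrM mulrC mulrA mulVf ?mul1r//.
Qed.

Lemma random_overlap_scaled (h : R -> R) : measurable_fun setT h -> (forall x, 0 <= h x)%R ->
  \int[P]_w (h (n.+2%:R^-1 * random_overlap w))%:E =
  \int[mu]_y (overlap_pdf n y * h y^-1)%:E.
Proof.
move=> mh h0; pose F (x : R) : \bar R := (h (n.+2%:R^-1 * x))%:E.
have N0 : (0 < n.+2%:R :> R)%R by rewrite ltr0n.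
have Nn := lt0r_neq0 N0.
have mF : measurable_fun setT F.
  by apply/measurable_EFinP; apply: (measurableT_comp mh); exact: measurable_funM.
have F0 x : 0 <= F x by rewrite lee_fin.
rewrite (random_overlap_law mF F0).
pose G x := (ooind 0 1 x * (x ^+ 1 * (1 - x) ^+ n))%:E * F x^-1%R.
have mG : measurable_fun setT G.
  apply: emeasurable_funM.
    apply/measurable_EFinP; apply: measurable_funM; first exact: measurable_ooind.
    by apply: measurable_funM => //; apply: measurable_funX; exact: measurable_funB.
  by apply: (measurableT_comp mF); exact: measurable_fun_inv.
have G0 x : 0 <= G x.
  apply: mule_ge0; last exact: F0.
  rewrite lee_fin /ooind.
  have [/andP[x0 x1]|_] := boolP ((0 < x) && (x < 1))%R; last by rewrite mul0r.
  by rewrite mul1r mulr_ge0 ?expr1 ?exprn_ge0 ?subr_ge0// ltW.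
have E := @ge0_integral_affine R n.+2%:R^-1%R 0%R G.
rewrite normfV invrK gtr0_norm// in E.
(* The substitution x = y / N, under which the scaled overlap 1 / (N x) becomes 1 / y. *)
have {}E : \int[mu]_x G x = (n.+2%:R^-1)%:E * \int[mu]_x G (n.+2%:R^-1 * x + 0)%R.
  by rewrite E ?invr_eq0// muleA -EFinM mulVf// mul1e.
rewrite -/(G _) E muleA -EFinM natrM mulfK// -ge0_integralTZl//; last first.
  by apply: (measurableT_comp mG); exact: measurable_affine.
apply: eq_integral => y _; rewrite addr0 /G /F /overlap_pdf -!EFinM; congr (_%:E).
rewrite mulrA; congr (_ * h _)%R; last by rewrite invfM invrK mulrA mulVf// mul1r.
by rewrite [(n.+2%:R^-1 * y)%R]mulrC expr1; ring.
Qed.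

End RandomOverlap.

Lemma integral_gamma2 (R : realType) d (W : measurableType d) (P : probability W R)
    (gamma2 : {RV P >-> measurableTypeR R}) (F : R -> \bar R) :
  has_density (@lebesgue_measure R) (@gamma2_pdf R) gamma2 ->
  measurable_fun setT F -> (forall x, 0 <= F x)%E ->
  (\int[P]_w F (gamma2 w) = \int[@lebesgue_measure R]_y (F y * (gamma2_pdf y)%:E))%E.
Proof.
move=> hg mF F0; rewrite -(ge0_integral_distribution gamma2)//.
apply: (@integral_density _ _ R (@lebesgue_measure R) (distribution P gamma2) (@gamma2_pdf R)).
- exact: measurable_gamma2_pdf.
- exact: gamma2_pdf_ge0.
- by move=> A mA; exact: hg.
- exact: mF.
- exact: F0.
Qed.

(** The integral of the density is the total mass of the law of [gamma2], hence finite; no Gamma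
    integral is evaluated. *)
Lemma integrable_gamma2_pdf (R : realType) d (W : measurableType d) (P : probability W R)
    (gamma2 : {RV P >-> measurableTypeR R}) :
  has_density (@lebesgue_measure R) (@gamma2_pdf R) gamma2 ->
  (@lebesgue_measure R).-integrable setT (EFin \o @gamma2_pdf R).
Proof.
move=> hg; apply/integrableP; split.
  by apply/measurable_EFinP; exact: measurable_gamma2_pdf.
under eq_integral do rewrite /= ger0_norm ?gamma2_pdf_ge0//.
have := hg setT measurableT; rewrite preimage_setT => <-.
by rewrite -ge0_fin_numE// fin_num_measure.
Qed.

Local Open Scope sesquilinear_scope.

(* N = n.+2, so that n : nat ranges over all N >= 2. Conditionally on
   lambda_1 = z, the matrix is G n = U T U^*, where T has Schur coordinates X n. *)
Theorem theorem1p1 (R : realType) (z : R[i])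
    (d : nat -> measure_display) (W : forall n, measurableType (d n))
    (P : forall n, probability (W n) R)
    (X : forall n, {RV (P n) >-> schur_coords R n.+2})
    (U : forall n, W n -> 'M[R[i]]_n.+2)
    (hX : forall n, sph_schur_law_given z (X n))
    (hU : forall n w, U n w \is unitarymx)
    (d' : measure_display) (W' : measurableType d') (P' : probability W' R)
    (gamma2 : {RV P' >-> measurableTypeR R})
    (hgamma2 : has_density (@lebesgue_measure R) (@gamma2_pdf R) gamma2) :
  let T n w := schur_mx z (X n w) in
  let G n w := U n w *m T n w *m (U n w)^t* in
  let O11 n w := diag_overlap (G n w) (fun i => T n w i i) ord0 in
  (forall n, 'E_(P n)[ O11 n ]%E = (n.+2%:R)%:E) /\
  cvg_in_law P (fun n w => (n.+2%:R)^-1 * O11 n w) P' (fun w => (gamma2 w)^-1).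
Proof.
move=> T G O11; split => [n|f cf [M fM]].
  exact: (random_overlap_mean (hX n) (hU n)).
have mf : measurable_fun setT f by exact: continuous_measurable_fun.
(* The shifted test function takes values in [0, 2 M]; the constant M is subtracted again on both
   sides of the limit. *)
pose h y := f y + M.
have h0 y : 0 <= h y.
  by have := fM y; rewrite ler_norml => /andP[]; rewrite -subr_ge0 opprK.
have hM y : h y <= M + M.
  by have := fM y; rewrite ler_norml => /andP[_]; rewrite /h lerD2r.
have mh : measurable_fun setT h by exact: measurable_funD.
have mhV : measurable_fun setT (fun y : measurableTypeR R => h y^-1).
  by apply: (measurableT_comp mh); exact: measurable_fun_inv.
have mV : measurable_fun setT (fun w => (gamma2 w)^-1).
  apply: measurable_fun_inv; exact: (measurable_funP gamma2).
have mO n : measurable_fun setT (fun w => (n.+2%:R)^-1 * O11 n w).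
  apply: measurable_funM => //.
  exact: (measurable_random_overlap z (X n) (hU n)).
(* The whole dependence on N moves into the density, tested against the fixed function y |-> h (1 /
   y). *)
have -> : (fun n => 'E_(P n)[f \o (fun w => (n.+2%:R)^-1 * O11 n w)%R]%E) =
    (fun n => \int[@lebesgue_measure R]_y (overlap_pdf n y * h y^-1)%R%:E - M%:E)%E.
  apply/funext => n; rewrite (integral_bounded_shift (P n) (mO n) mf fM).
  by rewrite -(random_overlap_scaled (hX n) (hU n) mh h0).
rewrite (integral_bounded_shift P' mV mf fM).
have -> : (\int[P']_w (f (gamma2 w)^-1 + M)%:E =
    \int[@lebesgue_measure R]_y (gamma2_pdf y * h y^-1)%:E)%E.
  have mF : measurable_fun setT (fun y : measurableTypeR R => (h y^-1)%:E).
    exact/measurable_EFinP.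
  rewrite (integral_gamma2 hgamma2 mF) => [|y]; last by rewrite lee_fin.
  by apply: eq_integral => y _; rewrite -EFinM mulrC.
apply: cvgeB; first by rewrite fin_num_adde_defl.
  apply: (@cvg_overlap_integral R (fun y => h y^-1) (M + M)) => //.
    exact: integrable_gamma2_pdf hgamma2.
  by move=> y; rewrite h0 hM.
exact: cvg_cst.
Qed.
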